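(* Work in either the $C^*$-setting or the $W^*$-setting. Let $X=(X(n))_{n\in\mathbb{Z}_+}$ be a standard subproduct system, and let $T$ be a completely contractive, covariant representation of $X$ on a Hilbert space $\mathcal{H}$. Then the following are equivalent: (1) $T$ is relatively isometric. (2) There exist a Hilbert space $\mathcal{U}$, a unitary $W:\mathcal{H}\to\mathcal{K}:=(\mathcal{F}_X\otimes_\sigma\mathcal{D})\oplus\mathcal{U}$ and a fully coisometric, covariant representation $Z=(Z_n)_{n\in\mathbb{Z}_+}$ of $X$ on $\mathcal{U}$ such that $WT_n(\zeta)W^{-1}=(S_n(\zeta)\otimes I_{\mathcal{D}})\oplus Z_n(\zeta)$ for all $n\in\mathbb{Z}_+$, $\zeta\in X(n)$. Moreover, when these conditions hold, $\mathcal{U}$ may be chosen to be $\{0\}$ if and only if $T$ is pure.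
   Context: Conventions. Hilbert spaces are complex; $C^*$-algebras need not be unital; all representations of operator algebras on Hilbert spaces are assumed nondegenerate. $\mathcal{L}(F)$ denotes the adjointable operators on a Hilbert module $F$. Two settings are considered. $C^*$-setting: $\mathcal{M}$ is a $C^*$-algebra; a correspondence over $\mathcal{M}$ is a right Hilbert $C^*$-module $F$ over $\mathcal{M}$ (inner product $\langle\cdot,\cdot\rangle$ linear in the second variable) with a left action $a\zeta=\varphi(a)\zeta$ given by a $*$-homomorphism $\varphi:\mathcal{M}\to\mathcal{L}(F)$; tensor products are interior tensor products. $W^*$-setting: $\mathcal{M}$ is a von Neumann algebra, correspondences are required to be self-dual with $\varphi$ normal, and tensor products and direct sums of correspondences mean the self-dual completions of the usual ones. For a representation $\sigma$ of $\mathcal{M}$ on $\mathcal{H}$, $F\otimes_\sigma\mathcal{H}$ is the Hilbert space with $(\zeta_1\otimes h_1,\zeta_2\otimes h_2)=(h_1,\sigma(\langle\zeta_1,\zeta_2\rangle)h_2)$. Standard subproduct system: a family $X=(X(n))_{n\in\mathbb{Z}_+}$ of correspondences over $\mathcal{M}$ with $X(0)=\mathcal{M}$ such that $X(n+m)$ is an orthogonally complementable sub-bimodule of $X(n)\otimes X(m)$ for all $n,m$ (where $X(n)\otimes\mathcal{M}$ and $\mathcal{M}\otimes X(n)$ are identified with $X(n)$ via the module actions, so the left actions are nondegenerate). Put $E=X(1)$; then $X(n)\subseteq E^{\otimes n}$ ($E^{\otimes 0}=\mathcal{M}$), and $p_n\in\mathcal{L}(E^{\otimes n})$ is the orthogonal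 projection onto $X(n)$. Completely contractive, covariant representation of $X$ on $\mathcal{H}$: a family $T=(T_n)_{n\in\mathbb{Z}_+}$ of linear maps $T_n:X(n)\to B(\mathcal{H})$ such that $\sigma:=T_0$ is a $C^*$-representation of $\mathcal{M}$ on $\mathcal{H}$; each $T_n$ is completely contractive (with $X(n)$ viewed inside its linking algebra); $T_n(\zeta a)=T_n(\zeta)\sigma(a)$ and $T_n(a\zeta)=\sigma(a)T_n(\zeta)$; and $T_{n+m}(p_{n+m}(\zeta\otimes\eta))=T_n(\zeta)T_m(\eta)$ for $\zeta\in X(n),\eta\in X(m)$. In the $W^*$-setting $\sigma$ is also required to be normal, and each $T_n$ continuous from the $\sigma$-topology of $X(n)$ (generated by the functionals $x\mapsto\sum_i\omega_i(\langle\eta_i,x\rangle)$ with $\omega_i\in\mathcal{M}_*$, $\eta_i\in X(n)$, $\sum_i\|\omega_i\|\|\eta_i\|<\infty$) to the ultraweak topology (this continuity is automatic when $\sigma$ is normal). For each $n$, $\widetilde{T}_n:X(n)\otimes_\sigma\mathcal{H}\to\mathcal{H}$ is the contraction $\widetilde{T}_n(\zeta\otimes h)=T_n(\zeta)h$. A completely contractive, covariant representation $T$ is fully coisometric if $\widetilde{T}_n$ is coisometric for all $n$. (A ''fully coisometric, covariant representation'' is in particular completely contractive.) $T$ is pure if $\widetilde{T}_n\widetilde{T}_n^*\to 0$ in the strong operator topology. $\Delta_*=\Delta_*(T):=(I_{\mathcal{H}}-\widetilde{T}_1\widetilde{T}_1^* )^{1/2}$ and $\mathcal{D}:=\overline{\operatorname{Im}\Delta_*(T)}$.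 $\Delta_*(T)$ commutes with $\sigma(\mathcal{M})$, so $\mathcal{D}$ reduces $\sigma$; the restriction of $\sigma$ to $\mathcal{D}$ is again denoted $\sigma$. $T$ is relatively isometric if all the maps $\widetilde{T}_n$, $n\in\mathbb{Z}_+$, are partial isometries and one (equivalently, both) of the following conditions holds: (a) $X(n)\otimes_\sigma\operatorname{Im}\Delta_*\subseteq\operatorname{Im}\widetilde{T}_n^*$ for all $n\in\mathbb{Z}_+$; (b) $\Delta_*T_n(\zeta)^*T_n(\zeta)\Delta_*=\sigma(\langle\zeta,\zeta\rangle)\Delta_*$ for all $n\in\mathbb{Z}_+$, $\zeta\in X(n)$. $X$-Fock space and shift: $\mathcal{F}_X=\bigoplus_{n\in\mathbb{Z}_+}X(n)$, and for $\zeta\in X(n)$, $S_n(\zeta)\in\mathcal{L}(\mathcal{F}_X)$ is given by $S_n(\zeta)\eta=p_{n+m}(\zeta\otimes\eta)$ for $\eta\in X(m)$; $S_n(\zeta)\otimes I_{\mathcal{D}}$ is the induced operator on $\mathcal{F}_X\otimes_\sigma\mathcal{D}$. *)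

(* Defs.v *)
From HB Require Import structures.
From mathcomp Require Import all_boot all_order all_algebra.
From mathcomp Require Import complex.
From mathcomp Require Import all_classical all_reals all_analysis.

Set Implicit Arguments.
Unset Strict Implicit.
Unset Printing Implicit Defensive.

Import Order.TTheory GRing.Theory Num.Theory.
Import numFieldNormedType.Exports.

Local Open Scope classical_set_scope.
Local Open Scope ring_scope.

(* Norms of complex normed modules take their values in the complex numbers
   (they are real and nonnegative there), so [`|x| ^+ 2 = ip x x] typechecks
   without a conversion. *)
Definition cplx (R : realType) : numClosedFieldType := R[i].

(* Inner products are linear in the second variable. *)
HB.mixin Record isHilbert (R : realType) V & CompleteNormedModule (cplx R) V := {
  ip : V -> V -> cplx R ;
  ipDr : forall x y z, ip x (y + z) = ip x y + ip x z ;
  ipZr : forall c x y, ip x (c *: y) = c * ip x y ;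
  ipC : forall x y, (ip x y)^* = ip y x ;
  ip_norm : forall x, ip x x = `|x| ^+ 2
}.
#[short(type="hilbertType")]
HB.structure Definition Hilbert (R : realType) :=
  {V of isHilbert R V & CompleteNormedModule (cplx R) V}.

(* Not necessarily unital. *)
HB.mixin Record isCstarAlgebra (R : realType) M & CompleteNormedModule (cplx R) M := {
  amul : M -> M -> M ;
  astar : M -> M ;
  amulA : associative amul ;
  amulDl : left_distributive amul +%R ;
  amulDr : right_distributive amul +%R ;
  amulZl : forall (c : cplx R) a b, amul (c *: a) b = c *: amul a b ;
  amulZr : forall (c : cplx R) a b, amul a (c *: b) = c *: amul a b ;
  astarK : involutive astar ;
  astarD : {morph astar : a b / a + b} ;
  astarZ : forall (c : cplx R) a, astar (c *: a) = c^* *: astar a ;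
  astarM : forall a b, astar (amul a b) = amul (astar b) (astar a) ;
  norm_amul : forall a b, `|amul a b| <= `|a| * `|b| ;
  norm_astar : forall a, `|amul (astar a) a| = `|a| ^+ 2
}.
#[short(type="cstarType")]
HB.structure Definition CstarAlgebra (R : realType) :=
  {M of isCstarAlgebra R M & CompleteNormedModule (cplx R) M}.

Definition apos (R : realType) (M : cstarType R) (a : M) : Prop :=
  exists b, a = amul (astar b) b.

HB.mixin Record isHilbertModule (R : realType) (M : cstarType R) F
    & CompleteNormedModule (cplx R) F := {
  ract : F -> M -> F ;
  minner : F -> F -> M ;
  ractDl : forall x y a, ract (x + y) a = ract x a + ract y a ;
  ractDr : forall x a b, ract x (a + b) = ract x a + ract x b ;
  ractZl : forall (c : cplx R) x a, ract (c *: x) a = c *: ract x a ;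
  ractZr : forall (c : cplx R) x a, ract x (c *: a) = c *: ract x a ;
  ractA : forall x a b, ract x (amul a b) = ract (ract x a) b ;
  minnerDr : forall x y z, minner x (y + z) = minner x y + minner x z ;
  minnerZr : forall (c : cplx R) x y, minner x (c *: y) = c *: minner x y ;
  minnerMr : forall x y a, minner x (ract y a) = amul (minner x y) a ;
  minnerC : forall x y, astar (minner x y) = minner y x ;
  minner_ge0 : forall x, apos (minner x x) ;
  minner_norm : forall x, `|minner x x| = `|x| ^+ 2
}.
#[short(type="hmodType")]
HB.structure Definition HilbertModule (R : realType) (M : cstarType R) :=
  {F of isHilbertModule R M F & CompleteNormedModule (cplx R) F}.

(* [lact_adj] says that [lact a] is adjointable with adjoint [lact (astar a)];
   linearity of [lact a] follows from it. *)
HB.mixin Record isCorrespondence (R : realType) (M : cstarType R) F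
    & HilbertModule R M F := {
  lact : M -> F -> F ;
  lactD : forall a b x, lact (a + b) x = lact a x + lact b x ;
  lactZ : forall (c : cplx R) a x, lact (c *: a) x = c *: lact a x ;
  lactM : forall a b x, lact (amul a b) x = lact a (lact b x) ;
  lact_adj : forall a x y,
    minner (lact a x) y = minner x (lact (astar a) y) :> M
}.
#[short(type="corrType")]
HB.structure Definition Correspondence (R : realType) (M : cstarType R) :=
  {F of isCorrespondence R M F & HilbertModule R M F}.

Section Operators.
Variable R : realType.
Local Notation C := (cplx R).

Definition lin_span (V : lmodType C) (A : set V) : set V :=
  [set x | exists (n : nat) (c : 'I_n -> C) (v : 'I_n -> V),
     (forall i, A (v i)) /\ x = \sum_i c i *: v i].

Definition bounded_op (V W : normedModType C) (f : V -> W) : Prop :=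
  linear f /\ continuous f.

(* The operators below are pinned down by properties that determine them
   uniquely; [xget] returns them whenever they exist. *)
Definition adj (G H : hilbertType R) (A : G -> H) : H -> G :=
  xget (fun=> 0) [set B | forall x y, ip (A x) y = ip x (B y)].

Definition positive_op (H : hilbertType R) (P : H -> H) : Prop :=
  bounded_op P /\ forall x, 0 <= ip x (P x).

Definition sqrt_op (H : hilbertType R) (A : H -> H) : H -> H :=
  xget (fun=> 0) [set P | positive_op P /\ forall x, P (P x) = A x].

Definition partial_isometry (G H : hilbertType R) (A : G -> H) : Prop :=
  bounded_op A /\
  forall x, (forall y, A y = 0 -> ip y x = 0) -> `|A x| = `|x|.

Definition coisometry (G H : hilbertType R) (A : G -> H) : Prop :=
  bounded_op A /\ forall y, `|adj A y| = `|y|.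

(* Hilbert space direct sum of G and U, carried by the product module. *)
Definition dsum_ip (G U : hilbertType R) (x y : G * U) : C :=
  ip x.1 y.1 + ip x.2 y.2.

Definition dsum_op (G U : hilbertType R) (A : G -> G) (B : U -> U) (x : G * U) :
  G * U := (A x.1, B x.2).

Definition dsum_unitary (H G U : hilbertType R) (W : H -> G * U) : Prop :=
  [/\ linear W, bijective W & forall x y, dsum_ip (W x) (W y) = ip x y].

Definition representation (M : cstarType R) (H : hilbertType R)
    (pi : M -> H -> H) : Prop :=
  [/\ forall a, bounded_op (pi a),
      forall (c : C) a b h, pi (c *: a + b) h = c *: pi a h + pi b h,
      forall a b h, pi (amul a b) h = pi a (pi b h),
      forall a h k, ip (pi a h) k = ip h (pi (astar a) k) &
      closure (lin_span [set x | exists a h, x = pi a h]) = setT].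

Definition adjoint_pair (M : cstarType R) (F : hmodType M) (A B : F -> F) : Prop :=
  forall x y, minner (A x) y = minner x (B y) :> M.

Definition adjointable (M : cstarType R) (F : hmodType M) (A : F -> F) : Prop :=
  exists B, adjoint_pair A B.

End Operators.

(* V with the coarsest topology that makes every functional in G continuous. *)
Definition wtop (R : realType) (V : Type) (G : set (V -> cplx R)) : Type :=
  initial_topology (fun (x : V) => (fun g : G => sval g x) : {ptws G -> cplx R}).
HB.instance Definition _ (R : realType) (V : choiceType) (G : set (V -> cplx R)) :=
  Topological.on (wtop G).

Section Settings.
Variable R : realType.
Local Notation C := (cplx R).

(* Ultraweakly continuous functionals on B(H), given by their values on bounded
   operators; their values at other functions are irrelevant. *)
Definition uw_functional (H : hilbertType R) : set ((H -> H) -> C) :=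
  [set f | exists xi eta : nat -> H,
    [/\ cvgn (series (fun i => `|xi i| ^+ 2 : C)),
        cvgn (series (fun i => `|eta i| ^+ 2 : C)) &
        forall S, bounded_op S ->
          series (fun i => ip (xi i) (S (eta i)) : C) @ \oo --> f S]].

(* A von Neumann algebra: a C*-algebra M together with an identification with
   a concrete *-algebra of operators that equals its own bicommutant. *)
Record vnAlgebra (M : cstarType R) := VnAlgebra {
  vn_space : hilbertType R ;
  vn_rep : M -> vn_space -> vn_space ;
  vn_repP : representation vn_rep ;
  vn_inj : injective vn_rep ;
  vn_bicommutant : forall S : vn_space -> vn_space, bounded_op S ->
    (forall S' : vn_space -> vn_space, bounded_op S' ->
       (forall a h, S' (vn_rep a h) = vn_rep a (S' h)) ->
       forall h, S (S' h) = S' (S h)) ->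
    exists a, S = vn_rep a
}.

Arguments vn_rep {M} v.

Inductive setting (M : cstarType R) :=
  | CstarSetting
  | WstarSetting of vnAlgebra M.

Definition predual (M : cstarType R) (v : vnAlgebra M) : set (M -> C) :=
  [set w | exists2 f, uw_functional f & w = f \o vn_rep v].

Definition normal_rep (M : cstarType R) (v : vnAlgebra M) (H : hilbertType R)
    (sigma : M -> H -> H) : Prop :=
  continuous (sigma : wtop (predual v) -> wtop (@uw_functional H)).

(* The functionals generating the sigma-topology of the submodule X of F. The
   number [c i] is an upper bound of the norm of [w i]. *)
Definition sigma_functional (M : cstarType R) (v : vnAlgebra M) (F : hmodType M)
    (X : set F) : set (F -> C) :=
  [set g | exists (w : nat -> M -> C) (eta : nat -> F) (c : nat -> C),
    [/\ forall i, predual v (w i) /\ X (eta i),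
        forall i a, `|w i a| <= c i * `|a|,
        cvgn (series (fun i => c i * `|eta i|)) &
        forall x, series (fun i => w i (minner (eta i) x)) @ \oo --> g x]].

(* Functionals generating the ultraweak topology of L(F), for F self-dual. *)
Definition uw_adjointable (M : cstarType R) (v : vnAlgebra M) (F : hmodType M) :
    set ((F -> F) -> C) :=
  [set f | exists (w : nat -> M -> C) (zeta eta : nat -> F) (c : nat -> C),
    [/\ forall i, predual v (w i),
        forall i a, `|w i a| <= c i * `|a|,
        cvgn (series (fun i => c i * `|zeta i| * `|eta i|)) &
        forall S, adjointable S ->
          series (fun i => w i (minner (zeta i) (S (eta i)))) @ \oo --> f S]].

Definition self_dual (M : cstarType R) (F : hmodType M) : Prop :=
  forall f : F -> M, linear f -> continuous f ->
    (forall x a, f (ract x a) = amul (f x) a) ->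
    exists y, forall x, f x = minner y x.

Definition corr_in (M : cstarType R) (s : setting M) (F : corrType M) : Prop :=
  match s with
  | CstarSetting => True
  | WstarSetting v => self_dual F /\
      continuous (@lact R M F : wtop (predual v) -> wtop (@uw_adjointable M v F))
  end.

(* In the W*-setting, tensor products and direct sums are self-dual
   completions, in which the usual ones are dense for the sigma-topology. *)
Definition closure_in (M : cstarType R) (s : setting M) (F : hmodType M)
    (A : set F) : set F :=
  match s with
  | CstarSetting => closure A
  | WstarSetting v => closure (A : set (wtop (sigma_functional v [set: F])))
  end.

End Settings.

Section SubproductSystems.
Variables (R : realType) (M : cstarType R) (s : setting M).
Local Notation C := (cplx R).

(* G, with [t x y] as elementary tensors, is the tensor product of E and F.
   Sesquilinearity and balancedness of t follow from the first clause. *)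
Definition is_tensor (E F G : corrType M) (t : E -> F -> G) : Prop :=
  [/\ forall x x' y y',
        minner (t x y) (t x' y') = minner y (lact (minner x x' : M) y') :> M,
      forall a x y, t (lact a x) y = lact a (t x y) &
      closure_in s (lin_span [set z | exists x y, z = t x y]) = setT].

(* The tensor powers of E := pow 1, determined by E up to isomorphism; [tunit]
   identifies M with pow 0. *)
Record tensor_powers := TensorPowers {
  pow : nat -> corrType M ;
  tunit : M -> pow 0%N ;
  tmul : forall n m, pow n -> pow m -> pow (n + m)%N ;
  pow_corr : forall n, corr_in s (pow n) ;
  tunit_inner : forall a b,
    minner (tunit a) (tunit b) = amul (astar a) b ;
  tunit_lact : forall a b, tunit (amul a b) = lact a (tunit b) ;
  tunit_surj : forall x, exists a, x = tunit a ;
  tmul_tensor : forall n m, is_tensor (@tmul n m) ;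
  tmulA : forall n m k (x : pow n) (y : pow m) (z : pow k),
    Tagged pow (tmul (tmul x y) z) = Tagged pow (tmul x (tmul y z)) ;
  tmul_unitl : forall n a (x : pow n), tmul (tunit a) x = lact a x ;
  tmul_unitr : forall n (x : pow n) a,
    Tagged pow (tmul x (tunit a)) = Tagged pow (ract x a)
}.

Definition sub_bimodule (F : corrType M) (X : set F) : Prop :=
  X 0 /\ forall x y, X x -> X y ->
    X (x + y) /\
    forall (c : C) (a : M), [/\ X (c *: x), X (lact a x) & X (ract x a)].

Definition orth_complementable (F : hmodType M) (X Y : set F) : Prop :=
  X `<=` Y /\ forall y, Y y ->
    exists2 x, X x & forall w, X w -> minner w (y - x) = 0 :> M.

Definition orth_proj (F : hmodType M) (X : set F) (y : F) : F :=
  xget 0 [set x | X x /\ forall w, X w -> minner w (y - x) = 0 :> M].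

(* The inner tensor product of submodules of pow n and pow m, inside
   pow (n + m). *)
Definition sub_tensor (P : tensor_powers) n m (X : set (pow P n))
    (Y : set (pow P m)) : set (pow P (n + m)%N) :=
  closure_in s (lin_span [set z | exists x y, [/\ X x, Y y & z = tmul x y]]).

Record subproduct_system := SubproductSystem {
  powers :> tensor_powers ;
  fiber : forall n, set (pow powers n) ;
  fiber0 : @fiber 0%N = setT ;
  fiber1 : @fiber 1%N = setT ;
  fiber_bimodule : forall n, sub_bimodule (@fiber n) ;
  fiber_complementable : forall n m,
    orth_complementable (@fiber (n + m)%N) (sub_tensor (@fiber n) (@fiber m))
}.

(* [htensor_map], restricted to X and D, exhibits a Hilbert space as the tensor
   product of the submodule X with the closed sigma-invariant subspace D. Such a
   space exists and is unique up to a unitary that preserves elementary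
   tensors. *)
Record htensor (F : hmodType M) (X : set F) (H : hilbertType R) (D : set H)
    (sigma : M -> H -> H) := Htensor {
  htensor_space :> hilbertType R ;
  htensor_map : F -> H -> htensor_space ;
  htensor_ip : forall x x' h h', X x -> X x' -> D h -> D h' ->
    ip (htensor_map x h) (htensor_map x' h') = ip h (sigma (minner x x') h') ;
  htensor_dense : closure (lin_span
    [set z | exists x h, [/\ X x, D h & z = htensor_map x h]]) = setT
}.

Arguments htensor_map {F X H D sigma} _.

Section Representations.
Variable X : subproduct_system.

(* A family of maps T_n from X(n) to B(H); the values outside of X(n) are
   irrelevant. *)
Definition op_family (H : hilbertType R) := forall n, pow X n -> H -> H.

Definition rep0 (H : hilbertType R) (T : op_family H) (a : M) : H -> H :=
  T 0%N (tunit X a).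

(* The norm of the matrix z over pow n is at most c. In the linking algebra
   M_k(X(n)) acts as module maps from M^k to X(n)^k. *)
Definition mx_norm_le n k (z : 'I_k -> 'I_k -> pow X n) (c : C) : Prop :=
  0 <= c /\ forall a : 'I_k -> M,
    let y i := \sum_j ract (z i j) (a j) in
    `|\sum_i (minner (y i) (y i) : M)| <=
      c ^+ 2 * `|\sum_j amul (astar (a j)) (a j)|.

Definition completely_contractive (H : hilbertType R) n
    (Tn : pow X n -> H -> H) : Prop :=
  forall k (z : 'I_k -> 'I_k -> pow X n) c,
    (forall i j, fiber (z i j)) -> mx_norm_le z c ->
    forall h : 'I_k -> H,
      \sum_i `|\sum_j Tn (z i j) (h j)| ^+ 2 <= c ^+ 2 * \sum_j `|h j| ^+ 2.

Record ccc_rep (H : hilbertType R) (T : op_family H) : Prop := CccRep {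
  ccc_bounded : forall n (x : pow X n), fiber x -> bounded_op (T n x) ;
  ccc_linear : forall n (c : C) (x y : pow X n) h, fiber x -> fiber y ->
    T n (c *: x + y) h = c *: T n x h + T n y h ;
  ccc_rep0 : representation (rep0 T) ;
  ccc_contractive : forall n, completely_contractive (T n) ;
  ccc_ract : forall n (x : pow X n) a h, fiber x ->
    T n (ract x a) h = T n x (rep0 T a h) ;
  ccc_lact : forall n (x : pow X n) a h, fiber x ->
    T n (lact a x) h = rep0 T a (T n x h) ;
  ccc_mul : forall n m (x : pow X n) (y : pow X m) h, fiber x -> fiber y ->
    T (n + m)%N (orth_proj (@fiber X (n + m)%N) (tmul x y)) h = T n x (T m y h) ;
  ccc_normal : match s with
    | CstarSetting => True
    | WstarSetting v => normal_rep v (rep0 T) /\ forall n,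
        {within (@fiber X n : set (wtop (sigma_functional v (@fiber X n)))),
          continuous (T n : wtop (sigma_functional v (@fiber X n)) ->
                            wtop (@uw_functional R H))}
    end
}.

Definition fiber_tensor (H : hilbertType R) (T : op_family H) :=
  forall n, htensor (@fiber X n) [set: H] (rep0 T).

Section OneRepresentation.
Variables (H : hilbertType R) (T : op_family H) (XH : fiber_tensor T).
Arguments T : clear implicits.

Definition tilde n : XH n -> H :=
  xget (fun=> 0) [set A | bounded_op A /\
    forall x h, fiber x -> A (htensor_map (XH n) x h) = T n x h].

Definition defect_op : H -> H :=
  sqrt_op (fun h => h - tilde (adj (@tilde 1%N) h)).

Definition defect_space : set H := closure (range defect_op).

Definition pure_rep : Prop :=
  forall h, (fun n => tilde (adj (@tilde n) h)) @ \oo --> (0 : H).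

Definition relatively_isometric : Prop :=
  (forall n, partial_isometry (@tilde n)) /\
  ((forall n, closure (lin_span [set z | exists x h,
        fiber x /\ z = htensor_map (XH n) x (defect_op h)])
      `<=` range (adj (@tilde n))) \/
   (forall n (x : pow X n) h, fiber x ->
      defect_op (adj (T n x) (T n x (defect_op h))) =
      rep0 T (minner x x) (defect_op h))).

End OneRepresentation.

Definition fully_coisometric (U : hilbertType R) (Z : op_family U) : Prop :=
  ccc_rep Z /\
  exists XU : fiber_tensor Z, forall n, coisometry (@tilde U Z XU n).

(* The direct sum of the correspondences X(n), unique up to a unitary that
   preserves the inclusions. *)
Record fock_module := FockModule {
  fock :> corrType M ;
  fock_inc : forall n, pow X n -> fock ;
  fock_corr : corr_in s fock ;
  fock_inc_inner : forall n (x y : pow X n), fiber x -> fiber y ->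
    minner (fock_inc x) (fock_inc y) = minner x y :> M ;
  fock_inc_orth : forall n m (x : pow X n) (y : pow X m), n <> m ->
    fiber x -> fiber y -> minner (fock_inc x) (fock_inc y) = 0 :> M ;
  fock_inc_lact : forall n (x : pow X n) a, fiber x ->
    fock_inc (lact a x) = lact a (fock_inc x) ;
  fock_dense : closure_in s (lin_span
    [set z | exists n (x : pow X n), fiber x /\ z = fock_inc x]) = setT
}.

Arguments fock_inc _ {n}.

Definition shift (F : fock_module) n (x : pow X n) : F -> F :=
  xget (fun=> 0) [set S | adjointable S /\
    forall m (y : pow X m), fiber y ->
      S (fock_inc F y) = fock_inc F (orth_proj (@fiber X (n + m)%N) (tmul x y))].

(* S (x) I_D on the tensor product of F and D. *)
Definition induced_op (F : hmodType M) (H : hilbertType R) (D : set H)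
    (sigma : M -> H -> H) (K : htensor [set: F] D sigma) (S : F -> F) : K -> K :=
  xget (fun=> 0) [set A | bounded_op A /\
    forall x h, D h -> A (htensor_map K x h) = htensor_map K (S x) h].

Arguments shift _ {n} _.
Arguments induced_op {F H D sigma} _ _.

(* W conjugates T to the direct sum of the shift tensored with I_D and of the
   fully coisometric representation Z. *)
Definition wold_decomposition (H : hilbertType R) (T : op_family H)
    (XH : fiber_tensor T) (F : fock_module)
    (K : htensor [set: F] (defect_space XH) (rep0 T))
    (U : hilbertType R) (W : H -> K * U) (Z : op_family U) : Prop :=
  [/\ dsum_unitary W, fully_coisometric Z &
      forall n (x : pow X n), fiber x -> forall h,
        W (T n x h) = dsum_op (induced_op K (shift F x)) (Z n x) (W h)].

End Representations.
End SubproductSystems.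

(* Main.v *)
(** Write [t_n] for the contraction from the tensor product of X(n) and H to H
    induced by T_n, [Q_n = t_n t_n^*], and D for the defect space.

    If T is relatively isometric, then [Q_n] and [Delta = 1 - Q_1] are projections,
    [t_n^* t_n] fixes the vectors [x (x) d] with d in D, and T_n(x) d is orthogonal
    to the range of T_N for [n < N]. Hence V : [x (x) d |-> T_n(x) d] is an isometry
    on the Fock space that intertwines the inflated shift with T. A vector u
    orthogonal to its range satisfies [Q_k u = u] for all k, by induction on k, so u
    is a limit of vectors in the range of T_k for every k; therefore the orthogonal
    complement of the range is invariant under T, and T is fully coisometric there.

    Conversely, let H be decomposed. On the summand U one has [Q_n u = u]. For z in
    X(N) the vector [t_n^* V(z (x) d)] is 0 if [N < n], while for [N = n + m] it is
    the image of [z (x) d] under the isometry that sends [(x (x) y) (x) d] to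
    [x (x) V(y (x) d)]. So [Q_n] fixes V(X(N) (x) D) for [n <= N], which shows that
    the [t_n] are partial isometries, that [Delta] is the projection onto
    V(X(0) (x) D), and that the range of [t_n^*] contains X(n) (x) D. It also shows
    that [Q_n h -> 0] for all h if and only if U is trivial.

    The contractions [t_n], the shifts and their inflations are defined only through
    their values on generators. They exist because of Gram matrix inequalities, which
    rest on Kaplansky's theorem that [b^* b] is positive and, in the W*-setting, on
    self-duality and on the bicommutant property. *)
Require Import Defs.
From HB Require Import structures.
From mathcomp Require Import all_boot all_order all_algebra.
From mathcomp Require Import complex.
From mathcomp Require Import all_classical all_reals all_analysis.
From mathcomp Require Import ring lra zify.
Set Implicit Arguments.
Unset Strict Implicit.
Unset Printing Implicit Defensive.
Import Order.TTheory GRing.Theory Num.Theory.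
Import numFieldNormedType.Exports.
Local Open Scope classical_set_scope.
Local Open Scope ring_scope.

(** Three obstacles shape the development. M need not have a unit, and positivity is treated without
    spectra or matrix algebras: it is a property of self-adjoint operators on M as a Hilbert module
    over itself, given by the norm condition [|t - f| <= t], and square roots come from an
    iteration. Where a spectral radius would be used, a log-convex sequence of at most linear growth
    is shown not to increase. The operators [t_n] are only asked to be bounded. The Gram inequality
    behind them is proved with the constant 2, and contractivity is recovered later from the partial
    isometry property. Elements of X(n + m) are limits of combinations of products, in norm or in
    the sigma-topology, and these approximants need not lie in X(n + m). Statements about them are
    therefore cast as equalities of matrix coefficients or as orthogonality relations, which pass to
    both kinds of closure. In the W*-setting this rests on the fact that x |-> <k, x (x) d> is one
    of the functionals that generate the sigma-topology. *)

Section LinearIdentities.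
Variables (K : comPzRingType) (V : lmodType K).

(** Reflected syntax of linear combinations. An identity of vectors holds once the coefficients of
    every atom agree, which leaves scalar goals for [ring] and [field]. *)
Inductive lexpr :=
  | LVar of nat | LZero | LAdd of lexpr & lexpr | LOpp of lexpr
  | LScale of K & lexpr.

Fixpoint leval (env : seq V) e : V :=
  match e with
  | LVar n => nth 0 env n
  | LZero => 0
  | LAdd a b => leval env a + leval env b
  | LOpp a => - leval env a
  | LScale c a => c *: leval env a
  end.

Fixpoint lcoef (n : nat) e : K :=
  match e with
  | LVar m => if eqn m n then 1 else 0
  | LZero => 0
  | LAdd a b => lcoef n a + lcoef n b
  | LOpp a => - lcoef n a
  | LScale c a => c * lcoef n a
  end.

Lemma levalE env e : leval env e = \sum_(n < size env) lcoef n e *: nth 0 env n.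
Proof.
elim: e => [m||a IHa b IHb|a IHa|c a IHa] /=; rewrite ?IHa ?IHb.
- have [mn|mn] := ltnP m (size env).
    rewrite (bigD1 (Ordinal mn)) //= eqnE eqxx scale1r big1 ?addr0 // => i im.
    rewrite ifF ?scale0r //; apply/negbTE; apply: contra im => /eqP im.
    by apply/eqP/val_inj.
  rewrite nth_default // big1 // => i _; rewrite ifF ?scale0r //.
  by apply/negbTE; rewrite neq_ltn (leq_trans (ltn_ord i)) // orbT.
- by rewrite big1 // => i _; rewrite scale0r.
- by rewrite -big_split; apply: eq_bigr => i _; rewrite scalerDl.
- by rewrite -sumrN; apply: eq_bigr => i _; rewrite scaleNr.
- by rewrite scaler_sumr; apply: eq_bigr => i _; rewrite scalerA.
Qed.

(** Defined by recursion instead of a quantifier over indices, so that computation turns it into one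
    scalar equation per atom. *)
Fixpoint lsame e1 e2 n : Prop :=
  if n is m.+1 then lcoef m e1 = lcoef m e2 /\ lsame e1 e2 m else True.

Lemma lcoef_eq env e1 e2 : lsame e1 e2 (size env) -> leval env e1 = leval env e2.
Proof.
rewrite !levalE => h; apply: eq_bigr => i _; congr (_ *: _).
elim: (size env) h (i : nat) (ltn_ord i) => // n IH [h hs] j.
by rewrite ltnS leq_eqVlt => /predU1P[->|/IH] //; apply.
Qed.
End LinearIdentities.

(** The inner [match goal] lets the tactic [constr_eq] run while a term is being computed; its
    failure makes the outer [match goal] try the next branch. *)
Ltac lvars l t :=
  lazymatch t with
  | (?a + ?b)%R => let l1 := lvars l a in lvars l1 b
  | (- ?a)%R => lvars l a
  | (_ *: ?a)%R => lvars l a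
  | 0%R => l
  | _ =>
    let rec mem k :=
      lazymatch k with
      | nil => false
      | cons ?y ?k' =>
        match goal with
        | _ => let _ := match goal with _ => constr_eq t y end in true
        | _ => mem k'
        end
      end in
    lazymatch mem l with
    | true => l
    | false => constr:(cons t l)
    end
  end.

Ltac lindex l t :=
  lazymatch l with
  | cons ?y ?k =>
    match goal with
    | _ => let _ := match goal with _ => constr_eq t y end in constr:(O)
    | _ => let n := lindex k t in constr:(S n)
    end
  end.

Ltac lreify K l t :=
  lazymatch t with
  | (?a + ?b)%R =>
    let ea := lreify K l a in let eb := lreify K l b in constr:(@LAdd K ea eb)
  | (- ?a)%R => let ea := lreify K l a in constr:(@LOpp K ea)
  | (?c *: ?a)%R => let ea := lreify K l a in constr:(@LScale K c ea)
  | 0%R => constr:(@LZero K)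
  | _ => let n := lindex l t in constr:(@LVar K n)
  end.

(* Proves an equality of linear combinations by comparing coefficients. *)
Ltac lmod K :=
  lazymatch goal with
  | |- @eq ?T ?x ?y =>
    let l0 := lvars (@nil T) x in let l := lvars l0 y in
    let ex := lreify K l x in let ey := lreify K l y in
    refine (@lcoef_eq K _ l ex ey _); cbn [lsame size lcoef eqn];
    repeat split; try (first [ring | by field])
  end.

(** * Real-valued norms and sequences *)

Section Norms.
Variable R : realType.
Local Notation C := (cplx R).

Definition rc (r : R) : C := r%:C%C.

(** Norms are complex valued here. Their real parts lie in a totally ordered field, where estimates
    can be left to [lra]. *)
Definition nrm (V : normedZmodType C) (x : V) : R := complex.Re (`|x| : R[i]).

Lemma rcD : {morph rc : x y / x + y}. Proof. exact: (rmorphD (real_complex R)). Qed.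
Lemma rcB : {morph rc : x y / x - y}. Proof. exact: (rmorphB (real_complex R)). Qed.
Lemma rcN : {morph rc : x / - x}. Proof. exact: (rmorphN (real_complex R)). Qed.
Lemma rcM : {morph rc : x y / x * y}. Proof. exact: (rmorphM (real_complex R)). Qed.
Lemma rcV : {morph rc : x / x^-1}. Proof. exact: (fmorphV (real_complex R)). Qed.
Lemma rcX n : {morph rc : x / x ^+ n}. Proof. exact: (rmorphXn (real_complex R)). Qed.
Lemma rc0 : rc 0 = 0. Proof. by []. Qed.
Lemma rc1 : rc 1 = 1. Proof. by []. Qed.
Lemma rc_nat n : rc n%:R = n%:R. Proof. exact: (rmorph_nat (real_complex R)). Qed.
Lemma rc_inj : injective rc. Proof. exact: complexI. Qed.
Lemma rc_sum (I : Type) (r : seq I) (P : pred I) (F : I -> R) :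
  rc (\sum_(i <- r | P i) F i) = \sum_(i <- r | P i) rc (F i).
Proof. exact: (rmorph_sum (real_complex R)). Qed.
Lemma rc_le x y : (rc x <= rc y) = (x <= y).
Proof. exact: lecR. Qed.
Lemma rc_lt x y : (rc x < rc y) = (x < y).
Proof. exact: ltcR. Qed.
Lemma rc_conj x : (rc x)^* = rc x.
Proof. by apply: (@conj_Creal C); rewrite realE -!rc0 !rc_le; exact: le_total. Qed.
Lemma rc_ge0 (z : C) : 0 <= z -> z = rc (complex.Re z).
Proof. by case: z => a b; rewrite lecE /= => /andP[/eqP -> _]. Qed.
Lemma rc_gt0 (z : C) : 0 < z -> exists2 r, 0 < r & z = rc r.
Proof.
move=> z0; exists (complex.Re z); last exact: rc_ge0 (ltW z0).
by rewrite -rc_lt -rc_ge0 ?ltW.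
Qed.

Section Normed.
Variable V : normedZmodType C.
Implicit Types x y : V.

Lemma nrmE x : `|x| = rc (nrm x). Proof. exact: (rc_ge0 (normr_ge0 x)). Qed.
Lemma nrm_ge0 x : 0 <= nrm x. Proof. by rewrite -rc_le -nrmE normr_ge0. Qed.
Lemma nrm0 : nrm (0 : V) = 0. Proof. by rewrite /nrm normr0. Qed.
Lemma nrm_eq0 x : nrm x = 0 -> x = 0.
Proof. by move=> h; apply/eqP; rewrite -normr_eq0 nrmE h. Qed.
Lemma nrm_le0 x : nrm x <= 0 -> x = 0.
Proof. by move=> h; apply: nrm_eq0; apply/eqP; rewrite eq_le h nrm_ge0. Qed.
Lemma nrmN x : nrm (- x) = nrm x. Proof. by rewrite /nrm normrN. Qed.
Lemma nrmBC x y : nrm (x - y) = nrm (y - x). Proof. by rewrite /nrm distrC. Qed.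
Lemma nrmD x y : nrm (x + y) <= nrm x + nrm y.
Proof. by rewrite -rc_le rcD -!nrmE ler_normD. Qed.
Lemma nrmT y x z : nrm (x - z) <= nrm (x - y) + nrm (y - z).
Proof. by rewrite -[x - z](subrKA y) nrmD. Qed.
Lemma nrm_sum (I : Type) (r : seq I) (P : pred I) (F : I -> V) :
  nrm (\sum_(i <- r | P i) F i) <= \sum_(i <- r | P i) nrm (F i).
Proof.
elim/big_rec2: _ => [|i b a _ h]; first by rewrite nrm0.
by rewrite (le_trans (nrmD _ _)) // lerD2l.
Qed.
End Normed.

Lemma nrmM (a b : C) : nrm (a * b) = nrm a * nrm b.
Proof. by apply: rc_inj; rewrite rcM -!nrmE normrM. Qed.
Lemma nrm_rc r : nrm (rc r) = `|r|.
Proof. by apply: rc_inj; rewrite -nrmE normc_def /= expr0n addr0 sqrtr_sqr. Qed.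
Lemma nrm_rc_ge0 r : 0 <= r -> nrm (rc r) = r.
Proof. by move=> h; rewrite nrm_rc ger0_norm. Qed.
Lemma nrm_conj (a : C) : nrm (a^*) = nrm a.
Proof. by rewrite /nrm norm_conjC. Qed.
Lemma nrm_i : nrm ('i : C) = 1.
Proof. by apply: rc_inj; rewrite -nrmE normCi. Qed.

Lemma nrmZ (V : normedModType C) (a : C) (x : V) : nrm (a *: x) = nrm a * nrm x.
Proof. by apply: rc_inj; rewrite rcM -!nrmE normrZ. Qed.
Lemma nrmZr (V : normedModType C) (r : R) (x : V) : 0 <= r ->
  nrm (rc r *: x) = r * nrm x.
Proof. by move=> h; rewrite nrmZ nrm_rc_ge0. Qed.

(* Convergence to 0 of a sequence of nonnegative reals. *)
Definition null (a : nat -> R) : Prop :=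
  forall e, 0 < e -> exists N, forall n, (N <= n)%N -> a n < e.

Lemma nullD a b : null a -> null b -> null (fun n => a n + b n).
Proof.
move=> ha hb e e0; have e2 : 0 < e / 2 by rewrite divr_gt0.
have [N hN] := ha _ e2; have [N' hN'] := hb _ e2.
exists (maxn N N') => n; rewrite geq_max => /andP[h1 h2].
by rewrite [e]splitr ltrD ?hN ?hN'.
Qed.
Lemma null_le b a : null b -> (forall n, a n <= b n) -> null a.
Proof.
move=> hb h e /hb [N hN]; exists N => n /hN; exact: le_lt_trans (h n).
Qed.
Lemma nullM c a : (forall n, 0 <= a n) -> null a -> null (fun n => c * a n).
Proof.
move=> a0 ha e e0; have [c0|c0] := leP c 0; last first.
  have [N hN] := ha _ (divr_gt0 e0 c0); exists N => n /hN.
  by rewrite ltr_pdivlMr // mulrC.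
by exists 0%N => n _; rewrite (le_lt_trans _ e0) // mulr_le0_ge0.
Qed.
Lemma null_inv : null (fun n => n.+1%:R^-1).
Proof.
move=> e e0; have [N _ hN] := near_infty_natSinv_lt (PosNum e0).
by exists N => n; exact: hN.
Qed.
Lemma null_half : null (fun n => 2^-1 ^+ n).
Proof.
apply: null_le null_inv _ => n; rewrite exprVn lef_pV2 ?posrE ?exprn_gt0 //.
by rewrite -natrX ler_nat ltn_expl.
Qed.
(** [null] bounds sequences from above only, so a constant null sequence is merely nonpositive.
    Inequalities that survive a limit are proved by showing that the difference of both sides is
    such a constant. *)
Lemma null_const a : null (fun=> a) -> a <= 0.
Proof.
move=> h; rewrite leNgt; apply/negP => a0; have [N hN] := h _ a0.
by have := hN N (leqnn N); rewrite ltxx.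
Qed.
Lemma null_shift a k : null a -> null (fun n => a (n + k)%N).
Proof.
move=> h e /h[N hN]; exists N => n Nn; apply: hN.
by rewrite (leq_trans Nn) ?leq_addr.
Qed.

Section Conv.
Variable V : normedModType C.
Implicit Types (x y : V) (u v : nat -> V).

Definition conv u x : Prop := null (fun n => nrm (u n - x)).

Lemma convP u x : conv u x <-> u @ \oo --> x.
Proof.
split=> [h|/cvgrPdist_lt h].
  apply/cvgrPdist_lt => e /rc_gt0[r r0 ->].
  have [N hN] := h _ r0; exists N => // n /hN.
  by rewrite nrmE rc_lt nrmBC.
move=> e e0; have /h [N _ hN] : 0 < rc e by rewrite -rc0 rc_lt.
by exists N => n /hN; rewrite nrmE rc_lt nrmBC.
Qed.
Lemma conv_cst x : conv (fun=> x) x.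
Proof. by move=> e e0; exists 0%N => n _; rewrite subrr nrm0. Qed.
Lemma conv_uniq u x y : conv u x -> conv u y -> x = y.
Proof.
move=> hx hy; apply/eqP; rewrite -subr_eq0; apply/eqP/nrm_le0/null_const.
apply: null_le (nullD hx hy) _ => n.
by rewrite [nrm (u n - x)]nrmBC; exact: nrmT.
Qed.
Lemma convD u v x y : conv u x -> conv v y -> conv (fun n => u n + v n) (x + y).
Proof.
by move=> hx hy; apply: null_le (nullD hx hy) _ => n; rewrite opprD addrACA nrmD.
Qed.
Lemma conv_shift u x k : conv u x -> conv (fun n => u (n + k)%N) x.
Proof. exact: null_shift. Qed.
Lemma conv_nrm_le u x c : conv u x -> (forall n, nrm (u n) <= c) -> nrm x <= c.
Proof.
move=> h hc; rewrite -subr_le0; apply: null_const; apply: null_le h _ => n.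
rewrite lerBlDr nrmBC; have := nrmD (x - u n) (u n); rewrite subrK => /le_trans.
by apply; rewrite lerD2l.
Qed.

Lemma closureP (A : set V) x :
  closure A x <-> forall e, 0 < e -> exists2 a, A a & nrm (a - x) < e.
Proof.
split=> [h e e0|h B /nbhs_ballP[e /= /rc_gt0[r r0 ->] hB]].
  have [] := h (ball x (rc e)); first by apply: nbhsx_ballx; rewrite -rc0 rc_lt.
  move=> a [Aa]; rewrite -ball_normE /ball_ /= nrmE rc_lt nrmBC => ha.
  by exists a.
have [a Aa ha] := h r r0; exists a; split => //; apply: hB.
by rewrite -ball_normE /ball_ /= nrmE rc_lt nrmBC.
Qed.
Lemma closure_seq (A : set V) x :
  closure A x -> exists2 u, (forall n, A (u n)) & forall n, nrm (u n - x) < n.+1%:R^-1.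
Proof.
move=> /closureP h; have /choice[u hu] : forall n, exists a, A a /\ nrm (a - x) < n.+1%:R^-1.
  by move=> n; have [|a] := h n.+1%:R^-1; [rewrite invr_gt0|exists a].
by exists u => n; have [] := hu n.
Qed.
Lemma closure_conv (A : set V) x :
  closure A x <-> exists2 u, (forall n, A (u n)) & conv u x.
Proof.
split=> [/closure_seq[u Au hu]|[u Au hu]].
  by exists u => //; apply: null_le null_inv _ => n; exact: ltW.
by apply/closureP => e /hu[N hN]; exists (u N) => //; exact: hN.
Qed.
End Conv.

Lemma cauchy_conv (V : completeNormedModType C) (u : nat -> V) (a : nat -> R) :
  null a -> (forall n k, nrm (u (n + k)%N - u n) <= a n) ->
  exists2 x, conv u x & forall n, nrm (u n - x) <= a n.
Proof.
move=> ha hu; have /cauchy_cvgP/convP : cauchy (u @ \oo).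
  apply: cauchy_exP => e /rc_gt0[r r0 ->].
  have [N hN] := ha _ r0; exists (u N), N => // n /= hn.
  rewrite -ball_normE /ball_ /= nrmE rc_lt nrmBC -(subnKC hn).
  exact: le_lt_trans (hu _ _) (hN _ _).
move=> hx; exists (lim (u @ \oo)) => // n.
rewrite -subr_le0; apply: null_const; apply: null_le (null_shift n hx) _ => k.
rewrite lerBlDr (le_trans (nrmT (u (k + n)%N) _ _)) // addrC lerD2l.
by rewrite nrmBC addnC.
Qed.

End Norms.
Arguments rc {R} r.
Arguments null_inv {R}.
Arguments null_half {R}.

Ltac lmodC := match goal with R : realType |- _ => lmod (cplx R) end.

(** * Linear and bounded maps *)

Section LinearMaps.
Variable R : realType.
Local Notation C := (cplx R).

Section Lin.
Variables (V W : lmodType C) (f : V -> W).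
Hypothesis fl : linear f.
Lemma linD x y : f (x + y) = f x + f y.
Proof. by have := fl 1 x y; rewrite !scale1r. Qed.
Lemma lin0 : f 0 = 0.
Proof. by apply: (addrI (f 0)); rewrite -linD !addr0. Qed.
Lemma linZ a x : f (a *: x) = a *: f x.
Proof. by have := fl a x 0; rewrite !addr0 lin0 addr0. Qed.
Lemma linN x : f (- x) = - f x.
Proof. by rewrite -scaleN1r linZ scaleN1r. Qed.
Lemma linB x y : f (x - y) = f x - f y.
Proof. by rewrite linD linN. Qed.
Lemma lin_sum (I : Type) (r : seq I) (P : pred I) (F : I -> V) :
  f (\sum_(i <- r | P i) F i) = \sum_(i <- r | P i) f (F i).
Proof. exact: (big_morph f linD lin0). Qed.
End Lin.

Lemma lin_comp (V W U : lmodType C) (f : W -> U) (g : V -> W) :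
  linear f -> linear g -> linear (f \o g).
Proof. by move=> fl gl a u v; rewrite /= gl fl. Qed.

Lemma lin_spanP (V : lmodType C) (A : set V) (P : V -> Prop) : P 0 ->
  (forall c a x, A a -> P x -> P (c *: a + x)) -> forall x, lin_span A x -> P x.
Proof.
move=> P0 PS x [n [c [v [Av ->]]]]; elim: n c v Av => [|n IH] c v Av.
  by rewrite big_ord0.
by rewrite big_ord_recl; apply: PS => //; exact: IH.
Qed.

Lemma lin_span_sub (V : lmodType C) (A : set V) : A `<=` lin_span A.
Proof.
move=> a Aa; exists 1%N, (fun=> 1), (fun=> a).
by rewrite big_ord1 scale1r.
Qed.

Lemma lin_span0 (V : lmodType C) (A : set V) : lin_span A 0.
Proof. by exists 0%N, (fun=> 1), (fun=> 0); split=> [[]|] //; rewrite big_ord0. Qed.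

Lemma lin_span_cons (V : lmodType C) (A : set V) c a x :
  A a -> lin_span A x -> lin_span A (c *: a + x).
Proof.
move=> Aa [n [d [v [Av ->]]]].
exists n.+1, (fun i => oapp d c (unlift ord0 i)),
  (fun i => oapp v a (unlift ord0 i)); split.
  by move=> i; case: unliftP => //= j _; exact: Av.
rewrite big_ord_recl unlift_none /=; congr (_ + _).
by apply: eq_bigr => i _; rewrite liftK.
Qed.

Lemma lin_spanD (V : lmodType C) (A : set V) x y :
  lin_span A x -> lin_span A y -> lin_span A (x + y).
Proof.
move=> hx hy; move: x hx; apply: lin_spanP; first by rewrite add0r.
by move=> c a x Aa h; rewrite -addrA; exact: lin_span_cons.
Qed.

Lemma lin_spanZ (V : lmodType C) (A : set V) c x :
  lin_span A x -> lin_span A (c *: x).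
Proof.
move=> hx; move: x hx; apply: lin_spanP; first by rewrite scaler0; exact: lin_span0.
by move=> d a x Aa h; rewrite scalerDr scalerA; exact: lin_span_cons.
Qed.

Lemma eq_lin_span (V W : lmodType C) (f g : V -> W) (A : set V) :
  linear f -> linear g -> (forall a, A a -> f a = g a) ->
  forall x, lin_span A x -> f x = g x.
Proof.
move=> fl gl h; apply: lin_spanP; first by rewrite !lin0.
by move=> c a x Aa hx; rewrite fl gl h // hx.
Qed.

Lemma bounded_opP (V W : normedModType C) (f : V -> W) :
  bounded_op f <-> linear f /\ exists2 c, 0 <= c & forall x, nrm (f x) <= c * nrm x.
Proof.
split=> [[fl fc]|[fl [c c0 fc]]]; split=> //.
  have /cvgrPdist_lt/(_ 1 ltr01) := fc 0.
  move=> /nbhs_ballP[e /= /rc_gt0[r r0 ->] hr].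
  have r2 : 0 < r / 2 by rewrite divr_gt0.
  exists (r / 2)^-1 => [|x]; first by rewrite invr_ge0 ltW.
  have [->|x0] := eqVneq x 0; first by rewrite lin0 // !nrm0 mulr0.
  have nx : 0 < nrm x.
    by rewrite lt_neqAle nrm_ge0 eq_sym andbT; apply: contra_neq x0; exact: nrm_eq0.
  have := hr (rc (r / 2 / nrm x) *: x); rewrite -ball_normE /ball_ /=.
  have k0 : 0 <= r / 2 / nrm x by rewrite divr_ge0 // ltW.
  rewrite (lin0 fl) (linZ fl) !sub0r !normrN !nrmE -rc1 !rc_lt !nrmZr //.
  rewrite mulfVK ?gt_eqF // => h.
  have : r / 2 < r by lra.
  by move=> /h; rewrite mulrAC ltr_pdivrMr // mul1r ler_pdivlMl // => /ltW.
move=> x; apply/cvgrPdist_lt => e /rc_gt0[r r0 ->].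
have c1 : 0 < c + 1 by lra.
apply/nbhs_ballP; exists (rc (r / (c + 1))); first by rewrite /= -rc0 rc_lt divr_gt0.
move=> y; rewrite -ball_normE /ball_ /= !nrmE !rc_lt -linB // ltr_pdivlMr // => h.
apply: le_lt_trans (fc _) (le_lt_trans _ h).
by rewrite mulrC ler_wpM2l ?nrm_ge0 //; lra.
Qed.

Lemma bounded_conv (V W : normedModType C) (f : V -> W) u x :
  bounded_op f -> conv u x -> conv (f \o u) (f x).
Proof.
move=> /bounded_opP[fl [c c0 fc]] h.
apply: null_le (nullM c _ h) _ => [n|n /=]; first exact: nrm_ge0.
by rewrite -linB.
Qed.

Lemma bounded_comp (V W U : normedModType C) (f : W -> U) (g : V -> W) :
  bounded_op f -> bounded_op g -> bounded_op (f \o g).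
Proof.
move=> /bounded_opP[fl [c c0 fc]] /bounded_opP[gl [d d0 gd]]; apply/bounded_opP.
split; first exact: lin_comp.
exists (c * d) => [|x /=]; first exact: mulr_ge0.
by rewrite (le_trans (fc _)) // -mulrA ler_wpM2l.
Qed.

Lemma bounded_id (V : normedModType C) : bounded_op (fun x : V => x).
Proof. by apply/bounded_opP; split=> //; exists 1 => // x; rewrite mul1r. Qed.

Lemma bounded_0 (V W : normedModType C) : bounded_op (fun _ : V => 0 : W).
Proof.
apply/bounded_opP; split; first by move=> a u v; rewrite scaler0 addr0.
by exists 0 => // x; rewrite nrm0 mul0r.
Qed.

Lemma bounded_lin (V W : normedModType C) (f g : V -> W) c :
  bounded_op f -> bounded_op g -> bounded_op (fun x => c *: f x + g x).
Proof.
move=> /bounded_opP[fl [a a0 fc]] /bounded_opP[gl [b b0 gd]]; apply/bounded_opP.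
split=> [d x y|].
  by rewrite fl gl !scalerDr !scalerA [c * d]mulrC addrACA.
exists (nrm c * a + b) => [|x]; first by rewrite addr_ge0 ?mulr_ge0 ?nrm_ge0.
rewrite (le_trans (nrmD _ _)) // nrmZ mulrDl lerD // -mulrA.
by rewrite ler_wpM2l ?nrm_ge0.
Qed.

Lemma eq_bounded_closure (V W : normedModType C) (f g : V -> W) (A : set V) :
  bounded_op f -> bounded_op g -> (forall a, A a -> f a = g a) ->
  forall x, closure (lin_span A) x -> f x = g x.
Proof.
move=> fb gb h x /closure_conv[u Au ux].
apply: (conv_uniq (bounded_conv fb ux)).
rewrite (_ : f \o u = g \o u); first exact: bounded_conv.
by apply: funext => n /=; apply: eq_lin_span (Au n) => //; [exact: fb.1|exact: gb.1].
Qed.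

Lemma conv_scale (V : normedModType C) c u (x : V) :
  conv u x -> conv (fun n => c *: u n) (c *: x).
Proof.
move=> h; apply: null_le (nullM (nrm c) (fun n => nrm_ge0 _) h) _ => n.
by rewrite -scalerBr nrmZ.
Qed.

(* Optimize over [c = - t * z^*] with [t >= 0]. *)
Lemma quadratic_ge0 (p q : R) (z : C) : 0 <= q ->
  (forall c : C, 0 <= rc p + c * z + (c * z)^* + rc (nrm c ^+ 2 * q)) ->
  nrm z ^+ 2 <= p * q.
Proof.
move=> q0 h.
have {}h t : 0 <= t -> 0 <= p - 2 * t * nrm z ^+ 2 + t ^+ 2 * nrm z ^+ 2 * q.
  move=> t0; have := h (- (rc t * z^*)).
  have -> : - (rc t * z^*) * z = rc (- (t * nrm z ^+ 2)).
    by rewrite mulNr -mulrA [z^* * z]mulrC -normCK nrmE -rcX -rcM rcN.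
  rewrite rc_conj nrmN nrmM nrm_conj nrm_rc_ge0 // -!rcD -rc0 rc_le.
  by rewrite (_ : p + _ + _ + _ = p - 2 * t * nrm z ^+ 2 + t ^+ 2 * nrm z ^+ 2 * q) //; ring.
set Z := nrm z ^+ 2 in h *; have Z0 : 0 <= Z by rewrite sqr_ge0.
have p0 : 0 <= p by have := h 0 (lexx 0); rewrite mulr0 expr0n !mul0r subr0 addr0.
have [q_0|qn] := eqVneq q 0; last first.
  have qp : 0 < q by rewrite lt_neqAle eq_sym qn.
  have iq : 0 <= q^-1 by rewrite invr_ge0.
  have := h _ iq; have -> : q^-1 ^+ 2 * Z * q = q^-1 * Z by field.
  by rewrite -(@ler_pM2r _ q) // mul0r => hh; rewrite -subr_ge0 (le_trans hh) // le_eqVlt; apply/orP; left; apply/eqP; field.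
rewrite q_0 mulr0; have [Zp|//] := ltP 0 Z.
(* For [q = 0] the inequality is affine in [t]; at this [t] it reads [0 <= p - 2 (p + 1)], which is
   absurd. *)
have tp : 0 <= (p + 1) / Z by rewrite divr_ge0 // addr_ge0.
have := h _ tp; rewrite q_0 mulr0 addr0 -mulrA divfK ?gt_eqF //; lra.
Qed.
End LinearMaps.

(** * Hilbert spaces *)

Section HilbertSpaces.
Variable R : realType.
Local Notation C := (cplx R).

Lemma polarization0 (z : C) : (forall c : C, c * z + (c * z)^* = 0) -> z = 0.
Proof.
move=> /(_ z^*); rewrite [z^* * z]mulrC -normCK nrmE -rcX rc_conj -rcD -rc0.
move=> /rc_inj h; apply: nrm_eq0; have := sqr_ge0 (nrm z) => h'.
by apply/eqP; rewrite -[_ == 0]sqrf_eq0 eq_le h' andbT; lra.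
Qed.

Lemma null_sqrt (a : nat -> R) : null a -> null (fun n => Num.sqrt (a n)).
Proof.
move=> h e e0; have e2 : 0 < e ^+ 2 by rewrite exprn_gt0.
have [N hN] := h _ e2; exists N => n /hN han.
by rewrite -[ltRHS](gtr0_norm e0) -sqrtr_sqr ltr_sqrt.
Qed.

Lemma le_sqr (a b : R) : 0 <= b -> a ^+ 2 <= b ^+ 2 -> a <= b.
Proof.
move=> b0; have [a0|a0 _] := leP 0 a; last exact: le_trans (ltW a0) b0.
by rewrite ler_sqr.
Qed.

Section Inner.
Variable H : hilbertType R.
Implicit Types x y z : H.

Lemma ipDl x y z : ip (x + y) z = ip x z + ip y z.
Proof. by rewrite -ipC ipDr rmorphD /= !ipC. Qed.
Lemma ipZl c x y : ip (c *: x) y = c^* * ip x y.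
Proof. by rewrite -ipC ipZr rmorphM /= ipC. Qed.
Lemma ip_linear x : linear (ip x : H -> C^o).
Proof. by move=> a u v; rewrite ipDr ipZr. Qed.
Lemma ip0r x : ip x 0 = 0. Proof. exact: lin0 (ip_linear x). Qed.
Lemma ip0l x : ip 0 x = 0. Proof. by rewrite -ipC ip0r conjC0. Qed.
Lemma ipNr x y : ip x (- y) = - ip x y. Proof. exact: linN (ip_linear x) y. Qed.
Lemma ipNl x y : ip (- x) y = - ip x y.
Proof. by rewrite -ipC ipNr rmorphN /= ipC. Qed.
Lemma ipBr x y z : ip x (y - z) = ip x y - ip x z.
Proof. exact: linB (ip_linear x) y z. Qed.
Lemma ipBl x y z : ip (x - y) z = ip x z - ip y z.
Proof. by rewrite ipDl ipNl. Qed.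
Lemma ip_sumr (I : Type) (r : seq I) (P : pred I) (F : I -> H) x :
  ip x (\sum_(i <- r | P i) F i) = \sum_(i <- r | P i) ip x (F i).
Proof. exact: (lin_sum (ip_linear x)). Qed.
Lemma ip_suml (I : Type) (r : seq I) (P : pred I) (F : I -> H) x :
  ip (\sum_(i <- r | P i) F i) x = \sum_(i <- r | P i) ip (F i) x.
Proof. by rewrite -ipC ip_sumr rmorph_sum /=; apply: eq_bigr => i _; rewrite ipC. Qed.
Lemma ipxx x : ip x x = rc (nrm x ^+ 2).
Proof. by rewrite ip_norm nrmE rcX. Qed.
Lemma ip_eq0 x : ip x x = 0 -> x = 0.
Proof.
rewrite ipxx -rc0 => /rc_inj/eqP; rewrite sqrf_eq0 => /eqP; exact: nrm_eq0.
Qed.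
Lemma ip_ext x y : (forall z, ip z x = ip z y) -> x = y.
Proof.
by move=> h; apply/eqP; rewrite -subr_eq0; apply/eqP/ip_eq0; rewrite ipBr h subrr.
Qed.
Lemma nrm_sqrD x y c :
  rc (nrm (x + c *: y) ^+ 2) =
  rc (nrm x ^+ 2) + c * ip x y + (c * ip x y)^* + rc (nrm c ^+ 2 * nrm y ^+ 2).
Proof.
rewrite -!ipxx ipDl !ipDr !ipZl !ipZr !ipxx rmorphM /= ipC rcM addrA; congr (_ + _).
by rewrite mulrA [c^* * c]mulrC -normCK nrmE !rcX.
Qed.
Lemma ip_CS x y : nrm (ip x y) <= nrm x * nrm y.
Proof.
apply: le_sqr; first by rewrite mulr_ge0 ?nrm_ge0.
rewrite exprMn; apply: quadratic_ge0 => [|c]; first by rewrite sqr_ge0.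
by rewrite -nrm_sqrD -rc0 rc_le sqr_ge0.
Qed.
Lemma ip_bounded x : bounded_op (ip x : H -> C^o).
Proof.
apply/bounded_opP; split; first exact: ip_linear.
by exists (nrm x) => [|y]; [exact: nrm_ge0|exact: ip_CS].
Qed.
Lemma ip_conv x y u : conv u y -> conv (fun n => ip x (u n) : C^o) (ip x y).
Proof. exact: (bounded_conv (ip_bounded x)). Qed.
Lemma parallelogram x y :
  nrm (x + y) ^+ 2 + nrm (x - y) ^+ 2 = 2 * nrm x ^+ 2 + 2 * nrm y ^+ 2.
Proof.
apply: rc_inj; rewrite !rcD 2!rcM rc_nat -!ipxx !(ipDl, ipDr, ipNl, ipNr).
by ring.
Qed.
Lemma ip_closure0 (A : set H) x : (forall a, A a -> ip x a = 0) ->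
  forall y, closure (lin_span A) y -> ip x y = 0.
Proof.
move=> h; apply: (@eq_bounded_closure _ _ _ (ip x : H -> C^o) (fun=> 0)) => //.
  exact: ip_bounded.
exact: bounded_0.
Qed.
Lemma ip_dense (A : set H) x y : closure (lin_span A) = setT ->
  (forall a, A a -> ip a x = ip a y) -> x = y.
Proof.
move=> hA h; apply/eqP; rewrite -subr_eq0; apply/eqP/ip_eq0.
apply: (@ip_closure0 A) => [a Aa|]; last by rewrite hA.
by rewrite -ipC ipBr h // subrr conjC0.
Qed.
Lemma pythagoras x y : ip x y = 0 -> nrm (x + y) ^+ 2 = nrm x ^+ 2 + nrm y ^+ 2.
Proof.
by move=> h; apply: rc_inj; rewrite rcD -!ipxx ipDl !ipDr h -(ipC x y) h conjC0 addr0 add0r.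
Qed.

(* The limit of a minimizing sequence; Cauchy by the parallelogram law. *)
Lemma projection_exists (A : set H) x :
  exists2 y, closure (lin_span A) y & forall a, A a -> ip a (x - y) = 0.
Proof.
pose D : set R := [set d | exists2 v, lin_span A v & d = nrm (x - v) ^+ 2].
have Dne : has_inf D.
  split; first by exists (nrm (x - 0) ^+ 2), 0 => //; exact: lin_span0.
  by exists 0 => _ [v _ ->]; rewrite sqr_ge0.
have dlb v : lin_span A v -> inf D <= nrm (x - v) ^+ 2.
  by move=> hv; apply: ge_inf; [exact: Dne.2|exists v].
have /choice[v hv] : forall n, exists v, lin_span A v /\
    nrm (x - v) ^+ 2 < inf D + n.+1%:R^-1.
  move=> n; have n0 : 0 < n.+1%:R^-1 :> R by rewrite invr_gt0.
  by have [_ [w Aw ->] hw] := inf_adherent n0 Dne; exists w.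
have vA n := (hv n).1; have {hv}vd n := (hv n).2.
have a0 : null (fun n : nat => Num.sqrt (4 * n.+1%:R^-1) : R).
  by apply: null_sqrt; apply: nullM; [move=> n; rewrite invr_ge0|exact: null_inv].
have [n k|y vy _] := cauchy_conv (u := v) a0.
  rewrite -[nrm _]ger0_norm ?nrm_ge0 // -sqrtr_sqr ler_wsqrtr //.
  have := parallelogram (x - v n) (x - v (n + k)%N).
  have -> : x - v n - (x - v (n + k)%N) = v (n + k)%N - v n by lmodC.
  have -> : x - v n + (x - v (n + k)%N) = rc 2 *: (x - (rc 2^-1 *: (v n + v (n + k)%N))).
    by rewrite rcV rc_nat; lmodC.
  rewrite nrmZr // exprMn.
  have hm : lin_span A (rc 2^-1 *: (v n + v (n + k)%N)).
    by apply: lin_spanZ; exact: lin_spanD.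
  have := dlb _ hm; have := vd n; have := vd (n + k)%N.
  have : (n + k).+1%:R^-1 <= n.+1%:R^-1 :> R.
    by rewrite lef_pV2 ?posrE // ler_nat ltnS leq_addr.
  move: (nrm _ ^+ 2) (nrm _ ^+ 2) (nrm _ ^+ 2) (nrm _ ^+ 2) (_^-1) (_^-1) (inf D).
  by move=> *; lra.
have ymin w : lin_span A w -> nrm (x - y) <= nrm (x - w).
  move=> Aw; rewrite -subr_le0; apply: null_const.
  have i0 : null (fun n : nat => Num.sqrt n.+1%:R^-1 : R) := null_sqrt null_inv.
  apply: null_le (nullD vy i0) _ => n.
  have h1 := nrmT (v n) x y; set s := Num.sqrt _.
  have s0 : 0 <= s by exact: sqrtr_ge0.
  have s2 : s ^+ 2 = n.+1%:R^-1 by rewrite sqr_sqrtr // invr_ge0.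
  suff : nrm (x - v n) <= nrm (x - w) + s by lra.
  have w0 := nrm_ge0 (x - w).
  apply: le_sqr; first by rewrite addr_ge0.
  have := vd n; have := dlb _ Aw; rewrite -s2.
  have : 0 <= nrm (x - w) * s by rewrite mulr_ge0.
  by rewrite sqrrD; lra.
exists y; first by apply/closure_conv; exists v.
move=> a Aa; rewrite -ipC; apply/eqP; rewrite conjC_eq0; apply/eqP.
apply: nrm_eq0; apply/eqP; rewrite -[_ == 0]sqrf_eq0 eq_le sqr_ge0 andbT.
(* Minimality of [y] says that the form with [p = 0] and linear coefficient [ip (x - y) a] is
   nonnegative; hence this coefficient is 0. *)
rewrite -(mul0r (nrm a ^+ 2)); apply: quadratic_ge0 => [|c]; first exact: sqr_ge0.
suff : nrm (x - y) <= nrm (x - y + c *: a).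
  move=> h; have {h} : nrm (x - y) ^+ 2 <= nrm (x - y + c *: a) ^+ 2.
    by rewrite ler_sqr ?nnegrE ?nrm_ge0.
  rewrite -subr_ge0 -rc_le rcB nrm_sqrD rc0 => h; apply: le_trans h _.
  by rewrite le_eqVlt; apply/orP; left; apply/eqP; ring.
rewrite -subr_le0; apply: null_const; apply: null_le vy _ => n.
have := ymin _ (lin_span_cons (- c) Aa (vA n)).
have := nrmT (y - v n) (x - (- c *: a + v n)) 0.
have -> : x - (- c *: a + v n) - (y - v n) = x - y + c *: a.
  by lmodC.
by rewrite !subr0 [nrm (y - v n)]nrmBC; lra.
Qed.

Lemma riesz (f : H -> C) c : linear (f : H -> C^o) ->
  (forall x, nrm (f x) <= c * nrm x) -> exists y, forall x, f x = ip y x.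
Proof.
move=> fl fc; have [f0|/existsNP[x0 fx0]] := pselect (forall x, f x = 0).
  by exists 0 => x; rewrite ip0l f0.
pose A := [set x | f x = 0].
have fb : bounded_op (f : H -> C^o).
  apply/bounded_opP; split=> //; exists (Num.max c 0) => [|x].
    by rewrite le_max lexx orbT.
  by rewrite (le_trans (fc x)) // ler_wpM2r ?nrm_ge0 // le_max lexx.
have [p Ap hp] := projection_exists A x0; pose z := x0 - p.
have fp : f p = 0.
  by apply: (eq_bounded_closure fb (bounded_0 _ _) _ Ap).
have fz : f z = f x0 by rewrite /z (linB fl) fp subr0.
have z0 : ip z z != 0.
  by apply: contra_notN fx0 => /eqP/ip_eq0 z0; rewrite -fz z0 (lin0 fl).
exists ((f z / ip z z)^* *: z) => x; rewrite ipZl conjCK.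
have /hp : A (f z *: x - f x *: z).
  by rewrite /A /= (linB fl) !(linZ fl) /= [f z *: _]mulrC subrr.
move=> /(congr1 Num.conj); rewrite conjC0 ipC -/z ipBr !ipZr => /eqP.
rewrite subr_eq0 => /eqP h; rewrite -[f z / _ * _]mulrAC h mulfK //.
Qed.

End Inner.

Section Isometries.
Variable H : hilbertType R.
Lemma isometry_ip (V : hilbertType R) (A : H -> V) : linear A ->
  (forall x, nrm (A x) = nrm x) -> forall x y, ip (A x) (A y) = ip x y.
Proof.
move=> Al Ai x y; apply/eqP; rewrite -subr_eq0; apply/eqP/polarization0 => c.
have := congr1 rc (congr1 (fun t : R => t ^+ 2) (Ai (x + c *: y))).
rewrite (linD Al) (linZ Al) !nrm_sqrD !Ai => /addIr.
rewrite -!addrA => /addrI h.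
by rewrite mulrBr rmorphB /= addrACA -opprD h subrr.
Qed.
Lemma ip_isometry (V : hilbertType R) (A : H -> V) :
  (forall x y, ip (A x) (A y) = ip x y) -> forall x, nrm (A x) = nrm x.
Proof.
move=> h x; apply/eqP; rewrite -(@eqrXn2 _ 2) ?nrm_ge0 //; apply/eqP.
by apply: rc_inj; rewrite -!ipxx h.
Qed.

(** Lists serve as formal linear combinations of generators: two families indexed by the same
    generators are compared on them before any operator exists. *)
Definition comb (Y : Type) (V : lmodType C) (f : Y -> V) (l : seq (C * Y)) : V :=
  \sum_(p <- l) p.1 *: f p.2.
End Isometries.

Section Adjoint.
Variables (G H : hilbertType R) (A : G -> H).
Hypothesis Ab : bounded_op A.

Lemma adjP x y : ip (A x) y = ip x (adj A y).
Proof.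
have [Al [c c0 Ac]] := (bounded_opP _).1 Ab.
suff /choice[B hB] : forall z, exists w, forall v, ip (A v) z = ip v w.
  have : [set B | forall x y, ip (A x) y = ip x (B y)] B by move=> v z; exact: hB.
  by move=> /(@xgetI _ (fun=> 0))/(_ x y).
move=> z; have [w hw] : exists w, forall v, ip z (A v) = ip w v.
  apply: (@riesz _ _ (nrm z * c)) => [a u v|v]; first by rewrite Al ipDr ipZr.
  by rewrite (le_trans (ip_CS _ _)) // -mulrA ler_wpM2l ?nrm_ge0.
by exists w => v; rewrite -ipC hw ipC.
Qed.
Lemma adjPr x y : ip y (A x) = ip (adj A y) x.
Proof. by rewrite -ipC adjP ipC. Qed.
Lemma adj_uniq (B : H -> G) : (forall x y, ip (A x) y = ip x (B y)) -> adj A = B.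
Proof. by move=> h; apply/funext => y; apply: ip_ext => z; rewrite -adjP h. Qed.
Lemma adj_linear : linear (adj A).
Proof. by move=> a u v; apply: ip_ext => z; rewrite ipDr ipZr -!adjP ipDr ipZr. Qed.
Lemma adj_bound c : 0 <= c -> (forall x, nrm (A x) <= c * nrm x) ->
  forall y, nrm (adj A y) <= c * nrm y.
Proof.
move=> c0 hc y; have [h0|/nrm_le0 ->] := ltP 0 (nrm (adj A y)); last first.
  by rewrite nrm0 mulr_ge0 ?nrm_ge0.
rewrite -(ler_pM2l h0) -expr2 -[leLHS]ger0_norm ?sqr_ge0 // -nrm_rc -ipxx -adjP.
rewrite (le_trans (ip_CS _ _)) // mulrCA [leRHS]mulrA ler_wpM2r ?nrm_ge0 //.
Qed.
Lemma adj_bounded : bounded_op (adj A).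
Proof.
have [Al [c c0 Ac]] := (bounded_opP _).1 Ab.
apply/bounded_opP; split; first exact: adj_linear.
by exists c => //; exact: adj_bound.
Qed.
End Adjoint.
End HilbertSpaces.

(** * Extension of maps prescribed on generators *)

Section Combinations.
Variable R : realType.
Local Notation C := (cplx R).
Variable Y : Type.
Implicit Types l : seq (C * Y).

Definition lscale c l : seq (C * Y) := [seq (c * p.1, p.2) | p <- l].

Section OneModule.
Variables (V : lmodType C) (f : Y -> V).
Lemma comb_cat l l' : comb f (l ++ l') = comb f l + comb f l'.
Proof. by rewrite /comb big_cat. Qed.
Lemma comb_scale c l : comb f (lscale c l) = c *: comb f l.
Proof.
rewrite /comb big_map scaler_sumr; apply: eq_bigr => p _; by rewrite scalerA.
Qed.
Lemma comb1 y : comb f [:: (1, y)] = f y.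
Proof. by rewrite /comb big_seq1 scale1r. Qed.
Lemma comb_nil : comb f [::] = 0. Proof. by rewrite /comb big_nil. Qed.
Lemma comb_span l : lin_span (range f) (comb f l).
Proof.
elim: l => [|p l IH]; first by rewrite comb_nil; exact: lin_span0.
by rewrite /comb big_cons; apply: lin_span_cons => //; exists p.2.
Qed.
Lemma span_comb x : lin_span (range f) x -> exists l, x = comb f l.
Proof.
move: x; apply: lin_spanP; first by exists [::]; rewrite comb_nil.
move=> c _ _ [y _ <-] [l ->]; exists ((c, y) :: l).
by rewrite [RHS]/comb big_cons.
Qed.
End OneModule.

Lemma ip_comb (H : hilbertType R) (f g : Y -> H) l l' :
  ip (comb f l) (comb g l') =
  \sum_(p <- l) \sum_(q <- l') p.1^* * q.1 * ip (f p.2) (g q.2).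
Proof.
rewrite ip_suml; apply: eq_bigr => p _; rewrite ipZl ip_sumr mulr_sumr.
by apply: eq_bigr => q _; rewrite ipZr mulrA.
Qed.

Section Extension.
Variables (G : normedModType C) (W : completeNormedModType C).
Variables (phi : Y -> G) (psi : Y -> W) (k : R).
Hypothesis k0 : 0 <= k.
Hypothesis hk : forall l, nrm (comb psi l) <= k * nrm (comb phi l).

(** The closure of the graph of [comb phi l |-> comb psi l]. As a relation it can be handled before
    it is known to be single-valued, which follows from the estimate [hk]. *)
Definition ext_graph (g : G) (w : W) : Prop := exists L : nat -> seq (C * Y),
  conv (fun n => comb phi (L n)) g /\ conv (fun n => comb psi (L n)) w.

Lemma ext_graph_lin c g g' w w' : ext_graph g w -> ext_graph g' w' ->
  ext_graph (c *: g + g') (c *: w + w').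
Proof.
move=> [L [hg hw]] [L' [hg' hw']].
exists (fun n => lscale c (L n) ++ L' n); split.
  rewrite (_ : (fun n => _) = fun n => c *: comb phi (L n) + comb phi (L' n)).
    apply: convD => //; apply: (bounded_conv _ hg).
    by have := bounded_lin c (bounded_id G) (bounded_0 G G);
       under [X in bounded_op X]eq_fun do rewrite addr0.
  by apply/funext => n; rewrite comb_cat comb_scale.
rewrite (_ : (fun n => _) = fun n => c *: comb psi (L n) + comb psi (L' n)).
  apply: convD => //; apply: (bounded_conv _ hw).
  by have := bounded_lin c (bounded_id W) (bounded_0 W W);
     under [X in bounded_op X]eq_fun do rewrite addr0.
by apply/funext => n; rewrite comb_cat comb_scale.
Qed.

Lemma ext_graph_bound g w : ext_graph g w -> nrm w <= k * nrm g.
Proof.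
move=> [L [hg hw]]; rewrite -subr_le0; apply: null_const.
have hg' := nullM k (fun n => nrm_ge0 _) hg.
apply: null_le (nullD hw hg') _ => n /=.
have := hk (L n); have := nrmD (comb psi (L n)) (w - comb psi (L n)).
rewrite addrC subrK [nrm (w - _)]nrmBC.
have := ler_wpM2l k0 (nrmD (comb phi (L n) - g) g); rewrite subrK mulrDr.
by lra.
Qed.

Lemma ext_graph_gen y : ext_graph (phi y) (psi y).
Proof. by exists (fun=> [:: (1, y)]); rewrite !comb1; split; exact: conv_cst. Qed.

Lemma ext_graph_ex g : closure (lin_span (range phi)) g -> exists w, ext_graph g w.
Proof.
move=> /closure_seq[u us hu].
have /choice[L hL] : forall n, exists l, u n = comb phi l.
  by move=> n; exact: span_comb.
have n0 : null (fun n : nat => 2 * k * n.+1%:R^-1 : R).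
  by apply: nullM null_inv => n; rewrite invr_ge0.
have [n m|w hw _] := cauchy_conv (u := fun n => comb psi (L n)) n0.
  rewrite -scaleN1r -comb_scale -comb_cat (le_trans (hk _)) //.
  rewrite comb_cat comb_scale scaleN1r -!hL.
  have -> : 2 * k / n.+1%:R = k * (n.+1%:R^-1 + n.+1%:R^-1) by ring.
  rewrite ler_wpM2l // (le_trans (nrmT g _ _)) // lerD //; last first.
    by rewrite nrmBC ltW.
  by rewrite (le_trans (ltW (hu _))) // lef_pV2 ?posrE // ler_nat ltnS leq_addr.
exists w, L; split => //; apply: null_le null_inv _ => n; rewrite -hL; exact/ltW/hu.
Qed.

Lemma ext_graph_uniq g w w' : ext_graph g w -> ext_graph g w' -> w = w'.
Proof.
move=> h h'; have := ext_graph_bound (ext_graph_lin (-1) h h').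
rewrite !scaleN1r addNr nrm0 mulr0 addrC => /nrm_le0/eqP.
by rewrite subr_eq0 => /eqP.
Qed.

Lemma dense_extension : closure (lin_span (range phi)) = setT ->
  exists A : G -> W, [/\ bounded_op A, forall x, nrm (A x) <= k * nrm x &
    forall y, A (phi y) = psi y].
Proof.
move=> dense; have /choice[A hA] : forall g, exists w, ext_graph g w.
  by move=> g; apply: ext_graph_ex; rewrite dense.
have Ak x : nrm (A x) <= k * nrm x by exact: ext_graph_bound.
exists A; split => // [|y]; last exact: ext_graph_uniq (hA _) (ext_graph_gen y).
apply/bounded_opP; split; last by exists k.
by move=> c u v; exact: ext_graph_uniq (hA _) (ext_graph_lin _ _ _).
Qed.
End Extension.

(* Outside of the closed span of the phi y, compose with the projection. *)
Lemma hilbert_extension (G : hilbertType R) (W : completeNormedModType C)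
    (phi : Y -> G) (psi : Y -> W) (k : R) : 0 <= k ->
  (forall l, nrm (comb psi l) <= k * nrm (comb phi l)) ->
  exists A : G -> W, [/\ bounded_op A, forall x, nrm (A x) <= k * nrm x &
    forall y, A (phi y) = psi y].
Proof.
move=> k0 hk; pose Gr g w := exists2 p, ext_graph phi psi p w &
   forall a, range phi a -> ip a (g - p) = 0.
have Grex g : exists w, Gr g w.
  have [p cp hp] := projection_exists (range phi) g.
  by have [w hw] := ext_graph_ex k0 hk cp; exists w, p.
have Grlin c g g' w w' : Gr g w -> Gr g' w' -> Gr (c *: g + g') (c *: w + w').
  move=> [p hp hg] [p' hp' hg'].
  exists (c *: p + p'); first exact: ext_graph_lin.
  move=> a ha; have -> : c *: g + g' - (c *: p + p') = c *: (g - p) + (g' - p').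
    by lmodC.
  by rewrite ipDr ipZr hg // hg' // mulr0 addr0.
have Grb g w : Gr g w -> nrm w <= k * nrm g.
  move=> [p hp hg]; rewrite (le_trans (ext_graph_bound k0 hk hp)) // ler_wpM2l //.
  apply: le_sqr; first exact: nrm_ge0.
  have : ip (g - p) p = 0.
    case: hp => L [hL _]; apply: (@ip_closure0 _ _ (range phi)) => [a ha|].
      by rewrite -ipC hg // conjC0.
    by apply/closure_conv; exists (fun n => comb phi (L n)) => // n; exact: comb_span.
  by move=> /pythagoras; rewrite subrK => ->; rewrite lerDr sqr_ge0.
have Gru g w w' : Gr g w -> Gr g w' -> w = w'.
  move=> h h'; have := Grb _ _ (Grlin (-1) _ _ _ _ h h').
  rewrite !scaleN1r addNr nrm0 mulr0 addrC => /nrm_le0/eqP.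
  by rewrite subr_eq0 => /eqP.
have /choice[A hA] := Grex.
have Ak x : nrm (A x) <= k * nrm x by exact: Grb.
exists A; split => // [|y]; last first.
  apply: Gru (hA _) _; exists (phi y); first exact: ext_graph_gen.
  by move=> a _; rewrite subrr ip0r.
apply/bounded_opP; split; last by exists k.
by move=> c u v; exact: Gru (hA _) (Grlin _ _ _ _ _ _ _).
Qed.

(** Equal Gram matrices give formal combinations equal norms, so the assignment is well defined and
    isometric on the closed span. Off that span the map factors through the projection, hence the
    density condition in the last clause. *)
Lemma gram_isometry (G H : hilbertType R) (phi : Y -> G) (psi : Y -> H) :
  (forall y z, ip (psi y) (psi z) = ip (phi y) (phi z)) ->
  exists A : G -> H, [/\ bounded_op A, forall y, A (phi y) = psi y &
    closure (lin_span (range phi)) = setT -> forall x, nrm (A x) = nrm x].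
Proof.
move=> h; have hl l : nrm (comb psi l) = nrm (comb phi l).
  apply/eqP; rewrite -(@eqrXn2 _ 2) ?nrm_ge0 //; apply/eqP.
  apply: rc_inj; rewrite -!ipxx !ip_comb.
  by apply: eq_bigr => p _; apply: eq_bigr => q _; rewrite h.
have [|A [Ab A1 Aphi]] := @hilbert_extension _ _ phi psi 1 ler01.
  by move=> l; rewrite hl mul1r.
exists A; split => // dense x; have : closure (lin_span (range phi)) x by rewrite dense.
move=> /closure_conv[u us ux]; have uA := bounded_conv Ab ux.
apply/eqP; rewrite eq_le; apply/andP; split; first by have := A1 x; rewrite mul1r.
rewrite -subr_le0; apply: null_const; apply: null_le (nullD ux uA) _ => n.
have : nrm (A (u n)) = nrm (u n).
  have [l ->] := span_comb (us n); rewrite (lin_sum Ab.1) -hl; congr nrm.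
  by apply: eq_bigr => p _; rewrite (linZ Ab.1) Aphi.
have := nrmD (x - u n) (u n); have := nrmD (A (u n) - A x) (A x).
by rewrite !subrK [nrm (x - _)]nrmBC /=; lra.
Qed.
End Combinations.

(** * Hilbert spaces of positive kernels *)

Section ComplexCompleteness.
Variable R : realType.
Local Notation C := (cplx R).

Lemma cauchy_conv_real (u a : nat -> R) : null a ->
  (forall n k, `|u (n + k)%N - u n| <= a n) ->
  exists x, null (fun n => `|u n - x|).
Proof.
move=> ha hu; have /cauchy_cvgP/cvgrPdist_lt hc : cauchy (u @ \oo : set_system R^o).
  apply: cauchy_exP => e e0; have [N hN] := ha _ e0.
  exists (u N), N => // n /= hn; rewrite -ball_normE /ball_ /= distrC -(subnKC hn).
  exact: le_lt_trans (hu _ _) (hN _ _).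
exists (lim (u @ \oo : set_system R^o)) => e /hc[N _ hN].
by exists N => n /hN; rewrite distrC.
Qed.

Lemma nrm_Re (z : C) : `|complex.Re (z : R[i])| <= nrm z.
Proof. by rewrite -rc_le -nrmE; exact: normc_ge_Re. Qed.

Lemma nrm_Im (z : C) : `|complex.Im (z : R[i])| <= nrm z.
Proof.
have := nrm_Re ('i * z); rewrite nrmM nrm_i mul1r; apply: le_trans.
have -> : 'i * z = ('i%C : R[i]) * z by congr (_ * _); exact: complexiE.
by case: z => a b /=; rewrite mul0r mul1r sub0r normrN.
Qed.

Lemma cauchy_conv_complex (u : nat -> C) (a : nat -> R) : null a ->
  (forall n k, nrm (u (n + k)%N - u n) <= a n) -> exists z, conv (u : nat -> C^o) z.
Proof.
move=> a0 hu.
have [n k|x hx] := @cauchy_conv_real (fun n => complex.Re (u n : R[i])) a a0.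
  by apply: le_trans (hu n k); rewrite (le_trans _ (nrm_Re _)) // raddfB.
have [n k|y hy] := @cauchy_conv_real (fun n => complex.Im (u n : R[i])) a a0.
  by apply: le_trans (hu n k); rewrite (le_trans _ (nrm_Im _)) // raddfB.
exists (x +i* y)%C; apply: null_le (nullD hx hy) _ => n.
have -> : u n - (x +i* y)%C = rc (complex.Re (u n : R[i]) - x) +
    'i%C * rc (complex.Im (u n : R[i]) - y).
  case: (u n) => p q; apply/eqP; rewrite eq_complex /=.
  by apply/andP; split; apply/eqP; ring.
rewrite (le_trans (nrmD _ _)) // nrmM !nrm_rc.
have -> : ('i%C : C) = 'i by rewrite -complexiE.
by rewrite nrm_i mul1r.
Qed.
(** Centres of balls of radius [1 / (n + 1)] that belong to the Cauchy filter form a Cauchy sequence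
    with an explicit rate, and the filter converges to its limit. *)
Lemma seq_complete (V : normedModType C) :
  (forall (u : nat -> V) (a : nat -> R), null a ->
    (forall n k, nrm (u (n + k)%N - u n) <= a n) -> exists x, conv u x) ->
  forall F : set_system V, ProperFilter F -> cauchy F -> cvg F.
Proof.
move=> complete F FF /cauchyP hF.
have /choice[x hx] : forall n : nat, exists x, F (ball x (rc n.+1%:R^-1)).
  by move=> n; apply: hF; rewrite -rc0 rc_lt invr_gt0.
have hd n m : nrm (x n - x m) <= n.+1%:R^-1 + m.+1%:R^-1.
  have [y []] := filter_ex (filterI (hx n) (hx m)).
  rewrite -!ball_normE /ball_ /= !nrmE !rc_lt => h1 h2.
  by rewrite (le_trans (nrmT y _ _)) // lerD ?ltW // nrmBC.
have n0 : null (fun n : nat => 2 * n.+1%:R^-1 : R).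
  by apply: nullM null_inv => i; rewrite invr_ge0.
have [n k|f hf] := complete x _ n0.
  rewrite (le_trans (hd _ _)) // -[2 * _]/(2 * _) mulr_natl mulr2n lerD2r.
  by rewrite lef_pV2 ?posrE // ler_nat ltnS leq_addr.
apply/cvg_ex; exists f; apply/cvgrPdist_lt => e /rc_gt0[r r0 ->].
have r2 : 0 < r / 2 by rewrite divr_gt0.
have [N hN] := hf _ r2; have [N' hN'] := null_inv _ r2.
near=> y; rewrite nrmE rc_lt (le_lt_trans (nrmT (x (maxn N N')) _ _)) //.
rewrite [r]splitr ltrD //; first by rewrite nrmBC hN // leq_maxl.
have : ball (x (maxn N N')) (rc (maxn N N').+1%:R^-1) y by near: y; exact: hx.
rewrite -ball_normE /ball_ /= nrmE rc_lt => /lt_trans; apply.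
by rewrite hN' // leq_maxr.
Unshelve. all: by end_near.
Qed.

End ComplexCompleteness.

Section PreInnerProduct.
Variable R : realType.
Local Notation C := (cplx R).

Lemma Re_le_nrm (z : C) : complex.Re (z : R[i]) <= nrm z.
Proof. by apply: le_trans (nrm_Re z); exact: ler_norm. Qed.
Lemma addCconj (z : C) : z + z^* = rc (2 * complex.Re (z : R[i])).
Proof. by case: z => a b; apply/eqP; rewrite eq_complex /= subrr eqxx andbT; apply/eqP; ring. Qed.

Variables (V : lmodType C) (b : V -> V -> C).
Hypothesis bDr : forall x y z, b x (y + z) = b x y + b x z.
Hypothesis bZr : forall c x y, b x (c *: y) = c * b x y.
Hypothesis bC : forall x y, (b x y)^* = b y x.
Hypothesis b_ge0 : forall x, 0 <= b x x.

Definition prenorm x : R := Num.sqrt (complex.Re (b x x : R[i])).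

Lemma prenorm_sqr x : b x x = rc (prenorm x ^+ 2).
Proof.
rewrite sqr_sqrtr; first exact: (rc_ge0 (b_ge0 x)).
by have := b_ge0 x; rewrite {1}(rc_ge0 (b_ge0 x)) -rc0 rc_le.
Qed.
Lemma pre_DZ x y c : b (x + c *: y) (x + c *: y) =
  rc (prenorm x ^+ 2) + c * b x y + (c * b x y)^* + rc (nrm c ^+ 2 * prenorm y ^+ 2).
Proof.
have h u v w : b (u + v) w = b u w + b v w by rewrite -bC bDr rmorphD /= !bC.
have hZ d u v : b (d *: u) v = d^* * b u v by rewrite -bC bZr rmorphM /= bC.
rewrite h !bDr !hZ !bZr -[b y x]bC !prenorm_sqr rmorphM /= [rc (nrm c ^+ 2 * _)]rcM.
by rewrite [rc (nrm c ^+ 2)]rcX -nrmE normCK; ring.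
Qed.
Lemma prenorm_CS x y : nrm (b x y) <= prenorm x * prenorm y.
Proof.
apply: le_sqr; first by rewrite mulr_ge0 ?sqrtr_ge0.
rewrite exprMn; apply: quadratic_ge0 => [|c]; first by rewrite sqr_ge0.
by rewrite -pre_DZ.
Qed.
Lemma prenormD x y : prenorm (x + y) <= prenorm x + prenorm y.
Proof.
apply: le_sqr; first by rewrite addr_ge0 ?sqrtr_ge0.
rewrite -rc_le -prenorm_sqr -{1 2}[y]scale1r pre_DZ mul1r -(addrA (rc _)) addCconj.
rewrite -rc1 nrm_rc_ge0 // expr1n mul1r -!rcD rc_le.
by have := le_trans (Re_le_nrm _) (prenorm_CS x y); lra.
Qed.
Lemma prenormZ c x : prenorm (c *: x) = nrm c * prenorm x.
Proof.
apply/eqP; rewrite -(@eqrXn2 _ 2) ?mulr_ge0 ?nrm_ge0 ?sqrtr_ge0 //; apply/eqP/rc_inj.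
have hZ d u v : b (d *: u) v = d^* * b u v by rewrite -bC bZr rmorphM /= bC.
rewrite -prenorm_sqr bZr hZ prenorm_sqr exprMn [RHS]rcM [rc (nrm c ^+ 2)]rcX -nrmE.
by rewrite normCK mulrA.
Qed.
End PreInnerProduct.

Section KernelSpace.
Variable R : realType.
Local Notation C := (cplx R).
Variables (Y : Type) (kappa : Y -> Y -> C).

Definition kform (l l' : seq (C * Y)) : C :=
  \sum_(p <- l) \sum_(q <- l') p.1^* * q.1 * kappa p.2 q.2.

Hypothesis kappaC : forall y z, (kappa y z)^* = kappa z y.
Hypothesis kform_ge0 : forall l, 0 <= kform l l.

Lemma kform_catl l m n : kform (l ++ m) n = kform l n + kform m n.
Proof. by rewrite /kform big_cat. Qed.
Lemma kformC l m : (kform l m)^* = kform m l.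
Proof.
rewrite rmorph_sum /= [RHS]exchange_big /=; apply: eq_bigr => p _.
rewrite rmorph_sum; apply: eq_bigr => q _.
by rewrite !rmorphM /= conjCK kappaC [p.1 * _]mulrC.
Qed.
Lemma kform_catr l m n : kform n (l ++ m) = kform n l + kform n m.
Proof. by rewrite -kformC kform_catl rmorphD /= !kformC. Qed.
Lemma kform_Zr c l m : kform l (lscale c m) = c * kform l m.
Proof.
rewrite /kform mulr_sumr; apply: eq_bigr => p _; rewrite big_map mulr_sumr.
by apply: eq_bigr => q _; rewrite /= !mulrA [c * _]mulrC.
Qed.
Lemma kform_Zl c l m : kform (lscale c l) m = c^* * kform l m.
Proof. by rewrite -kformC kform_Zr rmorphM /= kformC. Qed.

Definition knorm l : R := Num.sqrt (complex.Re (kform l l : R[i])).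
Lemma knorm_ge0 l : 0 <= knorm l. Proof. exact: sqrtr_ge0. Qed.
Lemma kform_norm l : kform l l = rc (knorm l ^+ 2).
Proof.
rewrite sqr_sqrtr; first exact: (rc_ge0 (kform_ge0 l)).
by have := kform_ge0 l; rewrite {1}(rc_ge0 (kform_ge0 l)) -rc0 rc_le.
Qed.
Lemma kform_sqrD c l m : rc (knorm (l ++ lscale c m) ^+ 2) =
  rc (knorm l ^+ 2) + c * kform l m + (c * kform l m)^* +
  rc (nrm c ^+ 2 * knorm m ^+ 2).
Proof.
rewrite -!kform_norm kform_catl !kform_catr !kform_Zl !kform_Zr !kform_norm.
rewrite rmorphM /= kformC rcM addrA; congr (_ + _).
by rewrite mulrA [c^* * c]mulrC -normCK nrmE !rcX.
Qed.
Lemma kform_CS l m : nrm (kform l m) <= knorm l * knorm m.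
Proof.
apply: le_sqr; first by rewrite mulr_ge0 ?knorm_ge0.
rewrite exprMn; apply: quadratic_ge0 => [|c]; first by rewrite sqr_ge0.
by rewrite -kform_sqrD -rc0 rc_le sqr_ge0.
Qed.
Lemma knormD l m : knorm (l ++ m) <= knorm l + knorm m.
Proof.
apply: le_sqr; first by rewrite addr_ge0 ?knorm_ge0.
rewrite -rc_le -kform_norm kform_catl !kform_catr -(kformC l m) !kform_norm.
rewrite addrA -(addrA (rc _)) addCconj -!rcD rc_le.
have := le_trans (Re_le_nrm _) (kform_CS l m); lra.
Qed.
Lemma knormZ c l : knorm (lscale c l) = nrm c * knorm l.
Proof.
apply/eqP; rewrite -(@eqrXn2 _ 2) ?knorm_ge0 ?mulr_ge0 ?nrm_ge0 ?knorm_ge0 //.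
apply/eqP/rc_inj; rewrite -kform_norm kform_Zl kform_Zr kform_norm exprMn [RHS]rcM.
by rewrite mulrA [c^* * c]mulrC -normCK nrmE !rcX.
Qed.

Definition ldiff (l m : seq (C * Y)) : seq (C * Y) := l ++ lscale (-1) m.
(** Lists are not identified modulo relations; this is the triangle inequality for a list that
    agrees with [m ++ n] only as a functional. *)
Lemma knorm_le_diff l m n : (forall o, kform o l = kform o m + kform o n) ->
  knorm l <= knorm m + knorm n.
Proof.
move=> h; apply: le_trans (knormD m n); rewrite le_eqVlt; apply/orP; left.
rewrite -(@eqrXn2 _ 2) ?knorm_ge0 //; apply/eqP/rc_inj; rewrite -!kform_norm.
by rewrite h -(kformC m l) -(kformC n l) !h kform_catl !kform_catr !rmorphD /= !kformC; ring.
Qed.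

Implicit Types L : nat -> seq (C * Y).
Definition kcauchy (a : nat -> R) L : Prop := null a /\
  forall n k, knorm (ldiff (L (n + k)%N) (L n)) <= a n.
Definition keval l y : C := kform [:: (1, y)] l.
(** As for reproducing kernels, the completion is realized by functions on [Y]: the pointwise limits
    of Cauchy sequences of formal combinations. Equality of functions then replaces the quotient by
    null combinations and by null sequences. *)
Definition represents L (f : Y -> C) : Prop :=
  (exists a, kcauchy a L) /\ forall y, conv (fun n => keval (L n) y : C^o) (f y).

Lemma kcauchy_bound a L : kcauchy a L -> forall n, knorm (L n) <= a 0%N + knorm (L 0%N).
Proof.
move=> [_ h] n; apply: le_trans (lerD (h 0%N n) (lexx _)); rewrite add0n.
apply: knorm_le_diff => o.
by rewrite kform_catr kform_Zr; ring.
Qed.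

Lemma kform_cvg a b L L' : kcauchy a L -> kcauchy b L' ->
  exists z, conv (fun n => kform (L n) (L' n) : C^o) z.
Proof.
move=> ha hb; pose B := b 0%N + knorm (L' 0%N); pose A := a 0%N + knorm (L 0%N).
have a0 n : 0 <= a n by apply: le_trans (ha.2 n 0%N); exact: knorm_ge0.
have b0 n : 0 <= b n by apply: le_trans (hb.2 n 0%N); exact: knorm_ge0.
have B0 : 0 <= B by rewrite addr_ge0 ?knorm_ge0.
have A0 : 0 <= A by rewrite addr_ge0 ?knorm_ge0.
have n0 : null (fun n => B * a n + A * b n).
  by apply: nullD; apply: nullM; [|exact: ha.1| |exact: hb.1].
have [n k|z hz] := @cauchy_conv_complex _ (fun n => kform (L n) (L' n)) _ n0.
  have -> : kform (L (n + k)%N) (L' (n + k)%N) - kform (L n) (L' n) =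
    kform (ldiff (L (n + k)%N) (L n)) (L' (n + k)%N) +
    kform (L n) (ldiff (L' (n + k)%N) (L' n)).
    by rewrite kform_catl kform_catr kform_Zl kform_Zr rmorphN1; ring.
  apply: le_trans (nrmD _ _) _; apply: lerD; apply: le_trans (kform_CS _ _) _.
    rewrite mulrC ler_pM ?knorm_ge0 //; [exact: kcauchy_bound|exact: ha.2].
  by rewrite ler_pM ?knorm_ge0 //; [exact: kcauchy_bound|exact: hb.2].
by exists z.
Qed.

Lemma represents_lin c L L' f g : represents L f -> represents L' g ->
  represents (fun n => lscale c (L n) ++ L' n) (c *: f + g).
Proof.
move=> [[a [a0 ha]] hf] [[b [b0 hb]] hg]; split.
  exists (fun n => nrm c * a n + b n); split.
    apply: nullD => //; apply: nullM a0 => n.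
    by apply: le_trans (ha n 0%N); exact: knorm_ge0.
  move=> n k; apply: le_trans (_ : knorm (lscale c (ldiff (L (n + k)%N) (L n))) +
     knorm (ldiff (L' (n + k)%N) (L' n)) <= _); last first.
    by rewrite knormZ lerD // ler_wpM2l ?nrm_ge0.
  apply: knorm_le_diff => o.
  by rewrite !(kform_catr, kform_Zr); ring.
move=> y; rewrite (_ : (fun n => _) = fun n => c *: (keval (L n) y : C^o) + keval (L' n) y).
  apply: convD (hg y); apply: (bounded_conv (f := fun z : C^o => c *: z)) (hf y).
  by have := bounded_lin c (bounded_id C^o) (bounded_0 C^o C^o);
     under [X in bounded_op X]eq_fun do rewrite addr0.
by apply/funext => n; rewrite /keval kform_catr kform_Zr.
Qed.

(** Split [<L n, L n>] into [<L n - L m, L n> + <L m, L n>]: the first term is small for large [m]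
    by the Cauchy property, and the second tends to 0 for fixed [m] by the pointwise limit. This
    makes the norm well defined on functions. *)
Lemma represents0 L : represents L (fun=> 0) -> null (fun n => knorm (L n)).
Proof.
move=> [[a ha] h0]; have [a0 hL] := ha.
have a00 n : 0 <= a n by apply: le_trans (hL n 0%N); exact: knorm_ge0.
pose B := a 0%N + knorm (L 0%N); have B0 : 0 <= B by rewrite addr_ge0 ?knorm_ge0.
have hB := kcauchy_bound ha : forall n, knorm (L n) <= B.
have lim0 l : conv (fun n => kform l (L n) : C^o) 0.
  elim: l => [|[c y] l IH].
    rewrite (_ : (fun n => _) = fun=> 0); first exact: conv_cst.
    by apply/funext => n; rewrite /kform big_nil.
  rewrite (_ : (fun n => _) = fun n => c^* *: (keval (L n) y : C^o) + kform l (L n)).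
    rewrite -[X in conv _ X](addr0 (0 : C^o)); apply: convD IH.
    rewrite -(scaler0 C^o c^*); apply: (bounded_conv (f := fun z : C^o => c^* *: z)) (h0 y).
    by have := bounded_lin c^* (bounded_id C^o) (bounded_0 C^o C^o);
       under [X in bounded_op X]eq_fun do rewrite addr0.
  apply/funext => n; rewrite -cat1s kform_catl /keval.
  rewrite (_ : [:: (c, y)] = lscale c [:: (1, y)]) ?kform_Zl //.
  by rewrite /lscale /= mulr1.
have nn : null (fun n => knorm (L n) ^+ 2).
  move=> e e0; have B1 : 0 < B + 1 by rewrite ltr_wpDl.
  have [m hm] := a0 _ (divr_gt0 (divr_gt0 e0 (ltr0Sn _ 1)) B1).
  have [N hN] := lim0 (L m) _ (divr_gt0 e0 (ltr0Sn _ 1)).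
  exists (maxn m N) => n; rewrite geq_max => /andP[mn Nn].
  rewrite -[ltLHS]ger0_norm ?sqr_ge0 // -nrm_rc -kform_norm.
  have -> : kform (L n) (L n) = kform (ldiff (L n) (L m)) (L n) + kform (L m) (L n).
    by rewrite kform_catl kform_Zl rmorphN1; ring.
  apply: le_lt_trans (nrmD _ _) _; rewrite [e]splitr ltr_leD //; last first.
    by have := hN n Nn; rewrite subr0 => /ltW.
  apply: le_lt_trans (kform_CS _ _) _.
  have := hm m (leqnn m); rewrite ltr_pdivlMr // => /(le_lt_trans _); apply.
  apply: ler_pM; rewrite ?knorm_ge0 //; first by rewrite -(subnKC mn).
  by rewrite (le_trans (hB _)) // lerDl.
have := null_sqrt nn; congr null; apply/funext => n.
by rewrite sqrtr_sqr ger0_norm ?knorm_ge0.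
Qed.

Lemma represents_const l : represents (fun=> l) (keval l).
Proof.
split=> [|y]; last exact: conv_cst.
exists (fun=> 0); split=> [e e0|n k]; first by exists 0%N.
apply: le_sqr => //; rewrite expr0n /= -rc_le -kform_norm.
rewrite kform_catl !kform_catr !kform_Zl !kform_Zr rmorphN1 rc0.
by rewrite (_ : _ + _ = 0) //; ring.
Qed.

Definition kpred : {pred (Y -> C)} := fun f => `[<exists L, represents L f>].

Lemma kpred_closed : submod_closed kpred.
Proof.
split=> [|c f g /asboolP[L hL] /asboolP[L' hL']]; apply/asboolP.
  exists (fun=> [::]); rewrite (_ : 0 = keval [::]); first exact: represents_const.
  by apply/funext => y; rewrite /keval /kform big_seq1 big_nil.
by exists (fun n => lscale c (L n) ++ L' n); exact: represents_lin.
Qed.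

Record kspace := KSpace { kfun : Y -> C ; kfunP : kpred kfun }.
HB.instance Definition _ := [isSub for kfun].
HB.instance Definition _ := [Choice of kspace by <:].
HB.instance Definition _ :=
  GRing.SubChoice_isSubLmodule.Build _ _ _ kspace (GRing.submod_closed_semi kpred_closed).

Lemma kfun_lin c (f g : kspace) : kfun (c *: f + g) = c *: kfun f + kfun g.
Proof. exact: erefl. Qed.

Definition krep (f : kspace) : nat -> seq (C * Y) :=
  sval (cid (asboolP _ (kfunP f))).
Lemma krepP f : represents (krep f) (kfun f).
Proof. by rewrite /krep; case: cid. Qed.

Definition kip (f g : kspace) : C :=
  xget 0 [set z | conv (fun n => kform (krep f n) (krep g n) : C^o) z].

Lemma kip_krep f g : conv (fun n => kform (krep f n) (krep g n) : C^o) (kip f g).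
Proof.
have [[a ha] _] := krepP f; have [[b hb] _] := krepP g.
by have [z hz] := kform_cvg ha hb; exact: (@xgetI _ 0 [set z | conv (fun n => kform (krep f n) (krep g n) : C^o) z] z hz).
Qed.

Lemma represents_diff L L' f : represents L f -> represents L' f ->
  null (fun n => knorm (ldiff (L' n) (L n))).
Proof.
move=> h h'; have := represents_lin (-1) h h'.
rewrite scaleN1r addNr => /represents0 h0; apply: null_le h0 _ => n.
rewrite le_eqVlt; apply/orP; left; rewrite -(@eqrXn2 _ 2) ?knorm_ge0 //.
apply/eqP/rc_inj; rewrite -!kform_norm.
by rewrite !(kform_catl, kform_catr, kform_Zl, kform_Zr); ring.
Qed.

(** Independence of the representing sequences: two sequences for the same function differ by a null
    sequence, by [represents0]. *)
Lemma kipP L L' f g : represents L (kfun f) -> represents L' (kfun g) ->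
  conv (fun n => kform (L n) (L' n) : C^o) (kip f g).
Proof.
move=> hL hL'; have [[a ha] _] := hL; have [[b hb] _] := krepP g.
have a1 := kcauchy_bound ha; have b1 := kcauchy_bound hb.
have d1 := represents_diff (krepP f) hL; have d2 := represents_diff (krepP g) hL'.
have n1 := nullM (b 0%N + knorm (krep g 0%N)) (fun n => knorm_ge0 _) d1.
have n2 := nullM (a 0%N + knorm (L 0%N)) (fun n => knorm_ge0 _) d2.
apply: null_le (nullD (nullD n1 n2) (kip_krep f g)) _ => n /=.
rewrite (le_trans (nrmT (kform (krep f n) (krep g n)) _ _)) // lerD2r.
have -> : kform (L n) (L' n) - kform (krep f n) (krep g n) =
   kform (ldiff (L n) (krep f n)) (krep g n) + kform (L n) (ldiff (L' n) (krep g n)).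
  by rewrite kform_catl kform_catr kform_Zl kform_Zr rmorphN1; ring.
rewrite (le_trans (nrmD _ _)) // lerD // (le_trans (kform_CS _ _)) //.
  by rewrite mulrC ler_wpM2r ?knorm_ge0.
by rewrite ler_wpM2r ?knorm_ge0.
Qed.

Lemma kipDr (f g h : kspace) : kip f (g + h) = kip f g + kip f h.
Proof.
have h1 : represents (fun n => lscale 1 (krep g n) ++ krep h n) (kfun (g + h)).
  rewrite -[X in kfun (X + _)]scale1r kfun_lin; apply: represents_lin; exact: krepP.
apply: conv_uniq (kipP (krepP f) h1) _.
rewrite (_ : (fun n => _) = fun n => (kform (krep f n) (krep g n) : C^o) +
  kform (krep f n) (krep h n)); first by apply: convD; exact: kip_krep.
by apply/funext => n; rewrite kform_catr kform_Zr mul1r.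
Qed.

Lemma kipZr c f g : kip f (c *: g) = c * kip f g.
Proof.
have h0 : represents (fun=> [::]) (kfun 0).
  rewrite (_ : kfun 0 = keval [::]); first exact: represents_const.
  rewrite -[kfun 0]/(val (0 : kspace)) raddf0.
  by apply/funext => y; rewrite /keval /kform big_seq1 big_nil.
have h1 : represents (fun n => lscale c (krep g n) ++ [::]) (kfun (c *: g)).
  rewrite -[X in kfun X]addr0 kfun_lin; apply: represents_lin => //; exact: krepP.
apply: conv_uniq (kipP (krepP f) h1) _.
rewrite (_ : (fun n => _) = fun n => c *: (kform (krep f n) (krep g n) : C^o)).
  apply: (bounded_conv (f := fun z : C^o => c *: z)) (kip_krep f g).
  by have := bounded_lin c (bounded_id C^o) (bounded_0 C^o C^o);
     under [X in bounded_op X]eq_fun do rewrite addr0.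
by apply/funext => n; rewrite cats0 kform_Zr.
Qed.

Lemma kipC f g : (kip f g)^* = kip g f.
Proof.
apply: (@conv_uniq _ C^o (fun n => kform (krep g n) (krep f n))); last exact: kip_krep.
apply: null_le (kip_krep f g) _ => n.
by rewrite -kformC -rmorphB nrm_conj.
Qed.

Lemma kip_real f : kip f f = rc (complex.Re (kip f f : R[i])) /\
  0 <= complex.Re (kip f f : R[i]).
Proof.
have hR : complex.Im (kip f f : R[i]) = 0.
  have := kipC f f; case: (kip f f) => x y [] /= h.
  by lra.
split; first by move: hR; case: (kip f f) => x y /= ->.
rewrite -oppr_le0; apply: null_const; apply: null_le (kip_krep f f) _ => n.
rewrite kform_norm; apply: le_trans (nrm_Re _).
rewrite raddfB /=; apply: le_trans (ler_norm _); rewrite -[leLHS]add0r lerD2r.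
exact: sqr_ge0.
Qed.

Lemma kip_eq0 f : kip f f = 0 -> f = 0.
Proof.
move=> h; apply: val_inj; rewrite raddf0 /=; apply/funext => y.
have n0 : null (fun n => knorm (krep f n) ^+ 2).
  have h1 := kip_krep f f; rewrite h in h1; apply: null_le h1 _ => n.
  by rewrite subr0 kform_norm nrm_rc_ge0 // sqr_ge0.
have n2 : null (fun n => knorm (krep f n)).
  apply: null_le (null_sqrt n0) _ => n.
  by rewrite sqrtr_sqr ger0_norm ?knorm_ge0.
have n1 := nullM (knorm [:: (1, y)]) (fun n => knorm_ge0 _) n2.
apply: (@conv_uniq _ C^o (fun n => keval (krep f n) y)); first exact: (krepP f).2.
by apply: null_le n1 _ => n; rewrite subr0; exact: kform_CS.
Qed.

Lemma kip_ge0 f : 0 <= kip f f.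
Proof. by have [-> h] := kip_real f; rewrite -rc0 rc_le. Qed.

Definition kspace_norm (f : kspace) : C := rc (prenorm kip f).

Lemma kip_norm f : kip f f = kspace_norm f ^+ 2.
Proof. by rewrite (prenorm_sqr kip_ge0) rcX. Qed.
Lemma kspace_normD f g : kspace_norm (f + g) <= kspace_norm f + kspace_norm g.
Proof. by rewrite -rcD rc_le; exact: (prenormD kipDr kipZr kipC kip_ge0). Qed.
Lemma kspace_normZ c f : kspace_norm (c *: f) = `|c| * kspace_norm f.
Proof. by rewrite nrmE -rcM; congr rc; exact: (prenormZ kipZr kipC kip_ge0). Qed.
Lemma kspace_norm0 f : kspace_norm f = 0 -> f = 0.
Proof. by move=> h; apply: kip_eq0; rewrite kip_norm h expr0n. Qed.

HB.instance Definition _ :=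
  Lmodule_isNormed.Build C kspace kspace_normD kspace_normZ kspace_norm0.

Lemma nrm_kspace (f : kspace) : nrm f = prenorm kip f.
Proof. by []. Qed.

Definition kelem (l : seq (C * Y)) : kspace := KSpace (asboolT
  (ex_intro (fun L => represents L (keval l)) (fun=> l) (represents_const l))).

Lemma kip_kelem l m : kip (kelem l) (kelem m) = kform l m.
Proof.
apply: (conv_uniq (kipP _ _ : conv _ (_ : C^o)) (conv_cst (kform l m : C^o)));
  exact: represents_const.
Qed.

Lemma kelem_lin c l m : kelem (lscale c l ++ m) = c *: kelem l + kelem m.
Proof.
apply: val_inj; apply/funext => y /=.
by rewrite /keval kform_catr kform_Zr.
Qed.

Lemma kelem_dist a L (f : kspace) : kcauchy a L -> represents L (kfun f) ->
  forall n, nrm (f - kelem (L n)) <= a n.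
Proof.
move=> ha hL n; have a0 : 0 <= a n by apply: le_trans (ha.2 n 0%N); exact: knorm_ge0.
have hd : represents (fun k => lscale (-1) (L n) ++ L k) (kfun (f - kelem (L n))).
  have -> : f - kelem (L n) = -1 *: kelem (L n) + f by rewrite scaleN1r addrC.
  by rewrite kfun_lin; apply: represents_lin hL; exact: represents_const.
apply: le_sqr => //; rewrite nrm_kspace -rc_le -(prenorm_sqr kip_ge0) (kip_real _).1 rc_le.
rewrite -subr_le0; apply: null_const.
have h1 := conv_shift n (kipP hd hd); apply: null_le h1 _ => k.
set z := kip _ _; set d := lscale _ _ ++ _.
have hk : knorm d <= a n.
  rewrite (le_trans _ (ha.2 n k)) // le_eqVlt; apply/orP; left.
  rewrite -(@eqrXn2 _ 2) ?knorm_ge0 //; apply/eqP/rc_inj; rewrite -!kform_norm addnC.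
  by rewrite !(kform_catl, kform_catr, kform_Zl, kform_Zr); ring.
rewrite kform_norm nrmBC; apply: le_trans (nrm_Re _); apply: le_trans (ler_norm _).
rewrite raddfB /= lerD2l lerN2 ler_sqr ?nnegrE ?knorm_ge0 //.
Qed.

Lemma kspace_dense (f : kspace) e : 0 < e -> exists l, nrm (f - kelem l) < e.
Proof.
move=> e0; have [[a ha] _] := krepP f; have [N hN] := ha.1 _ e0.
exists (krep f N); apply: le_lt_trans (hN N (leqnn N)).
exact: kelem_dist ha (krepP f) N.
Qed.

Lemma nrm_kelem l m : nrm (kelem l - kelem m) = knorm (ldiff l m).
Proof.
rewrite (_ : kelem l - kelem m = kelem (lscale (-1) m ++ l)); last first.
  by rewrite kelem_lin scaleN1r addrC.
rewrite nrm_kspace /prenorm kip_kelem /knorm; congr (Num.sqrt (complex.Re _)).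
by rewrite !(kform_catl, kform_catr, kform_Zl, kform_Zr); ring.
Qed.

(** Replacing [u n] by a formal combination within [1 / (n + 1)] gives a Cauchy sequence of lists
    with rate [a n + 2 / (n + 1)]; its pointwise limit is the limit sought. *)
Lemma kspace_seq_complete (u : nat -> kspace) (a : nat -> R) : null a ->
  (forall n k, nrm (u (n + k)%N - u n) <= a n) -> exists f, conv u f.
Proof.
move=> a0 hu; have /choice[L hL] : forall n, exists l, nrm (u n - kelem l) < n.+1%:R^-1.
  by move=> n; apply: kspace_dense; rewrite invr_gt0.
have hc : kcauchy (fun n => a n + 2 * n.+1%:R^-1) L.
  split; first by apply: nullD => //; apply: nullM null_inv => n; rewrite invr_ge0.
  move=> n k; rewrite -nrm_kelem.
  rewrite (le_trans (nrmT (u (n + k)%N) _ _)) // (nrmBC _ (u _)).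
  have := nrmT (u n) (u (n + k)%N) (kelem (L n)).
  have := hu n k; have := ltW (hL n); have := ltW (hL (n + k)%N).
  have : (n + k).+1%:R^-1 <= n.+1%:R^-1 :> R.
    by rewrite lef_pV2 ?posrE // ler_nat ltnS leq_addr.
  by move: (nrm _) (nrm _) (nrm _) (nrm _) (_^-1) (_^-1) => *; lra.
have /choice[f hf] : forall y, exists z, conv (fun n => keval (L n) y : C^o) z.
  move=> y; have hy : kcauchy (fun=> 0) (fun=> [:: (1, y)]).
    by have [[b hb] _] := represents_const [:: (1 : C, y)];
       split=> [e e0|n k]; [exists 0%N|rewrite le_eqVlt; apply/orP; left;
         rewrite -nrm_kelem subrr nrm0].
  exact: kform_cvg hy hc.
have hr : represents L f by split=> //; exists (fun n => a n + 2 * n.+1%:R^-1).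
exists (KSpace (asboolT (ex_intro (fun L => represents L f) L hr))).
apply: null_le (nullD null_inv hc.1) _ => n.
rewrite (le_trans (nrmT (kelem (L n)) _ _)) // lerD ?(ltW (hL n)) // nrmBC.
exact: kelem_dist hc _ n.
Qed.

Lemma kspace_complete (F : set_system kspace) : ProperFilter F -> cauchy F -> cvg F.
Proof. exact: seq_complete kspace_seq_complete F. Qed.

HB.instance Definition _ := Uniform_isComplete.Build kspace kspace_complete.
HB.instance Definition _ := isHilbert.Build R kspace kipDr kipZr kipC kip_norm.

(** The Hilbert spaces constructed below, namely tensor products and ranges of projections, come
    from this construction. *)
Lemma kernel_space : exists (G : hilbertType R) (phi : Y -> G),
  (forall y z, ip (phi y) (phi z) = kappa y z) /\ closure (lin_span (range phi)) = setT.
Proof.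
exists kspace, (fun y => kelem [:: (1, y)]); split=> [y z|].
  by rewrite [LHS]kip_kelem /kform !big_seq1 conjC1 !mul1r.
apply/seteqP; split=> // f _; apply/closureP => e /(kspace_dense f)[l hl].
exists (kelem l); last by rewrite nrmBC.
elim: l {hl} => [|[c y] l IH].
  rewrite (_ : kelem [::] = 0); first exact: lin_span0.
  by have := kelem_lin (-1) [::] [::]; rewrite scaleN1r addNr.
rewrite -cat1s (_ : [:: (c, y)] = lscale c [:: (1, y)]); last by rewrite /lscale /= mulr1.
by rewrite kelem_lin; apply: lin_span_cons => //; exists y.
Qed.
End KernelSpace.

(** * Positive elements of C*-algebras *)

Section LogConvex.
Variable R : realType.

(** The quotients [e n.+1 / e n] do not decrease. If the first one exceeded 1, the sequence would
    grow geometrically, against the linear bound. This takes the place of spectral radius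
    formulas. *)
Lemma log_convex_le (e : nat -> R) (c : R) : (forall n, 0 <= e n) ->
  (forall n, e n.+1 ^+ 2 <= e n * e n.+2) -> (forall n, e n <= c * n.+1%:R) ->
  e 1%N <= e 0%N.
Proof.
move=> e0 ec eb; rewrite leNgt; apply/negP => h01.
have p0 : 0 < e 0%N.
  rewrite lt_neqAle eq_sym e0 andbT; apply/eqP => z.
  have := ec 0%N; rewrite z mul0r => h; have := sqr_ge0 (e 1%N) => h'.
  have /eqP : e 1%N ^+ 2 = 0 by apply/eqP; rewrite eq_le h h'.
  by rewrite sqrf_eq0 => /eqP z1; move: h01; rewrite z z1 ltxx.
pose r := e 1%N / e 0%N; pose d := r - 1.
have d0 : 0 < d by rewrite subr_gt0 ltr_pdivlMr ?mul1r.
have hr n : 0 < e n /\ r * e n <= e n.+1.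
  elim: n => [|n [en hn]]; first by rewrite divfK ?gt_eqF.
  have en1 : 0 < e n.+1 by apply: lt_le_trans hn; rewrite mulr_gt0 ?divr_gt0 // (lt_trans p0).
  split=> //; rewrite -(ler_pM2l en) (le_trans _ (ec n)) // expr2 mulrA ler_wpM2r //.
  by rewrite mulrC.
have hp n : e 0%N * r ^+ n <= e n.
  elim: n => [|n IH]; first by rewrite expr0 mulr1.
  apply: le_trans (hr n).2; rewrite exprS mulrCA ler_wpM2l //.
  by rewrite divr_ge0.
have bern n : 1 + n%:R * d <= r ^+ n.
  elim: n => [|n IH]; first by rewrite mul0r addr0 expr0.
  have r1 : 0 <= r by rewrite divr_ge0.
  rewrite exprS; apply: le_trans (ler_wpM2l r1 IH).
  have -> : r = 1 + d by rewrite /d; ring.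
  rewrite -natr1; have : 0 <= n%:R * d ^+ 2 by rewrite mulr_ge0 ?sqr_ge0.
  by lra.
have c0 : 0 < c by have := eb 0%N; rewrite mulr1; exact: lt_le_trans.
have ed : 0 < e 0%N * d ^+ 2 by rewrite mulr_gt0 ?exprn_gt0.
(* Bernoulli's bound on [r ^+ n] is squared, so that at index [2 * n] the lower bound is quadratic
   in [n]; this [n] makes it exceed the linear upper bound. *)
pose n := (Num.truncn (3 * c / (e 0%N * d ^+ 2))).+1.
have : 3 * c / (e 0%N * d ^+ 2) < n%:R by exact: truncnS_gt.
rewrite ltr_pdivrMr // => hn.
have h1 : e 0%N * (1 + n%:R * d) ^+ 2 <= c * (2 * n).+1%:R.
  apply: le_trans (eb _); apply: le_trans (hp _); rewrite ler_pM2l // mulnC exprM.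
  by rewrite ler_sqr ?nnegrE ?bern ?exprn_ge0 ?divr_ge0 ?addr_ge0 ?mulr_ge0 // ltW.
have n1 : 1 <= n%:R :> R by rewrite ler1n.
rewrite -natr1 natrM in h1.
set N : R := n%:R in hn h1 n1.
have hc : c * (2 * N + 1) <= 3 * c * N by have := ler_wpM2l (ltW c0) n1; lra.
have hN : 3 * c * N < N * (e 0%N * d ^+ 2) * N.
  by rewrite ltr_pM2r // (lt_le_trans ltr01).
have : 0 <= e 0%N * (N * d) by rewrite !mulr_ge0 ?ltW // (lt_le_trans ltr01).
have : e 0%N * (1 + N * d) ^+ 2 = e 0%N + 2 * (e 0%N * (N * d)) + N * (e 0%N * d ^+ 2) * N.
  by ring.
lra.
Qed.
End LogConvex.

Section SquareRoot.
Variable R : realType.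
Local Notation C := (cplx R).
Variables (V : completeNormedModType C) (f : V -> V).
Hypothesis fl : linear f.
Hypothesis f1 : forall x, nrm (f x) <= nrm x.

(* The fixed point iteration for [g = (f + g^2) / 2], that is
   [(1 - g)^2 = 1 - f]; [sqrt_bound] majorizes its norms. *)
Fixpoint sqrt_iter n (x : V) : V :=
  if n is m.+1 then rc 2^-1 *: (f x + sqrt_iter m (sqrt_iter m x)) else 0.
Fixpoint sqrt_bound n : R := if n is m.+1 then (1 + sqrt_bound m ^+ 2) / 2 else 0.

Lemma sqrt_iter_linear n : linear (sqrt_iter n).
Proof.
elim: n => [|n IH] a x y /=; first by rewrite scaler0 addr0.
by rewrite fl !IH; lmodC.
Qed.

Lemma sqrt_bound_itv n : 0 <= sqrt_bound n <= 1.
Proof.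
elim: n => [|n /andP[h0 h1]] /=; first by rewrite lexx ler01.
have h2 : sqrt_bound n ^+ 2 <= 1 by rewrite expr_le1.
have := sqr_ge0 (sqrt_bound n).
by move: (_ ^+ 2) h2 => z h2 h3; apply/andP; split; lra.
Qed.

Lemma sqrt_iter_bound n x : nrm (sqrt_iter n x) <= sqrt_bound n * nrm x.
Proof.
elim: n x => [|n IH] x /=; first by rewrite nrm0 mul0r.
have /andP[h0 h1] := sqrt_bound_itv n.
rewrite nrmZr ?invr_ge0 // [_ / 2]mulrC -mulrA ler_wpM2l ?invr_ge0 //.
rewrite (le_trans (nrmD _ _)) // mulrDl mul1r lerD // (le_trans (IH _)) //.
by rewrite expr2 -mulrA ler_wpM2l.
Qed.

Lemma sqrt_bound_mono n k : sqrt_bound n <= sqrt_bound (n + k)%N.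
Proof.
elim: n k => [|n IH] k; first by have /andP[] := sqrt_bound_itv k.
rewrite addSn /= ler_pM2r ?invr_gt0 // lerD2l ler_sqr ?nnegrE //.
  by have /andP[] := sqrt_bound_itv n.
by have /andP[] := sqrt_bound_itv (n + k).
Qed.

(** For two stages [G] and [g] of the iteration, the next difference is half of
    [(G - g) G + g (G - g)]; the increments of the scalar sequence [sqrt_bound] follow the same
    pattern. *)
Lemma sqrt_iter_diff n k x : nrm (sqrt_iter (n + k) x - sqrt_iter n x) <=
  (sqrt_bound (n + k)%N - sqrt_bound n) * nrm x.
Proof.
elim: n x => [|n IH] x.
  by rewrite /= subr0 subr0; exact: sqrt_iter_bound.
rewrite addSn /=.
set a := sqrt_bound (n + k)%N; set b := sqrt_bound n.
have /andP[a0 a1] := sqrt_bound_itv (n + k) : 0 <= a <= 1.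
have /andP[b0 b1] := sqrt_bound_itv n : 0 <= b <= 1.
have ab : b <= a := sqrt_bound_mono n k.
set y := sqrt_iter (n + k) x.
have -> : rc 2^-1 *: (f x + sqrt_iter (n + k) y) -
    rc 2^-1 *: (f x + sqrt_iter n (sqrt_iter n x)) =
    rc 2^-1 *: ((sqrt_iter (n + k) y - sqrt_iter n y) + sqrt_iter n (y - sqrt_iter n x)).
  by rewrite (linB (sqrt_iter_linear n)); lmodC.
have -> : (1 + a ^+ 2) / 2 - (1 + b ^+ 2) / 2 = 2^-1 * ((a - b) * a + b * (a - b)) by field.
rewrite nrmZr ?invr_ge0 // -[leRHS]mulrA ler_wpM2l ?invr_ge0 //.
rewrite (le_trans (nrmD _ _)) // mulrDl lerD //.
  rewrite (le_trans (IH _)) // -[leRHS]mulrA ler_wpM2l ?subr_ge0 //.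
  exact: sqrt_iter_bound.
rewrite (le_trans (sqrt_iter_bound _ _)) // -[leRHS]mulrA ler_wpM2l //; exact: IH.
Qed.

(** The defect [d = 1 - sqrt_bound n] is followed by [d - d^2 / 2], whence [d <= 2 / (n + 1)] by
    induction. *)
Lemma sqrt_bound_null : null (fun n => 1 - sqrt_bound n).
Proof.
have n0 : null (fun n : nat => 2 * n.+1%:R^-1 : R).
  by apply: nullM null_inv => n; rewrite invr_ge0.
apply: null_le n0 _ => n; elim: n => [|n IH] /=; first by rewrite invr1; lra.
have /andP[h0 h1] := sqrt_bound_itv n.
set d := 1 - sqrt_bound n in IH *.
have d0 : 0 <= d by rewrite subr_ge0.
have d1 : d <= 1 by rewrite /d; lra.
have -> : 1 - (1 + sqrt_bound n ^+ 2) / 2 = d - d ^+ 2 / 2 by rewrite /d; field.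
set m : R := n.+1%:R in IH *; have m0 : 0 < m by rewrite ltr0n.
have -> : n.+2%:R = m + 1 :> R by rewrite natr1.
have m1 : 0 < m + 1 by lra.
rewrite ler_pdivlMr //.
have dm : d * m <= 2 by rewrite -ler_pdivlMr.
have h : 0 <= (1 - d) * (2 - d * m) by rewrite mulr_ge0 // subr_ge0.
have := sqr_ge0 d; have -> : (d - d ^+ 2 / 2) * (m + 1) =
  d * m + d - d * (d * m) / 2 - d ^+ 2 / 2 by field.
have : (1 - d) * (2 - d * m) = 2 - d * m - 2 * d + d * (d * m) by ring.
lra.
Qed.

Lemma sqrt_iter_lim : exists g : V -> V,
  [/\ linear g, forall x, nrm (g x) <= nrm x,
      forall x, conv (fun n => sqrt_iter n x) (g x),
      (forall n x, nrm (sqrt_iter n x - g x) <= (1 - sqrt_bound n) * nrm x) &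
      forall x, f x = rc 2 *: g x - g (g x)].
Proof.
have hc x : exists y, conv (fun n => sqrt_iter n x) y /\
    forall n, nrm (sqrt_iter n x - y) <= (1 - sqrt_bound n) * nrm x.
  have n0 : null (fun n => (1 - sqrt_bound n) * nrm x).
    under [X in null X]eq_fun do rewrite mulrC.
    apply: nullM sqrt_bound_null => n; rewrite subr_ge0.
    by have /andP[] := sqrt_bound_itv n.
  have [n k|y hy hy'] := cauchy_conv (u := fun n => sqrt_iter n x) n0.
    rewrite (le_trans (sqrt_iter_diff _ _ _)) // ler_wpM2r ?nrm_ge0 // lerD2r.
    by have /andP[] := sqrt_bound_itv (n + k).
  by exists y.
have /choice[g hg] := hc.
have gc x := (hg x).1; have {hg}gd x := (hg x).2.
have gl : linear g.
  move=> a x y; apply: conv_uniq (gc _) _.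
  rewrite (_ : (fun n => _) = fun n => a *: sqrt_iter n x + sqrt_iter n y).
    apply: convD => //; apply: (bounded_conv (f := fun z : V => a *: z)) (gc x).
    by have := bounded_lin a (bounded_id V) (bounded_0 V V);
       under [X in bounded_op X]eq_fun do rewrite addr0.
  by apply/funext => n; rewrite sqrt_iter_linear.
have g1 x : nrm (g x) <= nrm x.
  apply: conv_nrm_le (gc x) _ => n; rewrite (le_trans (sqrt_iter_bound _ _)) //.
  by rewrite ler_piMl ?nrm_ge0 //; have /andP[] := sqrt_bound_itv n.
exists g; split=> // x.
have hgg : conv (fun n => sqrt_iter n (sqrt_iter n x)) (g (g x)).
  have n0 : null (fun n => (1 - sqrt_bound n) * nrm x).
    under [X in null X]eq_fun do rewrite mulrC.
    apply: nullM sqrt_bound_null => n; rewrite subr_ge0.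
    by have /andP[] := sqrt_bound_itv n.
  apply: null_le (nullD n0 n0) _ => n.
  have /andP[b0 b1] := sqrt_bound_itv n.
  rewrite (le_trans (nrmT (g (sqrt_iter n x)) _ _)) // lerD //.
    rewrite (le_trans (gd _ n)) // ler_wpM2l ?subr_ge0 //.
    by rewrite (le_trans (sqrt_iter_bound _ _)) // ler_piMl ?nrm_ge0.
  by rewrite -(linB gl) (le_trans (g1 _)) // gd.
have h2 : rc 2^-1 *: (f x + g (g x)) = g x.
  apply: (@conv_uniq _ _ (fun n => sqrt_iter n.+1 x)).
    apply: (bounded_conv (f := fun z : V => rc 2^-1 *: z)).
      by have := bounded_lin (rc 2^-1) (bounded_id V) (bounded_0 V V);
         under [X in bounded_op X]eq_fun do rewrite addr0.
    exact: convD (conv_cst _) hgg.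
  by have := conv_shift 1 (gc x); under [X in conv X]eq_fun do rewrite addn1.
by rewrite -{1}h2 scalerA -rcM mulfV // scale1r addrK.
Qed.
End SquareRoot.

Section CstarOperators.
Variable R : realType.
Local Notation C := (cplx R).
Variable M : cstarType R.
Implicit Types (a b x y : M) (f g k l : M -> M).

Local Notation "a ** b" := (amul a b) (at level 40, left associativity).
Local Notation "a ^*'" := (astar a) (at level 2).

Lemma amul_linr a : linear (amul a).
Proof. by move=> c u v; rewrite amulDr amulZr. Qed.
Lemma amul_linl b : linear (amul^~ b).
Proof. by move=> c u v; rewrite amulDl amulZl. Qed.
Lemma amul0r a : a ** 0 = 0. Proof. exact: lin0 (amul_linr a). Qed.
Lemma amul0l a : 0 ** a = 0. Proof. exact: lin0 (amul_linl a). Qed.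
Lemma amulNr a b : a ** (- b) = - (a ** b). Proof. exact: linN (amul_linr a) b. Qed.
Lemma amulNl a b : (- a) ** b = - (a ** b). Proof. exact: linN (amul_linl b) a. Qed.
Lemma astar0 : (0 : M)^*' = 0.
Proof. by have := astarZ (0 : C) (0 : M); rewrite !scale0r conjC0 scale0r. Qed.
Lemma astarN a : (- a)^*' = - a^*'.
Proof. by rewrite -scaleN1r astarZ rmorphN1 scaleN1r. Qed.
Lemma nrm_amul a b : nrm (a ** b) <= nrm a * nrm b.
Proof. by rewrite -rc_le rcM -!nrmE norm_amul. Qed.
Lemma nrm_star_amul a : nrm (a^*' ** a) = nrm a ^+ 2.
Proof. by apply: rc_inj; rewrite -nrmE norm_astar rcX nrmE. Qed.
Lemma amul_star_eq0 a : a^*' ** a = 0 -> a = 0.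
Proof.
move=> h; apply: nrm_eq0; apply/eqP; rewrite -[_ == 0]sqrf_eq0 -nrm_star_amul h.
by rewrite nrm0.
Qed.
Lemma nrm_astar a : nrm a^*' = nrm a.
Proof.
suff h b : nrm b <= nrm b^*' by apply/eqP; rewrite eq_le h -{2}(astarK a) h.
have [h0|/nrm_le0 ->] := ltP 0 (nrm b); last by rewrite astar0.
rewrite -(ler_pM2l h0) -expr2 -nrm_star_amul (le_trans (nrm_amul _ _)) //.
by rewrite mulrC.
Qed.
Lemma amul_bounded a : bounded_op (amul a).
Proof.
apply/bounded_opP; split; first exact: amul_linr.
by exists (nrm a) => [|b]; [exact: nrm_ge0|exact: nrm_amul].
Qed.
Lemma amulr_bounded a : bounded_op (amul^~ a).
Proof.
apply/bounded_opP; split; first exact: amul_linl.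
by exists (nrm a) => [|b]; [exact: nrm_ge0|rewrite mulrC; exact: nrm_amul].
Qed.
Lemma nrm_le_amul a c : 0 <= c -> (forall b, nrm (a ** b) <= c * nrm b) -> nrm a <= c.
Proof.
move=> c0 h; have [h0|h0] := ltP 0 (nrm a); last exact: le_trans h0 c0.
rewrite -(ler_pM2r h0) -expr2 -[nrm a]nrm_astar -nrm_star_amul astarK.
by rewrite nrm_astar -[X in _ <= c * X]nrm_astar; exact: h.
Qed.

(* Self-adjoint operators for the M-valued inner product [x^* y] of M. *)
Definition selfadj f : Prop :=
  linear f /\ forall x y, (f x)^*' ** y = x^*' ** f y.
Definition op_le f (c : R) : Prop := forall x, nrm (f x) <= c * nrm x.
(** Positivity without spectra: a self-adjoint [f] has nonnegative spectrum exactly if [t - f] has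
    norm at most [t] for some [t >= 0]. Operators on M are used in place of elements so that the
    identity is at hand even if M has no unit. *)
Definition op_pos f : Prop :=
  selfadj f /\ exists2 t, 0 <= t & op_le (fun x => rc t *: x - f x) t.

Lemma star_ext x y : (forall z, z ** x = z ** y) -> x = y.
Proof.
move=> h; apply/eqP; rewrite -subr_eq0; apply/eqP/amul_star_eq0.
by rewrite amulDr amulNr h subrr.
Qed.

Lemma selfadj_comp f g : selfadj f -> selfadj g -> (forall x, f (g x) = g (f x)) ->
  selfadj (f \o g).
Proof.
move=> [fl fs] [gl gs] fg; split; first exact: lin_comp.
by move=> x y; rewrite /= fs gs fg.
Qed.
Lemma selfadj_sqr f : selfadj f -> selfadj (f \o f).
Proof. by move=> h; exact: selfadj_comp. Qed.
Lemma selfadj_comb (r s : R) f g : selfadj f -> selfadj g ->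
  selfadj (fun x => rc r *: f x + rc s *: g x).
Proof.
move=> [fl fs] [gl gs]; split=> [c x y|x y]; first by rewrite fl gl; lmodC.
by rewrite astarD !astarZ !rc_conj amulDl !amulZl amulDr !amulZr fs gs.
Qed.
Lemma eq_selfadj f g : selfadj f -> (forall x, f x = g x) -> selfadj g.
Proof. by move=> h /funext <-. Qed.
Lemma selfadj_id : selfadj (fun x => x). Proof. by split. Qed.

Lemma nrm_selfadj f x : selfadj f -> nrm (f x) ^+ 2 <= nrm x * nrm (f (f x)).
Proof.
by move=> [_ fs]; rewrite -nrm_star_amul fs (le_trans (nrm_amul _ _)) // nrm_astar.
Qed.

Lemma op_pos_bounded f : op_pos f -> exists2 c, 0 <= c & op_le f c.
Proof.
move=> [_ [t t0 h]]; exists (2 * t) => [|x]; first by rewrite mulr_ge0.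
have := nrmD (f x - rc t *: x) (rc t *: x); rewrite subrK nrmBC nrmZr //.
by have := h x; lra.
Qed.

Lemma eq_op_pos f g : op_pos f -> (forall x, f x = g x) -> op_pos g.
Proof. by move=> h /funext <-. Qed.

Lemma op_posD f g : op_pos f -> op_pos g -> op_pos (fun x => f x + g x).
Proof.
move=> [fs [t t0 ft]] [gs [u u0 gu]]; split.
  apply: eq_selfadj (selfadj_comb 1 1 fs gs) _ => x.
  by rewrite rc1 !scale1r.
exists (t + u) => [|x]; first exact: addr_ge0.
have -> : rc (t + u) *: x - (f x + g x) = (rc t *: x - f x) + (rc u *: x - g x).
  by rewrite rcD; lmodC.
by rewrite (le_trans (nrmD _ _)) // mulrDl lerD.
Qed.

Lemma op_posZ r f : 0 <= r -> op_pos f -> op_pos (fun x => rc r *: f x).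
Proof.
move=> r0 [fs [t t0 ft]]; split.
  by apply: eq_selfadj (selfadj_comb r 0 fs fs) _ => x; rewrite scale0r addr0.
exists (r * t) => [|x]; first exact: mulr_ge0.
have -> : rc (r * t) *: x - rc r *: f x = rc r *: (rc t *: x - f x).
  by rewrite rcM; lmodC.
by rewrite nrmZr // -mulrA ler_wpM2l.
Qed.

Lemma selfadj_ub t f : selfadj f -> selfadj (fun x => rc t *: x - f x).
Proof.
move=> fs; apply: eq_selfadj (selfadj_comb t (-1) selfadj_id fs) _ => x.
by rewrite rcN scaleN1r.
Qed.

Lemma op_pos_ub t f : 0 <= t -> selfadj f -> op_le f t ->
  op_pos (fun x => rc t *: x - f x).
Proof.
move=> t0 fs h; split; first exact: selfadj_ub.
by exists t => // x; rewrite opprB addrC subrK.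
Qed.

Lemma selfadj_lim (u : nat -> M -> M) f : linear f -> (forall n, selfadj (u n)) ->
  (forall x, conv (fun n => u n x) (f x)) -> selfadj f.
Proof.
move=> fl us uf; split=> // x y.
apply: (@conv_uniq _ _ (fun n => (u n x)^*' ** y)).
  apply: (bounded_conv (f := amul^~ y)); first exact: amulr_bounded.
  apply: null_le (uf x) _ => n; rewrite -astarN -astarD nrm_astar //.
rewrite (_ : (fun n => _) = fun n => x^*' ** u n y).
  by apply: (bounded_conv (f := amul x^*')) (uf y); exact: amul_bounded.
by apply/funext => n; rewrite (us n).2.
Qed.

(** After rescaling, [y = 1 - f / t] is a contraction, and the solution [g] of [y = 2 g - g^2] gives
    [k = sqrt t (1 - g)]. A bounded operator that commutes with [f] commutes with the iterates,
    hence with [k]. *)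
Lemma op_sqrt f : op_pos f -> exists k, [/\ op_pos k, forall x, k (k x) = f x &
  forall g, bounded_op g -> (forall x, g (f x) = f (g x)) ->
    forall x, g (k x) = k (g x)].
Proof.
move=> [fs [t t0 ft]]; have [tp|tn] := ltP 0 t; last first.
  have f0 x : f x = 0.
    have := ft x; have -> : t = 0 by apply/eqP; rewrite eq_le tn t0.
    by rewrite mul0r scale0r sub0r nrmN => /nrm_le0.
  exists f; split=> [|x|g _ h x]; [|by rewrite !f0|by rewrite h].
  by split => //; exists t.
pose y x := x - rc t^-1 *: f x.
have ys : selfadj y.
  apply: eq_selfadj (selfadj_comb 1 (- t^-1) selfadj_id fs) _ => x.
  by rewrite rcN scaleNr scale1r.
have y1 x : nrm (y x) <= nrm x.
  have -> : y x = rc t^-1 *: (rc t *: x - f x).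
    by rewrite /y scalerBr scalerA -rcM mulVf ?gt_eqF // scale1r.
  by rewrite nrmZr ?invr_ge0 // ler_pdivrMl.
have [g [gl g1 gc _ gy]] := sqrt_iter_lim ys.1 y1.
have comm h : bounded_op h -> (forall x, h (f x) = f (h x)) ->
    forall x, h (g x) = g (h x).
  move=> hb hf x; apply: (@conv_uniq _ _ (fun n => h (sqrt_iter y n x))).
    by apply: (bounded_conv hb).
  rewrite (_ : (fun n => _) = fun n => sqrt_iter y n (h x)) //.
  apply/funext => n; elim: n x => [|n IH] x /=; first by rewrite (lin0 hb.1).
  rewrite (linZ hb.1) (linD hb.1) !IH; congr (_ *: (_ + _)).
  by rewrite /y (linB hb.1) (linZ hb.1) hf.
have gs : selfadj g.
  apply: (selfadj_lim gl _ gc) => n; elim: n => [|n IH] /=.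
    by split=> [c u v|u v]; rewrite ?scaler0 ?addr0 // astar0 amul0l amul0r.
  apply: eq_selfadj (selfadj_comb 2^-1 2^-1 ys (selfadj_sqr IH)) _ => x.
  by rewrite [RHS]scalerDr.
pose s := Num.sqrt t; have s0 : 0 <= s by exact: sqrtr_ge0.
have s2 : s * s = t by rewrite -expr2 sqr_sqrtr.
exists (fun x => rc s *: (x - g x)); split=> [|x|h hb hf x].
- split.
    apply: eq_selfadj (selfadj_comb s (- s) selfadj_id gs) _ => x.
    by rewrite rcN; lmodC.
  exists s => // x.
  have -> : rc s *: x - rc s *: (x - g x) = rc s *: g x by lmodC.
  by rewrite nrmZr // ler_wpM2l.
- rewrite (linZ gl) (linB gl).
  have -> : rc s *: (rc s *: (x - g x) - rc s *: (g x - g (g x))) =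
    rc (s * s) *: (x - (rc 2 *: g x - g (g x))).
    by rewrite rcM rc_nat; lmodC.
  rewrite s2 -gy /y scalerBr scalerBr scalerA -rcM mulfV ?gt_eqF // scale1r.
  by rewrite opprB addrC subrK.
- by rewrite (linZ hb.1) (linB hb.1) comm.
Qed.

(* With [u = g + i k] one has [u^* u = c^2]. *)
Lemma op_le_sqr_sum g k (c : R) : 0 <= c -> selfadj g -> selfadj k ->
  (forall x, g (k x) = k (g x)) ->
  (forall x, g (g x) + k (k x) = rc (c ^+ 2) *: x) -> op_le g c.
Proof.
move=> c0 [gl gs] [kl ks] gk h x.
have nu d : d * d^* = 1 -> d^* = - d -> nrm (g x + d *: k x) = c * nrm x.
  move=> dd dN; apply/eqP.
  rewrite -(@eqrXn2 _ 2) ?mulr_ge0 ?nrm_ge0 //; apply/eqP.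
  rewrite -nrm_star_amul astarD astarZ amulDl !amulDr !amulZl !amulZr.
  rewrite !gs !ks gk !scalerA [d^* * d]mulrC dd scale1r dN.
  have -> : x^*' ** g (g x) + d *: (x^*' ** k (g x)) +
    (- d *: (x^*' ** k (g x)) + x^*' ** k (k x)) = x^*' ** (g (g x) + k (k x)).
    by rewrite amulDr; lmodC.
  by rewrite h amulZr nrmZr ?sqr_ge0 // nrm_star_amul exprMn.
have ii : ('i : C) * 'i^* = 1 by rewrite conjCi mulrN -expr2 sqrCi opprK.
have n1 := nu 'i ii (conjCi _).
have n2 : nrm (g x + (- 'i) *: k x) = c * nrm x.
  by apply: nu; rewrite rmorphN /= ?mulrNN // conjCi.
have := nrmD (g x + 'i *: k x) (g x + (- 'i) *: k x); rewrite n1 n2.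
have -> : g x + 'i *: k x + (g x + - 'i *: k x) = rc 2 *: g x by rewrite rc_nat; lmodC.
by rewrite nrmZr //; lra.
Qed.

(** The root [k] of [d^2 - g^2] satisfies [g^2 + k^2 = d^2], so [k] has norm at most [d], and
    [d^2 - g^2 = k^2] has norm at most [d^2]. *)
Lemma op_pos_sqr g c : 0 <= c -> selfadj g -> op_le g c -> op_pos (g \o g).
Proof.
move=> c0 gs gc; pose d := c + 1; have d0 : 0 < d by rewrite ltr_wpDl.
have cd : c <= d by rewrite lerDl.
have gd x : nrm (g (g x)) <= d ^+ 2 * nrm x.
  rewrite expr2 -mulrA (le_trans (gc _)) // ler_pM ?nrm_ge0 //.
  by rewrite (le_trans (gc _)) // ler_wpM2r ?nrm_ge0.
have g2s : selfadj (fun x => g (g x)) := selfadj_sqr gs.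
have [k [[ks _] kk comm]] := op_sqrt (op_pos_ub (sqr_ge0 d) g2s gd).
have gb : bounded_op g by apply/bounded_opP; split; [exact: gs.1|exists c].
have gk x : g (k x) = k (g x).
  by apply: comm => // z; rewrite (linB gs.1) (linZ gs.1).
split => //; exists (d ^+ 2) => [|x]; first exact: sqr_ge0.
rewrite -[X in nrm X]kk /= expr2 -mulrA.
have kd : op_le k d.
  apply: (@op_le_sqr_sum k g _ (ltW d0) ks gs) => z; first by rewrite gk.
  by rewrite kk subrK.
by rewrite (le_trans (kd _)) // ler_wpM2l ?(ltW d0).
Qed.

(** With commuting roots [k] of [f] and [l] of [t - f], the squares of [f - t / 2] and [k l] add up
    to [(t / 2)^2]; hence [f - t / 2] has norm at most [t / 2]. *)
Lemma op_pos_le f t : 0 <= t -> op_pos f -> op_pos (fun x => rc t *: x - f x) ->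
  op_le f t.
Proof.
move=> t0 fp gp; have [k [kp kk kc]] := op_sqrt fp.
have [l [lp ll lc]] := op_sqrt gp.
have fl := fp.1.1.
have kb : bounded_op k.
  by have [c c0 hc] := op_pos_bounded kp; apply/bounded_opP; split; [exact: kp.1.1|exists c].
have kl x : k (l x) = l (k x).
  apply: lc => // z; rewrite (linB kp.1.1) (linZ kp.1.1); congr (_ - _).
  by rewrite -!kk.
pose y x := f x - rc (t / 2) *: x.
have ys : selfadj y.
  apply: eq_selfadj (selfadj_comb 1 (- (t / 2)) fp.1 selfadj_id) _ => x.
  by rewrite rcN scaleNr scale1r.
have klf x : k (l (f x)) = f (k (l x)) by rewrite -!kk !kl.
have hy : op_le y (t / 2).
  apply: (@op_le_sqr_sum y (k \o l)) => [|||x|x].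
  - by rewrite divr_ge0.
  - exact: ys.
  - exact: selfadj_comp kp.1 lp.1 kl.
  - by rewrite /= /y (linB lp.1.1) (linZ lp.1.1) (linB kp.1.1) (linZ kp.1.1) klf.
  rewrite /= -kl kk ll /y (linB fl) (linB fl) !(linZ fl).
  have -> : (t / 2) ^+ 2 = (t / 2) * (t / 2) by [].
  have -> : rc t = rc (t / 2) + rc (t / 2) by rewrite -rcD; congr rc; field.
  by rewrite rcM; lmodC.
move=> x; have := hy x; have := nrmD (y x) (rc (t / 2) *: x).
by rewrite subrK nrmZr ?divr_ge0 //; lra.
Qed.

(** The roots of [f] and [- f] commute and their squares add up to 0, so [op_le_sqr_sum] applies
    with the constant 0. *)
Lemma op_pos_antisym f : op_pos f -> op_pos (fun x => - f x) -> forall x, f x = 0.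
Proof.
move=> fp gp; have [k [kp kk kc]] := op_sqrt fp.
have [l [lp ll lc]] := op_sqrt gp.
have kb : bounded_op k.
  by have [c c0 hc] := op_pos_bounded kp; apply/bounded_opP; split; [exact: kp.1.1|exists c].
have kl x : k (l x) = l (k x).
  by apply: lc => // z; rewrite (linN kp.1.1) -!kk.
have k0 : op_le k 0.
  apply: (op_le_sqr_sum (lexx 0) kp.1 lp.1 kl) => x.
  by rewrite kk ll addrN expr0n scale0r.
by move=> x; rewrite -kk; apply: nrm_le0; rewrite (le_trans (k0 _)) // mul0r.
Qed.

Lemma star_adj_sym (d e : M -> M) : (forall x y, (d x)^*' ** y = x^*' ** e y) ->
  forall x y, (e x)^*' ** y = x^*' ** d y.
Proof.
by move=> de x y; apply: (can_inj (@astarK _ M)); rewrite !astarM !astarK de.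
Qed.

Lemma iter_linear n f : linear f -> linear (iter n f).
Proof. by move=> fl; elim: n => //= n IH c x y; rewrite /= IH fl. Qed.

(* Positivity passes from [d e] to [e d], for [e] the adjoint of [d], because
   these have the same spectral radius up to 0: the norms of the iterates of
   [t + d e], divided by the powers of [t], form a log-convex sequence that
   grows at most linearly. *)
Lemma op_pos_flip (d e : M -> M) : bounded_op d -> bounded_op e ->
  (forall x y, (d x)^*' ** y = x^*' ** e y) ->
  op_pos (fun x => - e (d x)) -> op_pos (fun x => - d (e x)).
Proof.
move=> db eb de [_ [t0 t00 h0]]; pose t := t0 + 1.
have tp : 0 < t by rewrite ltr_wpDl.
have h : op_le (fun x => rc t *: x + e (d x)) t.
  move=> x; have -> : rc t *: x + e (d x) = x + (rc t0 *: x - - e (d x)).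
    by rewrite /t rcD rc1; lmodC.
  by rewrite (le_trans (nrmD _ _)) // /t mulrDl mul1r [leRHS]addrC lerD2l.
have ed := star_adj_sym de.
have gs : selfadj (fun x => d (e x)).
  split=> [c x y|x y]; first by rewrite eb.1 db.1.
  by rewrite de ed.
split.
  by apply: eq_selfadj (selfadj_comb (-1) 0 gs gs) _ => x; rewrite scale0r addr0 rcN scaleN1r.
exists t => [|x]; first exact: ltW.
rewrite opprK; pose g x := rc t *: x + d (e x).
have gls : selfadj g.
  apply: eq_selfadj (selfadj_comb t 1 selfadj_id gs) _ => z.
  by rewrite rc1 scale1r.
(* [d] intertwines the iterates of [t + e d] and [t + d e]. Each step of the second iteration thus
   adds only a term controlled by the first, and the growth beyond [t ^+ n] is linear. *)
have gd n z : iter n g (d z) = d (iter n (fun x => rc t *: x + e (d x)) z).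
  elim: n => //= n ->; by rewrite /g (linD db.1) (linZ db.1).
have hn n z : nrm (iter n (fun x => rc t *: x + e (d x)) z) <= t ^+ n * nrm z.
  elim: n => [|n IH] /=; first by rewrite expr0 mul1r.
  by rewrite (le_trans (h _)) // exprS -mulrA ler_wpM2l ?(ltW tp).
have [dl [c c0 hc]] := (bounded_opP _).1 db.
pose K := nrm x + c * nrm (e x) / t.
have step n : nrm (iter n g x) <= t ^+ n * (nrm x + n%:R * (c * nrm (e x) / t)).
  elim: n => [|n IH]; first by rewrite /= expr0 mul0r addr0 mul1r.
  have -> : iter n.+1 g x = rc t *: iter n g x + iter n g (d (e x)).
    by rewrite iterSr {1}/g; have il : linear (iter n g) := iter_linear n gls.1; rewrite il.
  rewrite (le_trans (nrmD _ _)) // nrmZr ?(ltW tp) // gd.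
  have h1 : nrm (d (iter n (fun x => rc t *: x + e (d x)) (e x))) <= t ^+ n * (c * nrm (e x)).
    by rewrite (le_trans (hc _)) // mulrCA ler_wpM2l.
  have h2 := ler_wpM2l (ltW tp) IH.
  rewrite exprS -natr1.
  have -> : t * t ^+ n * (nrm x + (n%:R + 1) * (c * nrm (e x) / t)) =
    t * (t ^+ n * (nrm x + n%:R * (c * nrm (e x) / t))) + t ^+ n * (c * nrm (e x)).
    by field; rewrite gt_eqF.
  exact: lerD.
pose E n := nrm (iter n g x) / t ^+ n.
have tn n : 0 < t ^+ n by rewrite exprn_gt0.
have := @log_convex_le R E K; rewrite /E /= expr0 expr1 divr1.
have -> : nrm (g x) / t <= nrm x = (nrm (g x) <= t * nrm x).
  by rewrite ler_pdivrMr // mulrC.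
apply=> [n|n|n].
- by rewrite divr_ge0 ?nrm_ge0 // (ltW (tn n)).
- rewrite -[iter n g x]/(iter n g x) expr_div_n.
  have := nrm_selfadj (iter n g x) gls; rewrite /= => hs.
  have -> : t ^+ n.+1 ^+ 2 = t ^+ n * t ^+ n.+2.
    by rewrite -exprM -exprD; congr (_ ^+ _); lia.
  by rewrite mulf_div ler_pM2r // invr_gt0 mulr_gt0.
- rewrite ler_pdivrMr // mulrC (le_trans (step n)) // ler_wpM2l ?(ltW (tn n)) // /K mulrDl.
  set b := c * _ / t; have b0 : 0 <= b by rewrite !mulr_ge0 ?nrm_ge0 // invr_ge0 (ltW tp).
  rewrite -natr1 !mulrDr !mulr1 [b * _]mulrC.
  have : 0 <= nrm x * n%:R by rewrite mulr_ge0 ?nrm_ge0.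
  by lra.
Qed.

(** The sum is half of [u^2 + v^2] for the self-adjoint operators [u = d + e] and
    [v = i (d - e)]. *)
Lemma op_pos_add_adj (d e : M -> M) : bounded_op d -> bounded_op e ->
  (forall x y, (d x)^*' ** y = x^*' ** e y) -> op_pos (fun x => e (d x) + d (e x)).
Proof.
move=> db eb de; have ed := star_adj_sym de.
pose u x := d x + e x; pose v x := 'i *: (d x - e x).
have us : selfadj u.
  split=> [z x y|x y]; first by rewrite /u db.1 eb.1; lmodC.
  by rewrite /u astarD amulDl amulDr de ed addrC.
have vs : selfadj v.
  split=> [z x y|x y]; first by rewrite /v db.1 eb.1; lmodC.
  rewrite /v astarZ astarD astarN amulZl amulDl amulNl de ed amulZr amulDr amulNr.
  by rewrite conjCi scaleNr -scalerN opprB.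
have ub : bounded_op u.
  have := bounded_lin 1 db eb; congr bounded_op; apply/funext => x.
  by rewrite scale1r.
have vb : bounded_op v.
  have := bounded_lin 'i db (bounded_lin (- 'i) eb (bounded_0 _ _)).
  by congr bounded_op; apply/funext => x; rewrite /v; lmodC.
have [_ [j j0 hj]] := (bounded_opP _).1 ub.
have [_ [i i0 hi]] := (bounded_opP _).1 vb.
have h2 : 0 <= 2^-1 :> R by rewrite invr_ge0.
apply: eq_op_pos (op_posZ h2 (op_posD (op_pos_sqr j0 us hj) (op_pos_sqr i0 vs hi))) _.
move=> x; rewrite /= /v (linZ db.1) (linZ eb.1) -scalerBr scalerA -expr2 sqrCi.
rewrite /u !(linD db.1) !(linD eb.1) (linN db.1) (linN eb.1) rcV rc_nat; lmodC.
Qed.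

(* Kaplansky's argument: with [a] the multiplication by [b^* b], [A = |a|] and
   [c = A - a], the operator [d = b c] satisfies [d^* d = - c A c], which is only
   possible if [c = 0]. *)
Lemma op_pos_star_mul b : op_pos (amul (b^*' ** b)).
Proof.
pose a := amul (b^*' ** b).
have al : linear a by exact: amul_linr.
have ab : bounded_op a by exact: amul_bounded.
have as_ : selfadj a.
  by split=> // x y; rewrite /a !astarM astarK !amulA.
have ac : op_le a (nrm (b^*' ** b)) by move=> x; exact: nrm_amul.
have [A [Ap AA Ac]] := op_sqrt (op_pos_sqr (nrm_ge0 _) as_ ac).
have Al := Ap.1.1.
have Ab : bounded_op A.
  by have [c c0 hc] := op_pos_bounded Ap; apply/bounded_opP; split=> //; exists c.
have aA x : a (A x) = A (a x) by exact: Ac.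
have [r [rp rr rcm]] := op_sqrt Ap.
have rl := rp.1.1.
pose c x := A x - a x.
have cs : selfadj c.
  apply: eq_selfadj (selfadj_comb 1 (-1) Ap.1 as_) _ => x.
  by rewrite rc1 rcN scale1r scaleN1r.
have cl := cs.1.
have cb : bounded_op c.
  have := bounded_lin (-1) ab Ab; congr bounded_op; apply/funext => x.
  by rewrite scaleN1r addrC.
have rb : bounded_op r.
  by have [k k0 hk] := op_pos_bounded rp; apply/bounded_opP; split=> //; exists k.
have AAaa x : A (A x) = a (a x) by exact: AA.
have cA x : c (A x) = A (c x) by rewrite /c (linB Al) aA.
have cr x : c (r x) = r (c x) by exact: rcm.
(* A consequence of [A^2 = a^2]: on the range of [c], which is twice the negative part of [a], the
   operator [a] acts as [- A]. *)
have aNA x : a (c x) = - A (c x).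
  by rewrite /c (linB al) (linB Al) aA -AAaa opprB.
have cc x : c (c x) = rc 2 *: A (c x) by rewrite {1}/c aNA rc_nat; lmodC.
have cac x : c (a (c x)) = - A (c (c x)) by rewrite aNA (linN cl) cA.
pose d x := b ** c x; pose e x := c (b^*' ** x).
have db : bounded_op d := bounded_comp (amul_bounded b) cb.
have eb : bounded_op e := bounded_comp cb (amul_bounded _).
have de x y : (d x)^*' ** y = x^*' ** e y.
  by rewrite /d /e astarM -amulA cs.2.
have ed x : e (d x) = - A (c (c x)) by rewrite /e /d amulA cac.
have rcs : selfadj (r \o c) by apply: selfadj_comp rp.1 cs _ => x; rewrite cr.
have [k k0 hk] := ((bounded_opP _).1 (bounded_comp rb cb)).2.
have p1 : op_pos (fun x => - e (d x)).
  apply: eq_op_pos (op_pos_sqr k0 rcs hk) _ => x.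
  by rewrite ed opprK /= cr rr.
(* The flip gives [d e <= 0], while [e d + d e >= 0] always holds; so [e d >= 0]. As [e d <= 0] by
   [p1], it vanishes, that is, [A c^2 = 0]. *)
have p2 := op_pos_flip db eb de p1.
have p3 := op_pos_add_adj db eb de.
have p4 : op_pos (fun x => e (d x)).
  by apply: eq_op_pos (op_posD p3 p2) _ => x; rewrite addrK.
have ed0 := op_pos_antisym p4 p1.
have Acc x : A (c (c x)) = 0 by have := ed0 x; rewrite ed => /eqP; rewrite oppr_eq0 => /eqP.
have Ac0 x : A (c x) = 0.
  apply: amul_star_eq0; rewrite Ap.1.2.
  have := Acc x; rewrite cc (linZ Al) => /eqP; rewrite scaler_eq0 => /orP[|/eqP ->].
    by rewrite rc_nat pnatr_eq0.
  by rewrite amul0r.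
have c0 x : c x = 0.
  by apply: amul_star_eq0; rewrite cs.2 cc Ac0 scaler0 amul0r.
by apply: eq_op_pos Ap _ => x; apply/eqP; rewrite -subr_eq0; apply/eqP; exact: c0.
Qed.

Definition mpos a : Prop := op_pos (amul a).

Lemma mpos_star_mul b : mpos (b^*' ** b). Proof. exact: op_pos_star_mul. Qed.
Lemma mposD a b : mpos a -> mpos b -> mpos (a + b).
Proof. by move=> pa pb; apply: eq_op_pos (op_posD pa pb) _ => x; rewrite amulDl. Qed.
Lemma mposZ r a : 0 <= r -> mpos a -> mpos (rc r *: a).
Proof. by move=> r0 pa; apply: eq_op_pos (op_posZ r0 pa) _ => x; rewrite amulZl. Qed.
Lemma mpos0 : mpos 0.
Proof. by rewrite -(amul0r (0^*')); exact: mpos_star_mul. Qed.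
Lemma mpos_sum (I : Type) (r : seq I) (P : pred I) (F : I -> M) :
  (forall i, P i -> mpos (F i)) -> mpos (\sum_(i <- r | P i) F i).
Proof. by move=> h; elim/big_ind: _; [exact: mpos0|exact: mposD|]. Qed.
Lemma mpos_apos a : apos a -> mpos a.
Proof. by move=> [b ->]; exact: mpos_star_mul. Qed.

(** [|a + b| - a] is positive, as the sum of [|a + b| - (a + b)] and [b]; then [op_pos_le]
    applies. *)
Lemma mpos_nrm_le a b : mpos a -> mpos b -> nrm a <= nrm (a + b).
Proof.
move=> pa pb; apply: nrm_le_amul; first exact: nrm_ge0.
have pab := mposD pa pb; apply: op_pos_le => //; first exact: nrm_ge0.
have ub := op_pos_ub (nrm_ge0 (a + b)) pab.1 (fun x => nrm_amul (a + b) x).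
by apply: eq_op_pos (op_posD ub pb) _ => x; rewrite amulDl; lmodC.
Qed.

(** The root [k] of multiplication by [a] is an operator on M, so [k b] is an element of M, and the
    conjugate equals [(k b)^* (k b)]. *)
Lemma mpos_conj a b : mpos a -> mpos (b^*' ** a ** b).
Proof.
move=> pa; have [k [kp kk _]] := op_sqrt pa.
have -> : b^*' ** a ** b = (k b)^*' ** k b by rewrite kp.1.2 kk amulA.
exact: mpos_star_mul.
Qed.

(* [b^* b <= |b|^2], realized by a square root [1 - g] of [1 - b^* b]. *)
Lemma star_mul_sqrt a : a^*' = a -> nrm a <= 1 ->
  exists2 g, g^*' = g & a = rc 2 *: g - g ** g.
Proof.
move=> sa a1; have la := amul_linr a.
have a1' x : nrm (a ** x) <= nrm x.
  by rewrite (le_trans (nrm_amul _ _)) // ler_piMl ?nrm_ge0.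
(* The iteration runs inside M, since [2 g - g^2 = a] can be stated without a unit; completeness of
   M makes the limit an element. *)
pose E := fix E n := if n is m.+1 then rc 2^-1 *: (a + E m ** E m) else 0 : M.
have EE n x : sqrt_iter (amul a) n x = E n ** x.
  elim: n x => [|n IH] x /=; first by rewrite amul0l.
  by rewrite !IH amulZl amulDl amulA.
have Es n : (E n)^*' = E n.
  elim: n => [|n IH] /=; first exact: astar0.
  by rewrite astarZ rc_conj astarD astarM !IH sa.
have Ec (n k : nat) : nrm (E (n + k)%N - E n) <= 1 - sqrt_bound R n.
  have /andP[b0 b1] := @sqrt_bound_itv R n.
  apply: nrm_le_amul => [|x]; first by rewrite subr_ge0.
  rewrite amulDl amulNl -!EE (le_trans (sqrt_iter_diff la a1' _ _ _)) //.
  rewrite ler_wpM2r ?nrm_ge0 // lerD2r.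
  by have /andP[] := @sqrt_bound_itv R (n + k).
have [g gE _] := cauchy_conv (@sqrt_bound_null R) Ec.
exists g.
  apply: (conv_uniq _ gE); apply: null_le gE _ => n.
  by rewrite -{1}[E n]Es -astarN -astarD nrm_astar.
have [G [_ _ Gc _ GG]] := sqrt_iter_lim la a1'.
have Gg x : G x = g ** x.
  apply: conv_uniq (Gc x) _; rewrite (_ : (fun n => _) = fun n => E n ** x).
    exact: (bounded_conv (f := amul^~ x)) (amulr_bounded x) gE.
  by apply/funext => n; rewrite EE.
apply: (can_inj (@astarK _ M)); apply: star_ext => x.
have := GG x^*'; rewrite !Gg => h.
apply: (can_inj (@astarK _ M)); rewrite !astarM !astarK h.
by rewrite amulDl amulZl amulNl amulA.
Qed.
End CstarOperators.

(** * Hilbert modules *)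

Notation "a ** b" := (amul a b) (at level 40, left associativity).

Section HilbertModules.
Variable R : realType.
Local Notation C := (cplx R).
Variable M : cstarType R.

Definition mle (a b : M) : Prop := mpos (b - a).

Lemma mle_trans b a c : mle a b -> mle b c -> mle a c.
Proof.
move=> h1 h2; rewrite /mle (_ : c - a = (b - a) + (c - b)); first exact: mposD.
by lmodC.
Qed.
Lemma mle_refl a : mle a a. Proof. by rewrite /mle subrr; exact: mpos0. Qed.
Lemma mle_sum (I : Type) (r : seq I) (P : pred I) (F G : I -> M) :
  (forall i, P i -> mle (F i) (G i)) ->
  mle (\sum_(i <- r | P i) F i) (\sum_(i <- r | P i) G i).
Proof. by move=> h; rewrite /mle -sumrB; exact: mpos_sum. Qed.
Lemma mleZ r a b : 0 <= r -> mle a b -> mle (rc r *: a) (rc r *: b).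
Proof. by move=> r0 h; rewrite /mle -scalerBr; exact: mposZ. Qed.
Lemma mle_nrm a b : mpos a -> mle a b -> nrm a <= nrm b.
Proof. by move=> pa /(mpos_nrm_le pa); rewrite addrC subrK. Qed.

Lemma mle_conj (a b : M) : mpos a ->
  mle (astar b ** a ** b) (rc (nrm a) *: (astar b ** b)).
Proof.
move=> pa; have [k [kp kk _]] := op_sqrt
  (op_pos_ub (nrm_ge0 a) pa.1 (fun x => nrm_amul a x)).
rewrite /mle (_ : _ - _ = astar (k b) ** k b); first exact: mpos_star_mul.
by rewrite kp.1.2 kk amulDr amulNr amulZr amulA.
Qed.

Section Module.
Variable F : hmodType M.
Implicit Types x y z : F.

Lemma minner_linear x : linear (minner x : F -> M).
Proof. by move=> a u v; rewrite minnerDr minnerZr. Qed.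
Lemma minnerDl x y z : minner (x + y) z = minner x z + minner y z :> M.
Proof. by rewrite -minnerC minnerDr astarD !minnerC. Qed.
Lemma minnerZl c x y : minner (c *: x) y = c^* *: minner x y :> M.
Proof. by rewrite -minnerC minnerZr astarZ minnerC. Qed.
Lemma minnerMl x y a : minner (ract x a) y = astar a ** minner x y :> M.
Proof. by rewrite -minnerC minnerMr astarM minnerC. Qed.
Lemma minner0r x : minner x 0 = 0 :> M. Proof. exact: lin0 (minner_linear x). Qed.
Lemma minner0l x : minner 0 x = 0 :> M. Proof. by rewrite -minnerC minner0r astar0. Qed.
Lemma minnerNr x y : minner x (- y) = - minner x y :> M.
Proof. exact: linN (minner_linear x) y. Qed.
Lemma minnerNl x y : minner (- x) y = - minner x y :> M.
Proof. by rewrite -minnerC minnerNr astarN minnerC. Qed.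
Lemma minnerBr x y z : minner x (y - z) = minner x y - minner x z :> M.
Proof. by rewrite minnerDr minnerNr. Qed.
Lemma minnerBl x y z : minner (x - y) z = minner x z - minner y z :> M.
Proof. by rewrite minnerDl minnerNl. Qed.
Lemma minner_sumr (I : Type) (r : seq I) (P : pred I) (f : I -> F) x :
  minner x (\sum_(i <- r | P i) f i) = \sum_(i <- r | P i) minner x (f i) :> M.
Proof. exact: (lin_sum (minner_linear x)). Qed.
Lemma minner_suml (I : Type) (r : seq I) (P : pred I) (f : I -> F) x :
  minner (\sum_(i <- r | P i) f i) x = \sum_(i <- r | P i) minner (f i) x :> M.
Proof.
by apply: (big_morph (fun u => minner u x : M)) => [u v|]; rewrite ?minnerDl ?minner0l.
Qed.
Lemma ract_linl a : linear (fun x => ract x a).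
Proof. by move=> c u v; rewrite ractDl ractZl. Qed.
Lemma ract_linr x : linear (ract x : M -> F).
Proof. by move=> c u v; rewrite ractDr ractZr. Qed.
Lemma nrm_minner x : nrm (minner x x : M) = nrm x ^+ 2.
Proof. by apply: rc_inj; rewrite -nrmE minner_norm rcX nrmE. Qed.
Lemma minner_mpos x : mpos (minner x x : M).
Proof. exact/mpos_apos/minner_ge0. Qed.
Lemma minner_eq0 x : minner x x = 0 :> M -> x = 0.
Proof.
move=> h; apply: nrm_eq0; apply/eqP; rewrite -[_ == 0]sqrf_eq0 -nrm_minner h.
by rewrite nrm0.
Qed.
Lemma minner_ext x y : (forall z, minner z x = minner z y :> M) -> x = y.
Proof.
move=> h; apply/eqP; rewrite -subr_eq0; apply/eqP/minner_eq0.
by rewrite minnerBr h subrr.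
Qed.
Lemma nrm_le_minner x y : mle (minner x x) (minner y y) -> nrm x <= nrm y.
Proof.
move=> /(mle_nrm (minner_mpos x)); rewrite !nrm_minner; apply: le_sqr.
exact: nrm_ge0.
Qed.

(** Positivity of [<z, z>] for [z = y - x t a], where [a = <x, y>] and [t = |x|^-2], combined with
    [a^* <x, x> a <= |x|^2 a^* a], gives [t a^* a <= <y, y>]. *)
Lemma minner_CS x y : nrm (minner x y : M) <= nrm x * nrm y.
Proof.
have [x0|/nrm_le0 ->] := ltP 0 (nrm x); last by rewrite minner0l !nrm0 mul0r.
set a : M := minner x y; pose t := (nrm x ^+ 2)^-1.
have t0 : 0 < t by rewrite invr_gt0 exprn_gt0.
pose z := y - ract x (rc t *: a).
have : mle (rc t *: (astar a ** a)) (minner y y).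
  rewrite /mle; have -> : minner y y - rc t *: (astar a ** a) = minner z z +
    rc (t ^+ 2) *: (rc (nrm (minner x x : M)) *: (astar a ** a) - astar a ** minner x x ** a).
    rewrite /z minnerBl !minnerBr minnerMr !minnerMl minnerMr -/a.
    rewrite -[minner y x]minnerC -/a !(astarZ, rc_conj, amulZl, amulZr).
    rewrite nrm_minner amulA scalerBr !scalerA -[rc (t ^+ 2) * _]rcM.
    have -> : t ^+ 2 * nrm x ^+ 2 = t.
      by rewrite /t expr2 -mulrA mulVf ?mulr1 // expf_neq0 // gt_eqF.
    by rewrite rcX; lmodC.
  apply: mposD; first exact: minner_mpos.
  by apply: mposZ; [exact: sqr_ge0|exact: mle_conj (minner_mpos x)].
move=> /(mle_nrm (mposZ (ltW t0) (mpos_star_mul a))).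
rewrite nrmZr ?(ltW t0) // nrm_star_amul nrm_minner /t ler_pdivrMl ?exprn_gt0 // => h.
by apply: le_sqr; rewrite ?mulr_ge0 ?nrm_ge0 // exprMn.
Qed.

Lemma minner_bounded x : bounded_op (minner x : F -> M).
Proof.
apply/bounded_opP; split; first exact: minner_linear.
by exists (nrm x) => [|y]; [exact: nrm_ge0|exact: minner_CS].
Qed.
Lemma nrm_ract x a : nrm (ract x a) <= nrm x * nrm a.
Proof.
apply: le_sqr; first by rewrite mulr_ge0 ?nrm_ge0.
rewrite -nrm_minner minnerMl minnerMr amulA.
have := mle_nrm (mpos_conj a (minner_mpos x)) (mle_conj a (minner_mpos x)).
by rewrite nrmZr ?nrm_ge0 // nrm_star_amul nrm_minner exprMn.
Qed.

(* Half of the sum of all [<y_i - y_j, y_i - y_j>] is the difference. *)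
Lemma mle_minner_sum (I : finType) (y : I -> F) :
  mle (minner (\sum_i y i) (\sum_i y i))
      (rc #|I|%:R *: \sum_i minner (y i) (y i)).
Proof.
rewrite /mle; have -> : rc #|I|%:R *: \sum_i minner (y i) (y i) -
    minner (\sum_i y i) (\sum_i y i) =
    rc 2^-1 *: \sum_i \sum_j minner (y i - y j) (y i - y j) :> M.
  set s : M := \sum_i minner (y i) (y i).
  have e1 : \sum_i \sum_(j in I) minner (y i) (y i) = rc #|I|%:R *: s :> M.
    under eq_bigr => i _ do rewrite sumr_const -scaler_nat.
    by rewrite -scaler_sumr rc_nat.
  have e2 : \sum_(i in I) \sum_j minner (y j) (y j) = rc #|I|%:R *: s :> M.
    by rewrite sumr_const -scaler_nat rc_nat.
  have e3 : \sum_i \sum_j minner (y i) (y j) = minner (\sum_i y i) (\sum_i y i) :> M.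
    by rewrite minner_suml; apply: eq_bigr => i _; rewrite minner_sumr.
  have e4 : \sum_i \sum_j minner (y j) (y i) = minner (\sum_i y i) (\sum_i y i) :> M.
    by rewrite exchange_big.
  have -> : \sum_i \sum_j minner (y i - y j) (y i - y j) =
     (rc #|I|%:R *: s + rc #|I|%:R *: s) -
     (minner (\sum_i y i) (\sum_i y i) + minner (\sum_i y i) (\sum_i y i)) :> M.
    rewrite -{1}e1 -e2 -{1}e3 -e4 -!big_split -sumrB; apply: eq_bigr => i _.
    rewrite -!big_split -sumrB; apply: eq_bigr => j _ /=.
    by rewrite minnerBl !minnerBr; lmodC.
  by rewrite rcV rc_nat; lmodC.
apply: mposZ; first by rewrite invr_ge0.
by apply: mpos_sum => i _; apply: mpos_sum => j _; exact: minner_mpos.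
Qed.

Section Frame.
Variables (I : finType) (zeta : I -> F).

(* The M-linear combinations of the [zeta i] and, for the row [L] of the
   [zeta i], the operators [L L^*] and [1 - L L^*]. *)
Definition frame_sum (w : I -> M) : F := \sum_i ract (zeta i) (w i).
Definition frame_op (y : F) : F := frame_sum (fun i => minner (zeta i) y).
Definition coframe (y : F) : F := y - frame_op y.
Definition normalized : Prop :=
  forall w, mle (minner (frame_sum w) (frame_sum w)) (\sum_i astar (w i) ** w i).

Lemma minner_frame w y :
  minner (frame_sum w) y = \sum_i astar (w i) ** minner (zeta i) y :> M.
Proof. by rewrite minner_suml; apply: eq_bigr => i _; rewrite minnerMl. Qed.

Lemma coframe_adj x y : minner (coframe x) y = minner x (coframe y) :> M.
Proof.
rewrite /coframe minnerBl minnerBr; congr (_ - _).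
rewrite minner_frame -[RHS]minnerC minner_frame (big_morph (@astar R M) (@astarD R M) (@astar0 R M)).
by apply: eq_bigr => i _; rewrite astarM astarK minnerC.
Qed.

Lemma coframe_linear : linear coframe.
Proof.
move=> c x y; rewrite /coframe /frame_op /frame_sum.
have -> : \sum_i ract (zeta i) (minner (zeta i) (c *: x + y)) =
  c *: \sum_i ract (zeta i) (minner (zeta i) x) + \sum_i ract (zeta i) (minner (zeta i) y).
  rewrite scaler_sumr -big_split; apply: eq_bigr => i _ /=.
  by rewrite minner_linear ract_linr.
by lmodC.
Qed.

Hypothesis hz : normalized.

(** With [P = L L^*] and [s = 1 - P] one has [1 - s^2 = 2 P - P^2], and [P^2 <= P] by [normalized];
    so [P <= 1 - s^2]. This form telescopes along the iterates of [s]. *)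
Lemma coframe_mle y : mle (\sum_i astar (minner (zeta i) y) ** minner (zeta i) y)
  (minner y y - minner (coframe y) (coframe y)).
Proof.
pose w := fun i => minner (zeta i) y : M; have h := hz w; move: h; rewrite /mle.
rewrite /coframe /frame_op -/w minnerBl !minnerBr.
have e1 : minner (frame_sum w) y = \sum_i astar (w i) ** w i :> M by rewrite minner_frame.
have e2 : minner y (frame_sum w) = \sum_i astar (w i) ** w i :> M.
  rewrite -minnerC e1 (big_morph (@astar R M) (@astarD R M) (@astar0 R M)).
  by apply: eq_bigr => i _; rewrite astarM astarK.
have e0 : \sum_i astar (minner (zeta i) y) ** minner (zeta i) y = \sum_i astar (w i) ** w i :> M by [].
by rewrite e1 e2 e0; congr mpos; lmodC.
Qed.

Lemma coframe_dec y : mle (minner (coframe y) (coframe y)) (minner y y).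
Proof.
have := coframe_mle y; rewrite /mle => h.
have -> : minner y y - minner (coframe y) (coframe y) =
  \sum_i astar (minner (zeta i) y) ** minner (zeta i) y + (minner y y -
  minner (coframe y) (coframe y) - \sum_i astar (minner (zeta i) y) ** minner (zeta i) y) :> M.
  by lmodC.
by apply: mposD h; apply: mpos_sum => i _; exact: mpos_star_mul.
Qed.

Lemma iter_coframe_adj n x y :
  minner (iter n coframe x) y = minner x (iter n coframe y) :> M.
Proof. by elim: n x => // n IH x; rewrite iterSr IH coframe_adj -iterS. Qed.

Lemma nrm_iter_coframe n y : nrm (iter n coframe y) <= nrm y.
Proof.
by elim: n => // n IH; apply: le_trans IH; apply: nrm_le_minner; exact: coframe_dec.
Qed.

(* The rows [z] and [w] of the [s^i zeta_j] for [i < m], with [s = 1 - L L^*],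
   satisfy [z z^* = sum_i L L^* s^(2i) <= 1], hence [z^* z <= 1]. *)
Lemma coframe_row m (w : 'I_m * I -> M) :
  nrm (\sum_(p : 'I_m * I) ract (iter p.1 coframe (zeta p.2)) (w p)) ^+ 2 <=
  nrm (\sum_p astar (w p) ** w p).
Proof.
set y := \sum_(p : 'I_m * I) _; rewrite -nrm_minner.
pose v (p : 'I_m * I) : M := minner (iter p.1 coframe (zeta p.2)) y.
have yv : minner y y = \sum_p astar (w p) ** v p :> M.
  by rewrite {1}/y minner_suml; apply: eq_bigr => p _; rewrite minnerMl.
have vy : minner y y = \sum_p astar (v p) ** w p :> M.
  rewrite -minnerC yv (big_morph (@astar R M) (@astarD R M) (@astar0 R M)).
  by apply: eq_bigr => i _; rewrite astarM astarK.
apply: mle_nrm; first exact: minner_mpos.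
have hv : mle (\sum_p astar (v p) ** v p) (minner y y).
  pose D n : M := minner (iter n coframe y) (iter n coframe y).
  have : mle (\sum_(i < m) \sum_j astar (v (i, j)) ** v (i, j)) (\sum_(i < m) (D i - D i.+1)).
    apply: mle_sum => i _; apply: mle_trans (coframe_mle (iter i coframe y)).
    rewrite (_ : \sum_j _ = \sum_j astar (minner (zeta j) (iter i coframe y)) **
      minner (zeta j) (iter i coframe y)); first exact: mle_refl.
    by apply: eq_bigr => j _; rewrite /v /= iter_coframe_adj.
  rewrite pair_bigA /=.
  have -> : \sum_(p : 'I_m * I) astar (v (p.1, p.2)) ** v (p.1, p.2) = \sum_p astar (v p) ** v p.
    by apply: eq_bigr => -[].
  move=> h; have {h} : mle (\sum_p astar (v p) ** v p) (D 0%N - D m).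
    apply: mle_trans h _; rewrite -(big_mkord xpredT (fun i => D i - D i.+1)) sumrB.
    rewrite -opprB -sumrB telescope_sumr // opprB; exact: mle_refl.
  move=> h; apply: mle_trans h _; rewrite /mle opprB addrC subrK; exact: minner_mpos.
have hs : mpos (\sum_p astar (w p - v p) ** (w p - v p)).
  by apply: mpos_sum => p _; exact: mpos_star_mul.
have := mposD hs hv; rewrite /mle; congr mpos.
have -> : \sum_p astar (w p - v p) ** (w p - v p) = \sum_p astar (w p) ** w p -
    minner y y - minner y y + \sum_p astar (v p) ** v p :> M.
  rewrite {1}yv vy -!sumrB -big_split; apply: eq_bigr => p _ /=.
  by rewrite astarD astarN amulDl !amulDr amulNl !amulNr amulNl opprK; lmodC.
by lmodC.
Qed.
End Frame.

Lemma normalize (I : finType) (zeta : I -> F) :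
  exists2 r, 0 < r & normalized (fun i => rc r *: zeta i).
Proof.
(* [K] bounds every [|zeta i|^2], and [N] bounds the factor from [mle_minner_sum]; the summands 1
   keep both positive for empty or zero families. *)
pose K := \sum_i nrm (zeta i) ^+ 2 + 1.
have K0 : 0 < K by rewrite ltr_wpDl // sumr_ge0 // => i _; exact: sqr_ge0.
pose N : R := #|I|%:R + 1; have N0 : 0 < N by rewrite ltr_wpDl.
pose r := Num.sqrt (K * N)^-1; have r0 : 0 < r by rewrite sqrtr_gt0 invr_gt0 mulr_gt0.
have r2 : r ^+ 2 = (K * N)^-1 by rewrite sqr_sqrtr // invr_ge0 mulr_ge0 // ltW.
exists r => // w.
apply: mle_trans (mle_minner_sum _) _; rewrite scaler_sumr; apply: mle_sum => i _.
rewrite ractZl minnerZl minnerZr rc_conj !scalerA -!rcM minnerMl minnerMr amulA.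
have c0 : 0 <= #|I|%:R * r * r :> R by rewrite !mulr_ge0 // ltW.
apply: mle_trans (mleZ c0 (mle_conj (w i) (minner_mpos _))) _.
rewrite scalerA -rcM nrm_minner.
set c := #|I|%:R * r * r * _; rewrite /mle.
have -> : astar (w i) ** w i - rc c *: (astar (w i) ** w i) =
   rc (1 - c) *: (astar (w i) ** w i) by rewrite rcB rc1; lmodC.
apply: mposZ; last exact: mpos_star_mul.
have -> : c = r ^+ 2 * (#|I|%:R * nrm (zeta i) ^+ 2) by rewrite /c; ring.
rewrite subr_ge0 r2 ler_pdivrMl ?mulr_gt0 // mulr1 mulrC ler_pM //.
- exact: sqr_ge0.
- by rewrite /K (bigD1 i) //= -addrA lerDl addr_ge0 // sumr_ge0 // => j _; exact: sqr_ge0.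
- by rewrite /N lerDl.
Qed.
End Module.
End HilbertModules.

(** * Representations and tensor products with Hilbert spaces *)

Section Actions.
Variable R : realType.
Local Notation C := (cplx R).
Variable M : cstarType R.

Section LeftAction.
Variable F : corrType M.

Lemma lact_linear (a : M) : linear (lact a : F -> F).
Proof.
move=> c x y; apply: minner_ext => z; rewrite minner_linear.
have h u : minner z (lact a u) = minner (lact (astar a) z) u :> M.
  by rewrite lact_adj astarK.
by rewrite !h minner_linear.
Qed.
Lemma lact_linl (x : F) : linear (fun a : M => lact a x).
Proof. by move=> c a b; rewrite lactD lactZ. Qed.

(** If [b^* b = 2 g - g^2] with [g] self-adjoint, then [<x, x> - <b x, b x> = <(1 - g) x, (1 - g)
    x>] is positive. This settles [|b| <= 1]; the rest is scaling. *)
Lemma nrm_lact (a : M) (x : F) : nrm (lact a x) <= nrm a * nrm x.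
Proof.
have main b : nrm b <= 1 -> nrm (lact b x) <= nrm x.
  move=> b1; have [||g gs gb] := @star_mul_sqrt R M (astar b ** b).
  - by rewrite astarM astarK.
  - by rewrite nrm_star_amul expr_le1 ?nrm_ge0.
  apply: nrm_le_minner; rewrite /mle.
  have -> : minner x x - minner (lact b x) (lact b x) =
            minner (x - lact g x) (x - lact g x) :> M; last exact: minner_mpos.
  rewrite lact_adj -lactM gb (linB (lact_linl x)) lactZ lactM.
  rewrite minnerBl !minnerBr (lact_adj g x x) (lact_adj g x (lact g x)) gs minnerZr.
  set p := minner x x; set q := minner x (lact g x); set r := minner x _.
  rewrite rc_nat; lmodC.
have [a0|/nrm_le0->] := ltP 0 (nrm a); last by rewrite (lin0 (lact_linl x)) !nrm0 mul0r.
have /main : nrm (rc (nrm a)^-1 *: a) <= 1.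
  by rewrite nrmZr ?invr_ge0 ?nrm_ge0 // mulVf ?gt_eqF.
by rewrite lactZ nrmZr ?invr_ge0 ?nrm_ge0 // ler_pdivrMl.
Qed.
End LeftAction.

Section Representation.
Variables (H : hilbertType R) (pi : M -> H -> H).
Hypothesis hpi : representation pi.

Lemma rep_bounded a : bounded_op (pi a). Proof. by case: hpi. Qed.
Lemma rep_linr a : linear (pi a). Proof. exact: (rep_bounded a).1. Qed.
Lemma rep_linl h : linear (fun a => pi a h).
Proof. by move=> c a b; case: hpi => _ ->. Qed.
Lemma repM a b h : pi (a ** b) h = pi a (pi b h). Proof. by case: hpi. Qed.
Lemma rep_adj a h k : ip (pi a h) k = ip h (pi (astar a) k). Proof. by case: hpi. Qed.

(** The computation of [nrm_lact], with scalar inner products. *)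
Lemma nrm_rep a h : nrm (pi a h) <= nrm a * nrm h.
Proof.
have main b : nrm b <= 1 -> nrm (pi b h) <= nrm h.
  move=> b1; have [||g gs gb] := @star_mul_sqrt R M (astar b ** b).
  - by rewrite astarM astarK.
  - by rewrite nrm_star_amul expr_le1 ?nrm_ge0.
  apply: le_sqr; first exact: nrm_ge0.
  rewrite -rc_le -!ipxx -subr_ge0.
  have -> : ip h h - ip (pi b h) (pi b h) = ip (h - pi g h) (h - pi g h).
    rewrite rep_adj -repM gb (linB (rep_linl h)) (linZ (rep_linl h)) repM.
    rewrite ipBl !ipBr (rep_adj g h h) (rep_adj g h (pi g h)) gs ipZr rc_nat; ring.
  by rewrite ipxx -rc0 rc_le sqr_ge0.
have [a0|/nrm_le0->] := ltP 0 (nrm a); last by rewrite (lin0 (rep_linl h)) !nrm0 mul0r.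
have /main : nrm (rc (nrm a)^-1 *: a) <= 1.
  by rewrite nrmZr ?invr_ge0 ?nrm_ge0 // mulVf ?gt_eqF.
by rewrite (linZ (rep_linl h)) nrmZr ?invr_ge0 ?nrm_ge0 // ler_pdivrMl.
Qed.
End Representation.

Section Gram.
Variables (H : hilbertType R) (pi : M -> H -> H).
Hypothesis hpi : representation pi.
Variable F : hmodType M.

Definition right_submodule (X : set F) : Prop :=
  [/\ X 0, forall (c : C) x y, X x -> X y -> X (c *: x + y) & forall x (a : M), X x -> X (ract x a)].

(* Right M-balanced maps on X x H, like [(x, h) |-> T_n(x) h]. *)
Definition balanced (X : set F) (W : lmodType C) (tau : F -> H -> W) : Prop :=
  [/\ forall x, X x -> linear (tau x),
      forall c x y h, X x -> X y -> tau (c *: x + y) h = c *: tau x h + tau y h &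
      forall x a h, X x -> tau (ract x a) h = tau x (pi a h)].

Lemma right_submoduleT : right_submodule setT. Proof. by []. Qed.

Lemma submodule_sum (X : set F) (I : Type) (r : seq I) (P : pred I) (x : I -> F) :
  right_submodule X -> (forall i, X (x i)) -> X (\sum_(i <- r | P i) x i).
Proof.
move=> [X0 XD _] hx; elim/big_ind: _ => // u v hu hv.
by rewrite -[u]scale1r; exact: XD.
Qed.

Lemma balanced_sum (X : set F) (W : lmodType C) (tau : F -> H -> W) (I : Type)
    (r : seq I) (x : I -> F) h : right_submodule X -> balanced X tau ->
  (forall i, X (x i)) -> tau (\sum_(i <- r) x i) h = \sum_(i <- r) tau (x i) h.
Proof.
move=> hX [_ tl _] hx; have X0 : X 0 by case: hX.
have t0 : tau 0 h = 0.
  have := tl 1 0 0 h X0 X0; rewrite scaler0 addr0 scale1r => e.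
  have : tau 0 h + 0 = tau 0 h + tau 0 h by rewrite addr0.
  by move/addrI => <-.
elim: r => [|i r IH]; first by rewrite !big_nil.
rewrite !big_cons -[x i]scale1r tl ?scale1r ?IH //; exact: submodule_sum.
Qed.

Section Family.
Variables (I : finType) (zeta : I -> F).

(** This is [L^* L] for the row [L] of the [zeta i], acting on families of vectors of H; [cogram] is
    [1 - L^* L], the companion of [coframe]. *)
Definition gram (h : I -> H) : I -> H :=
  fun i => \sum_j pi (minner (zeta i) (zeta j)) (h j).
Definition cogram (h : I -> H) : I -> H := h - gram h.

Lemma coframe_ract x a : coframe zeta (ract x a) = ract (coframe zeta x) a.
Proof.
rewrite /coframe (linB (ract_linl a)); congr (_ - _).
rewrite (lin_sum (ract_linl a)); apply: eq_bigr => i _.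
by rewrite minnerMr ractA.
Qed.

Section Transfer.
Variables (X : set F) (W : lmodType C) (tau : F -> H -> W).
Hypotheses (hX : right_submodule X) (ht : balanced X tau) (Xz : forall i, X (zeta i)).

Lemma coframe_sub x : X x -> X (coframe zeta x).
Proof.
move=> Xx; case: (hX) => X0 XD XM; rewrite /coframe addrC -scaleN1r; apply: XD => //.
by apply: submodule_sum hX _ => i; exact: XM.
Qed.
Lemma iter_coframe_sub n x : X x -> X (iter n (coframe zeta) x).
Proof. by move=> Xx; elim: n => //= n; exact: coframe_sub. Qed.

Lemma balanced_iter n : balanced X (fun x => tau (iter n (coframe zeta) x)).
Proof.
case: (ht) => tr tl tm; split.
- by move=> x Xx; apply: tr; exact: iter_coframe_sub.
- move=> c x y h Xx Xy; rewrite -tl; try exact: iter_coframe_sub.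
  congr (tau _ h); elim: n => //= n ->; exact: coframe_linear.
- move=> x a h Xx; rewrite -tm; last exact: iter_coframe_sub.
  congr (tau _ h); elim: n => //= n ->; exact: coframe_ract.
Qed.
End Transfer.

(** With [s = 1 - L L^*] and [S = 1 - L^* L] this is the push-through identity [s L = L S];
    balancedness moves the coefficients in M from the module to the vectors. *)
Lemma balanced_cogram1 (X : set F) (W : lmodType C) (tau : F -> H -> W) h :
  right_submodule X -> balanced X tau -> (forall i, X (zeta i)) ->
  \sum_i tau (coframe zeta (zeta i)) (h i) = \sum_i tau (zeta i) (cogram h i).
Proof.
move=> hX ht Xz; case: (hX) => X0 XD XM; case: (ht) => tr tl tm.
have -> : \sum_i tau (zeta i) (cogram h i) = \sum_i tau (zeta i) (h i) -
    \sum_i \sum_j tau (zeta i) (pi (minner (zeta i) (zeta j)) (h j)).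
  rewrite -sumrB; apply: eq_bigr => i _.
  by rewrite (linB (tr _ (Xz i))) (lin_sum (tr _ (Xz i))).
rewrite exchange_big /= -sumrB; apply: eq_bigr => j _.
rewrite /coframe addrC -scaleN1r tl //; last by apply: submodule_sum hX _ => i; exact: XM.
rewrite scaleN1r addrC; congr (_ - _); rewrite (balanced_sum _ _ hX ht).
  by apply: eq_bigr => i _; rewrite tm.
by move=> i; exact: XM.
Qed.

Lemma balanced_cogram (X : set F) (W : lmodType C) (tau : F -> H -> W) n h :
  right_submodule X -> balanced X tau -> (forall i, X (zeta i)) ->
  \sum_i tau (iter n (coframe zeta) (zeta i)) (h i) =
  \sum_i tau (zeta i) (iter n cogram h i).
Proof.
move=> hX ht Xz; elim: n h => // n IH h; rewrite iterSr -IH.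
rewrite -(balanced_cogram1 h hX (balanced_iter hX ht Xz n) Xz).
by apply: eq_bigr => i _; rewrite iterSr.
Qed.

Definition fam_ip (h k : I -> H) : C := \sum_i ip (h i) (k i).

Lemma fam_ipDr h k l : fam_ip h (k + l) = fam_ip h k + fam_ip h l.
Proof. by rewrite -big_split; apply: eq_bigr => i _; rewrite ipDr. Qed.
Lemma fam_ipZr c h k : fam_ip h (c *: k) = c * fam_ip h k.
Proof. by rewrite /fam_ip mulr_sumr; apply: eq_bigr => i _; rewrite ipZr. Qed.
Lemma fam_ipC h k : (fam_ip h k)^* = fam_ip k h.
Proof. by rewrite rmorph_sum; apply: eq_bigr => i _; exact: ipC. Qed.
Lemma fam_ip_ge0 h : 0 <= fam_ip h h.
Proof. by apply: sumr_ge0 => i _; rewrite ipxx -rc0 rc_le sqr_ge0. Qed.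
Lemma fam_ipBr h k l : fam_ip h (k - l) = fam_ip h k - fam_ip h l.
Proof. by rewrite -scaleN1r fam_ipDr fam_ipZr mulN1r. Qed.
Lemma fam_ipBl h k l : fam_ip (k - l) h = fam_ip k h - fam_ip l h.
Proof. by rewrite -fam_ipC fam_ipBr rmorphB /= !fam_ipC. Qed.

Definition fam_nrm : (I -> H) -> R := prenorm fam_ip.
Lemma fam_nrm_sqr h : fam_ip h h = rc (fam_nrm h ^+ 2).
Proof. exact: (prenorm_sqr fam_ip_ge0). Qed.
Lemma fam_nrm_ge0 h : 0 <= fam_nrm h. Proof. exact: sqrtr_ge0. Qed.
Lemma fam_CS h k : nrm (fam_ip h k) <= fam_nrm h * fam_nrm k.
Proof. exact: (prenorm_CS fam_ipDr fam_ipZr fam_ipC fam_ip_ge0). Qed.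
Lemma fam_nrmE h : fam_nrm h ^+ 2 = \sum_i nrm (h i) ^+ 2.
Proof.
by apply: rc_inj; rewrite -fam_nrm_sqr rc_sum; apply: eq_bigr => i _; rewrite ipxx.
Qed.

Lemma gram_adj h k : fam_ip (gram h) k = fam_ip h (gram k).
Proof.
rewrite /fam_ip; under eq_bigr => i _ do rewrite ip_suml.
rewrite exchange_big; apply: eq_bigr => j _ /=; rewrite ip_sumr.
by apply: eq_bigr => i _; rewrite (rep_adj hpi) minnerC.
Qed.
Lemma cogram_adj h k : fam_ip (cogram h) k = fam_ip h (cogram k).
Proof. by rewrite fam_ipBl fam_ipBr gram_adj. Qed.

Lemma fam_nrm_le h c : 0 <= c -> (forall i, nrm (h i) <= c) ->
  fam_nrm h <= #|I|%:R * c.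
Proof.
move=> c0 hc; have s0 : 0 <= \sum_i nrm (h i) by apply: sumr_ge0 => i _; exact: nrm_ge0.
apply: (@le_trans _ _ (\sum_i nrm (h i))); last first.
  by rewrite mulr_natl -sumr_const; apply: ler_sum => i _.
apply: le_sqr => //; rewrite fam_nrmE expr2 mulr_suml; apply: ler_sum => i _.
rewrite expr2 ler_wpM2l ?nrm_ge0 // (bigD1 i) //= lerDl; apply: sumr_ge0 => j _.
exact: nrm_ge0.
Qed.

Hypothesis hz : normalized zeta.

(** The norms of [S^n h], with [S = cogram], form a log-convex sequence because [S] is symmetric.
    Successive vectors differ by [L^* L S^n h], which by the push-through identity is the family of
    sums of [pi <zeta_i, s^n zeta_j> h_j]; these stay bounded, as [s = coframe] does not increase
    norms. So the growth is at most linear and [log_convex_le] applies. *)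
Lemma nrm_cogram h : fam_nrm (cogram h) <= fam_nrm h.
Proof.
pose e n := fam_nrm (iter n cogram h).
pose D := \sum_i \sum_j nrm (zeta i) * nrm (zeta j) * nrm (h j).
have D0 : 0 <= D.
  by apply: sumr_ge0 => i _; apply: sumr_ge0 => j _; rewrite !mulr_ge0 ?nrm_ge0.
have hD n i : nrm (gram (iter n cogram h) i) <= D.
  have ht : balanced setT (fun y => pi (minner (zeta i) y)).
    split; first by move=> y _; exact: rep_linr.
      by move=> c y z k _ _; rewrite minner_linear (rep_linl hpi).
    by move=> y a k _; rewrite minnerMr (repM hpi).
  rewrite /gram -(balanced_cogram n h right_submoduleT ht) //.
  apply: (@le_trans _ _ (\sum_j nrm (zeta i) * nrm (zeta j) * nrm (h j))).
    apply: le_trans (nrm_sum _ _ _) _; apply: ler_sum => j _.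
    apply: le_trans (nrm_rep hpi _ _) _; rewrite ler_wpM2r ?nrm_ge0 //.
    apply: le_trans (minner_CS _ _) _; rewrite ler_wpM2l ?nrm_ge0 //.
    exact: nrm_iter_coframe.
  rewrite /D [leRHS](bigD1 i) //= lerDl.
  by apply: sumr_ge0 => k _; apply: sumr_ge0 => j _; rewrite !mulr_ge0 ?nrm_ge0.
pose K := fam_nrm h + #|I|%:R * D.
have K0 : 0 <= K by rewrite addr_ge0 ?fam_nrm_ge0 // mulr_ge0.
apply: (@log_convex_le R e K) => n; first exact: fam_nrm_ge0.
  have -> : e n.+1 ^+ 2 = nrm (fam_ip (iter n cogram h) (iter n.+2 cogram h)).
    have -> : fam_ip (iter n cogram h) (iter n.+2 cogram h) = rc (e n.+1 ^+ 2).
      by rewrite -fam_nrm_sqr /= cogram_adj.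
    by rewrite nrm_rc_ge0 // sqr_ge0.
  exact: fam_CS.
elim: n => [|n IH]; first by rewrite mulr1 lerDl mulr_ge0.
apply: le_trans (_ : e n + #|I|%:R * D <= _).
  apply: le_trans (prenormD fam_ipDr fam_ipZr fam_ipC fam_ip_ge0 _ _) _.
  rewrite lerD2l -scaleN1r (prenormZ fam_ipZr fam_ipC fam_ip_ge0).
  rewrite nrmN -rc1 nrm_rc_ge0 // mul1r; apply: fam_nrm_le => // i; exact: hD.
rewrite -[n.+2%:R]natr1 mulrDr mulr1; apply: lerD IH _.
by rewrite /K lerDr fam_nrm_ge0.
Qed.

(** For the Gram operator [G], contractivity of [1 - G] amounts to [G^2 <= 2 G]; positivity of [G]
    is read off from this. *)
Lemma gram_sqr_le h : rc (fam_nrm (gram h) ^+ 2) <= rc 2 * fam_ip h (gram h).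
Proof.
have := nrm_cogram h; rewrite -(@ler_sqr R) ?nnegrE ?fam_nrm_ge0 // -rc_le.
rewrite -!fam_nrm_sqr fam_ipBl !fam_ipBr (gram_adj h h) -subr_ge0 => h0.
rewrite -subr_ge0; move: h0; rewrite rc_nat; congr (0 <= _); ring.
Qed.
End Family.
End Gram.

Lemma gramB (H : hilbertType R) (pi : M -> H -> H) (F : hmodType M) (I : finType)
    (zeta : I -> F) h k : representation pi ->
  gram pi zeta (h - k) = gram pi zeta h - gram pi zeta k.
Proof.
move=> hpi; apply/funext => i.
change (gram pi zeta (h - k) i = gram pi zeta h i - gram pi zeta k i).
by rewrite /gram -sumrB; apply: eq_bigr => j _; exact: (linB (rep_linr hpi _)).
Qed.

Lemma gramZ (H : hilbertType R) (pi : M -> H -> H) (F : hmodType M) (I : finType)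
    (zeta : I -> F) r h : representation pi ->
  gram pi (fun i => rc r *: zeta i) h = rc (r ^+ 2) *: gram pi zeta h.
Proof.
move=> hpi; apply/funext => i.
change (gram pi (fun i => rc r *: zeta i) h i = rc (r ^+ 2) *: gram pi zeta h i).
rewrite /gram scaler_sumr; apply: eq_bigr => j _.
by rewrite minnerZl minnerZr rc_conj scalerA -rcM (linZ (rep_linl hpi _)) -expr2.
Qed.

(** Homogeneity reduces this to a normalized family, where [gram_sqr_le] applies. It makes the
    kernels behind tensor products positive. *)
Lemma gram_ge0 (H : hilbertType R) (pi : M -> H -> H) (F : hmodType M) (I : finType)
    (zeta : I -> F) (h : I -> H) : representation pi ->
  0 <= \sum_i \sum_j ip (h i) (pi (minner (zeta i) (zeta j)) (h j)).
Proof.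
move=> hpi; have [r r0 hr] := normalize zeta.
have : 0 <= fam_ip h (gram pi (fun i => rc r *: zeta i) h).
  have := gram_sqr_le hpi hr h; set z := fam_ip _ _ => hz.
  have : 0 <= rc 2 * z by apply: le_trans hz; rewrite -rc0 rc_le sqr_ge0.
  by rewrite pmulr_rge0 // -rc0 rc_lt.
rewrite gramZ // fam_ipZr pmulr_rge0; last by rewrite -rc0 rc_lt exprn_gt0.
congr (0 <= _); apply: eq_bigr => i _; exact: ip_sumr.
Qed.

Lemma htensor_exists (F : hmodType M) (X : set F) (H : hilbertType R) (D : set H)
  (sigma : M -> H -> H) : representation sigma -> X 0 -> D 0 ->
  inhabited (htensor X D sigma).
Proof.
(* The kernel has to be defined on all pairs: arguments outside [X] or [D] are replaced by 0, which
   does not enlarge the span. *)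
move=> hs X0 D0; pose xh x := if pselect (X x) then x else 0.
pose dh d := if pselect (D d) then d else 0.
have Xx x : X (xh x) by rewrite /xh; case: pselect.
have Dd d : D (dh d) by rewrite /dh; case: pselect.
have xhE x : X x -> xh x = x by rewrite /xh; case: pselect.
have dhE d : D d -> dh d = d by rewrite /dh; case: pselect.
pose kappa (p q : F * H) : C := ip (dh p.2) (sigma (minner (xh p.1) (xh q.1)) (dh q.2)).
have kC y z : (kappa y z)^* = kappa z y.
  by rewrite ipC (rep_adj hs) minnerC.
have kp l : 0 <= kform kappa l l.
  pose I := 'I_(size l); pose a (i : I) := nth (0, (0, 0)) l i.
  have := gram_ge0 (fun i => xh (a i).2.1) (fun i => (a i).1 *: dh (a i).2.2) hs.
  congr (0 <= _); rewrite /kform (big_nth (0, (0, 0))) big_mkord.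
  apply: eq_bigr => i _; rewrite (big_nth (0, (0, 0))) big_mkord; apply: eq_bigr => j _.
  by rewrite (linZ (rep_linr hs _)) ipZl ipZr mulrA.
have [G [phi [hphi dphi]]] := kernel_space kC kp.
constructor; apply: (@Htensor _ _ _ _ _ _ _ G (fun x h => phi (x, h))).
- by move=> x x' h h' Xx1 Xx2 Dh Dh'; rewrite hphi /kappa /= !xhE ?dhE.
- rewrite -dphi; congr closure; apply/seteqP; split=> z; last first.
    move: z; apply: lin_spanP; first exact: lin_span0.
    move=> c _ z [[x h] _ <-] hz; apply: lin_span_cons hz.
    exists (xh x), (dh h); split=> //; apply: ip_ext => u.
    suff -> : phi (x, h) = phi (xh x, dh h) by [].
    apply/eqP; rewrite -subr_eq0; apply/eqP/ip_eq0.
    by rewrite ipBl !ipBr !hphi /kappa /= (xhE _ (Xx _)) (dhE _ (Dd _)) !subrr.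
  move: z; apply: lin_spanP; first exact: lin_span0.
  by move=> c _ z [x [h [_ _ ->]]] hz; apply: lin_span_cons hz; exists (x, h).
Qed.
End Actions.

Section TensorExtension.
Variable R : realType.
Local Notation C := (cplx R).
Variable M : cstarType R.

Definition linear_subspace (H : hilbertType R) (D : set H) : Prop :=
  D 0 /\ forall (c : C) x y, D x -> D y -> D (c *: x + y).

Lemma linear_subspaceT (H : hilbertType R) : linear_subspace (setT : set H).
Proof. by []. Qed.

Section One.
Variables (F : hmodType M) (X : set F) (H : hilbertType R) (D : set H).
Variables (sigma : M -> H -> H) (G : htensor X D sigma).
Hypotheses (hs : representation sigma) (hX : right_submodule X).
Hypothesis hD : linear_subspace D.

Notation t := (htensor_map G).

Lemma htensor_ext (y z : G) :
  (forall x h, X x -> D h -> ip (t x h) y = ip (t x h) z) -> y = z.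
Proof.
move=> h; apply: (ip_dense (@htensor_dense _ _ _ _ _ _ _ G)) => _ [x [k [Xx Dk ->]]].
exact: h.
Qed.

Lemma htensor_linl c x y h : X x -> X y -> D h ->
  t (c *: x + y) h = c *: t x h + t y h.
Proof.
move=> Xx Xy Dh; have [X0 XD XM] := hX; apply: htensor_ext => z k Xz Dk.
rewrite ipDr ipZr !htensor_ip //; last exact: XD.
by rewrite minner_linear (rep_linl hs) ipDr ipZr.
Qed.
Lemma htensor_linr c x h k : X x -> D h -> D k ->
  t x (c *: h + k) = c *: t x h + t x k.
Proof.
move=> Xx Dh Dk; have [D0 DD] := hD; apply: htensor_ext => z l Xz Dl.
rewrite ipDr ipZr !htensor_ip //; last exact: DD.
by rewrite (rep_linr hs) ipDr ipZr.
Qed.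
Lemma htensor_ract x a h : X x -> D h -> D (sigma a h) -> t (ract x a) h = t x (sigma a h).
Proof.
move=> Xx Dh Dh'; have [X0 XD XM] := hX.
apply: htensor_ext => z k Xz Dk; rewrite !htensor_ip //; try exact: XM.
by rewrite minnerMr (repM hs).
Qed.
Lemma nrm_htensor x h : X x -> D h -> nrm (t x h) <= nrm x * nrm h.
Proof.
move=> Xx Dh; apply: le_sqr; first by rewrite mulr_ge0 ?nrm_ge0.
have -> : nrm (t x h) ^+ 2 = nrm (ip (t x h) (t x h)).
  by rewrite ipxx nrm_rc_ge0 // sqr_ge0.
rewrite htensor_ip //; apply: le_trans (ip_CS _ _) _.
apply: (@le_trans _ _ (nrm h * (nrm x ^+ 2 * nrm h))).
  by rewrite ler_wpM2l ?nrm_ge0 // -nrm_minner; exact: nrm_rep.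
by rewrite le_eqVlt; apply/orP; left; apply/eqP; ring.
Qed.
Lemma htensor_bounded_op (W : normedModType C) (A B : G -> W) :
  bounded_op A -> bounded_op B ->
  (forall x h, X x -> D h -> A (t x h) = B (t x h)) -> A =1 B.
Proof.
move=> hA hB h z; pose E := [set z | exists x h, [/\ X x, D h & z = t x h]].
have Ez : closure (lin_span E) z by rewrite (@htensor_dense _ _ _ _ _ _ _ G).
by apply: (eq_bounded_closure hA hB _ Ez) => _ [x [k [Xx Dk ->]]]; exact: h.
Qed.

(** The Gram inequality is boundedness on formal combinations. Their scalars are absorbed into the
    vectors [h i], which is why homogeneity of [psi x] is asked for. *)
Lemma htensor_extension (W : completeNormedModType C) (psi : F -> H -> W) (b : R) :
  0 <= b -> (forall c x h, X x -> D h -> psi x (c *: h) = c *: psi x h) ->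
  (forall n (x : 'I_n -> F) (h : 'I_n -> H), (forall i, X (x i)) -> (forall i, D (h i)) ->
    rc (nrm (\sum_i psi (x i) (h i)) ^+ 2) <=
    rc (b ^+ 2) * \sum_i \sum_j ip (h i) (sigma (minner (x i) (x j)) (h j))) ->
  exists A : G -> W, [/\ bounded_op A, forall z, nrm (A z) <= b * nrm z &
    forall x h, X x -> D h -> A (t x h) = psi x h].
Proof.
move=> b0 psiZ hb; have [X0 XD XM] := hX; have [D0 DD] := hD.
pose xh x := if pselect (X x) then x else 0.
pose dh d := if pselect (D d) then d else 0.
have Xx x : X (xh x) by rewrite /xh; case: pselect.
have Dd d : D (dh d) by rewrite /dh; case: pselect.
have [|A [Ab An Ag]] := @hilbert_extension R (F * H) G W
   (fun p => t (xh p.1) (dh p.2)) (fun p => psi (xh p.1) (dh p.2)) b b0.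
  move=> l; apply: le_sqr; first by rewrite mulr_ge0 ?nrm_ge0.
  rewrite exprMn -rc_le [rc (b ^+ 2 * _)]rcM -[rc (nrm (comb (fun p => t _ _) l) ^+ 2)]ipxx ip_comb.
  pose a (i : 'I_(size l)) := nth (0, (0, 0)) l i.
  have DZ c d : D d -> D (c *: d) by move=> hd; rewrite -[_ *: _]addr0; exact: DD.
  have := hb _ (fun i => xh (a i).2.1) (fun i => (a i).1 *: dh (a i).2.2)
     (fun i => Xx _) (fun i => DZ _ _ (Dd _)).
  have -> : \sum_i psi (xh (a i).2.1) ((a i).1 *: dh (a i).2.2) =
     comb (fun p => psi (xh p.1) (dh p.2)) l.
    rewrite /comb (big_nth (0, (0, 0))) big_mkord; apply: eq_bigr => i _.
    by rewrite psiZ.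
  congr (_ <= _ * _); rewrite [in RHS](big_nth (0, (0, 0))) big_mkord.
  apply: eq_bigr => i _; rewrite (big_nth (0, (0, 0))) big_mkord.
  apply: eq_bigr => j _ /=.
  by rewrite htensor_ip // (linZ (rep_linr hs _)) ipZl ipZr mulrA.
exists A; split=> // x h Xx1 Dh; have := Ag (x, h).
have -> : xh (x, h).1 = x by rewrite /xh; case: pselect.
by have -> : dh (x, h).2 = h by rewrite /dh; case: pselect.
Qed.
End One.
End TensorExtension.

(** * The operators from X(n) (x) H to H induced by a representation *)

Section Tilde.
Variables (R : realType) (M : cstarType R) (s : setting M).
Local Notation C := (cplx R).
Variables (X : subproduct_system s).

Lemma fiber_submodule n : right_submodule (@fiber _ _ _ X n).
Proof.
have [X0 h] := fiber_bimodule X n; split=> // [c x y Xx Xy|x a Xx].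
  have [_ /(_ c 0) [hc _ _]] := h x x Xx Xx.
  by have [] := h _ _ hc Xy.
by have [_ /(_ 0 a) []] := h x x Xx Xx.
Qed.
Lemma fiber_lact n x (a : M) : fiber x -> @fiber _ _ _ X n (lact a x).
Proof.
have [X0 h] := fiber_bimodule X n.
by move=> Xx; have [_ /(_ 0 a) []] := h x x Xx Xx.
Qed.
Lemma fiber_0 n : @fiber _ _ _ X n 0.
Proof. by case: (fiber_submodule n). Qed.

Variables (H : hilbertType R) (T : op_family X H).
Arguments T : clear implicits.
Hypothesis hT : ccc_rep T.

Lemma rep_balanced n : balanced (rep0 T) (@fiber _ _ _ X n) (T n).
Proof.
split=> [x Xx|c x y h Xx Xy|x a h Xx]; first exact: (ccc_bounded hT Xx).1.
  exact: (ccc_linear hT).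
exact: (ccc_ract hT).
Qed.

Lemma rep_zero n h : T n 0 h = 0.
Proof.
have h0 := fiber_0 n; have := ccc_linear hT 1 h h0 h0.
rewrite scaler0 addr0 scale1r => e.
have : T n 0 h + 0 = T n 0 h + T n 0 h by rewrite addr0.
by move/addrI => <-.
Qed.

(** Complete contractivity speaks of square matrices, so the row becomes the first line of a square
    matrix with zeros elsewhere. The empty family has no first line and is treated apart. *)
Lemma row_contractive n (I : finType) (x : I -> pow X n) (h : I -> H) :
  (forall i, fiber (x i)) ->
  (forall a : I -> M, nrm (\sum_i ract (x i) (a i)) ^+ 2 <=
                      nrm (\sum_i astar (a i) ** a i)) ->
  nrm (\sum_i T n (x i) (h i)) ^+ 2 <= \sum_i nrm (h i) ^+ 2.
Proof.
move=> Xx hx; have bij := onW_bij xpredT (@enum_val_bij I).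
rewrite !(reindex _ bij) /=; move: bij => _.
case: (posnP #|I|) => [|I0].
  by move=> I0; rewrite !big1 ?nrm0 ?expr0n // => i; have := ltn_ord i; rewrite {2}I0.
pose i0 := Ordinal I0.
pose z (i j : 'I_#|I|) : pow X n := if i == i0 then x (enum_val j) else 0.
have Xz i j : fiber (z i j) by rewrite /z; case: eqP => // _; exact: fiber_0.
have zn : mx_norm_le z 1.
  split=> // a /=; rewrite expr1n mul1r (bigD1 i0) //= [X in _ + X]big1 ?addr0; last first.
    move=> i /negPf ne; rewrite big1 ?minner0l // => j _.
    by rewrite /z ne (lin0 (ract_linl _)).
  rewrite !nrmE rc_le nrm_minner.
  have := hx (fun i => a (enum_rank i)); rewrite !(reindex _ (onW_bij xpredT (@enum_val_bij I))) /=.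
  under eq_bigr => i _ do rewrite enum_valK.
  under [X in _ <= nrm X]eq_bigr => i _ do rewrite enum_valK.
  by congr (_ <= _); congr (nrm _ ^+ 2); apply: eq_bigr => i _; rewrite /z eqxx.
have := ccc_contractive hT Xz zn (fun j => h (enum_val j)).
rewrite expr1n mul1r => hh; rewrite -rc_le rc_sum.
apply: le_trans (le_trans hh _); last first.
  by rewrite le_eqVlt; apply/orP; left; apply/eqP/eq_bigr => i _; rewrite nrmE rcX.
rewrite [leRHS](bigD1 i0) //= [X in _ <= _ + X]big1 ?addr0; last first.
  move=> i /negPf ne; rewrite big1 ?normr0 ?expr0n // => j _.
  by rewrite /z ne rep_zero.
rewrite nrmE -rcX rc_le le_eqVlt; apply/orP; left; apply/eqP.
by congr (nrm _ ^+ 2); apply: eq_bigr => j _; rewrite /z eqxx.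
Qed.

Section Bound.
Variables (n : nat) (I : finType) (x : I -> pow X n).
Hypothesis Xx : forall i, fiber (x i).

Let Tx (h : I -> H) : H := \sum_i T n (x i) (h i).
Let S := cogram (rep0 T) x.

Let TxB h k : Tx (h - k) = Tx h - Tx k.
Proof.
rewrite /Tx -sumrB; apply: eq_bigr => i _.
exact: (linB (ccc_bounded hT (Xx i)).1).
Qed.

Hypothesis hx : normalized x.

(** The rows of the [s^i x_j] are contractive by [coframe_row], and the push-through identity turns
    [s^i] on the module into [S^i] on the vectors. *)
Let rep_row m (k : nat -> I -> H) :
  nrm (\sum_(i < m) Tx (iter i S (k i))) ^+ 2 <= \sum_(i < m) fam_nrm (k i) ^+ 2.
Proof.
have -> : \sum_(i < m) fam_nrm (k i) ^+ 2 = \sum_(p : 'I_m * I) nrm (k p.1 p.2) ^+ 2.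
  by rewrite -(pair_bigA _ (fun (i : 'I_m) j => nrm (k i j) ^+ 2)); apply: eq_bigr => i _; rewrite fam_nrmE.
have -> : \sum_(i < m) Tx (iter i S (k i)) =
   \sum_(p : 'I_m * I) T n (iter p.1 (coframe x) (x p.2)) (k p.1 p.2).
  rewrite -(pair_bigA _ (fun (i : 'I_m) j => T n (iter i (coframe x) (x j)) (k i j))).
  apply: eq_bigr => i _ /=; symmetry.
  exact: balanced_cogram (fiber_submodule n) (rep_balanced n) Xx.
apply: (row_contractive (x := fun p : 'I_m * I => iter p.1 (coframe x) (x p.2))
  (fun p => k p.1 p.2)); last exact: coframe_row.
by move=> p; exact: (iter_coframe_sub (fiber_submodule n)).
Qed.

(* [T x h = T x (S^(2m) h) + \sum_(i < m) T x (S^i (S^i (1 - S^2) h))], where the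
   rows of the [s^i x_j] are contractive; averaging over them also shows that the
   first term tends to 0. *)
Lemma normalized_gram_bound h :
  rc (nrm (\sum_i T n (x i) (h i)) ^+ 2) <= rc 2 * fam_ip h (gram (rep0 T) x h).
Proof.
change (rc (nrm (Tx h) ^+ 2) <= rc 2 * fam_ip h (gram (rep0 T) x h)).
have hs := ccc_rep0 hT; pose e i := fam_nrm (iter i S h) ^+ 2.
have Se k : fam_nrm (S k) ^+ 2 <= fam_nrm k ^+ 2.
  by rewrite ler_sqr ?nnegrE ?fam_nrm_ge0 //; exact: nrm_cogram.
have Sn i : fam_nrm (iter i S h) <= fam_nrm h.
  by elim: i => //= i; apply: le_trans; exact: nrm_cogram.
have ip_iter i j : fam_ip (iter i S h) (iter j S h) = fam_ip h (iter (i + j) S h).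
  by elim: i j => // i IH j; rewrite iterS cogram_adj // -iterS IH addnS.
(* Row estimate for [k_i = S^i (1 - S^2) h]. On the left the terms telescope; on the right the
   squared norms are second differences of [e], with sum at most [e 0 - e 1]. *)
have b2 m : nrm (Tx h - Tx (iter (2 * m) S h)) ^+ 2 <= e 0%N - e 1%N.
  have := rep_row m (fun i => iter i S h - iter i.+2 S h).
  have SB i u v : iter i S (u - v) = iter i S u - iter i S v.
    elim: i => //= i ->; rewrite {1}/S /cogram (gramB _ _ _ hs).
    by rewrite !opprB addrACA [RHS]addrACA; congr (_ + _); rewrite addrC.
  under eq_bigr => i _ do rewrite SB TxB -!iterD addnS addnS addnn -doubleS.
  rewrite -(big_mkord xpredT (fun i => Tx (iter i.*2 S h) - Tx (iter i.+1.*2 S h))).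
  rewrite -[\sum_(0 <= i < m) _]opprK -sumrN.
  under eq_bigr => i _ do rewrite opprB.
  rewrite telescope_sumr // opprB mul2n /= => /le_trans; apply.
  have -> : \sum_(i < m) fam_nrm (iter i S h - iter i.+2 S h) ^+ 2 =
    \sum_(i < m) ((e i - e i.+1) - (e i.+1 - e i.+2)).
    apply: eq_bigr => i _; apply: rc_inj; rewrite -fam_nrm_sqr.
    have hsub u w : fam_ip (u - w) (u - w) = fam_ip u u - fam_ip u w - (fam_ip w u - fam_ip w w) :> C.
      by rewrite fam_ipBl !fam_ipBr.
    rewrite hsub !rcB /e -!fam_nrm_sqr !ip_iter !addnS !addSn; ring.
  rewrite -(big_mkord xpredT (fun i => (e i - e i.+1) - (e i.+1 - e i.+2))).
  rewrite -[\sum_(0 <= i < m) _]opprK -sumrN.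
  under eq_bigr => i _ do rewrite opprB.
  rewrite (telescope_sumr (fun i => e i - e i.+1)) // opprB gerBl subr_ge0; exact: Se.
(* [S^(2m+2) h] is written in [m + 1] ways as [S^i] of a vector of norm at most [|h|]; the row
   estimate for these equal terms gains the factor [1 / (m + 1)]. *)
have b1 m : nrm (Tx (iter (2 * m.+1) S h)) <= Num.sqrt (fam_nrm h ^+ 2 * m.+1%:R^-1).
  have := rep_row m.+1 (fun i => iter (2 * m.+1 - i) S h).
  have e1 (i : 'I_m.+1) : Tx (iter i S (iter (2 * m.+1 - i) S h)) = Tx (iter (2 * m.+1) S h).
    by rewrite -iterD subnKC // mul2n -addnn (leq_trans (ltnW (ltn_ord i))) ?leq_addr.
  rewrite (eq_bigr _ (fun i _ => e1 i)) sumr_const card_ord -scaler_nat -rc_nat.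
  rewrite nrmZr // exprMn => hh.
  have m0 : 0 < m.+1%:R :> R by [].
  rewrite -[leLHS]ger0_norm ?nrm_ge0 // -sqrtr_sqr ler_wsqrtr // -mulrC.
  rewrite ler_pdivlMl // -(ler_pM2l m0) mulrA -expr2; apply: le_trans hh _.
  rewrite mulr_natl -[m.+1 in leRHS]card_ord -sumr_const; apply: ler_sum => i _.
  by rewrite ler_sqr ?nnegrE ?fam_nrm_ge0.
have nv : nrm (Tx h) <= Num.sqrt (e 0%N - e 1%N).
  rewrite -subr_le0; apply: null_const.
  apply: null_le (null_sqrt (nullM (fam_nrm h ^+ 2) _ null_inv)) _ => [m|m]; first by rewrite invr_ge0.
  apply: le_trans (b1 m); rewrite lerBlDl.
  have := nrmD (Tx h - Tx (iter (2 * m.+1) S h)) (Tx (iter (2 * m.+1) S h)).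
  rewrite subrK => /le_trans; apply; rewrite lerD2r.
  by rewrite -[leLHS]ger0_norm ?nrm_ge0 // -sqrtr_sqr ler_wsqrtr.
have e01 : 0 <= e 0%N - e 1%N by rewrite subr_ge0; exact: Se.
(* [e 0 - e 1 = 2 <h, G h> - |G h|^2] for the Gram operator [G]; dropping the square leaves the
   constant 2. *)
apply: (@le_trans _ _ (rc (e 0%N - e 1%N))).
  rewrite rc_le -(sqr_sqrtr e01) ler_sqr ?nnegrE ?nrm_ge0 ?sqrtr_ge0 //.
have g0 : 0 <= fam_ip (gram (rep0 T) x h) (gram (rep0 T) x h) by exact: fam_ip_ge0.
rewrite rcB /e -!fam_nrm_sqr /= fam_ipBl !fam_ipBr (gram_adj hs _ h h) -subr_ge0.
by move: g0; rewrite rc_nat; congr (0 <= _); ring.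
Qed.
End Bound.

(** Both sides scale alike, so the family may be normalized. The constant 2 is harmless: the bound
    only has to produce a bounded operator [tilde]. *)
Lemma rep_gram_bound n (I : finType) (x : I -> pow X n) (h : I -> H) :
  (forall i, fiber (x i)) ->
  rc (nrm (\sum_i T n (x i) (h i)) ^+ 2) <=
  rc 2 * \sum_i \sum_j ip (h i) (rep0 T (minner (x i) (x j)) (h j)).
Proof.
move=> Xx; have [r r0 hr] := normalize x.
have XZ i : fiber (rc r *: x i).
  have [X0 XD _] := fiber_submodule n; rewrite -[_ *: _]addr0; exact: XD.
have := normalized_gram_bound XZ hr h.
rewrite (gramZ _ _ _ (ccc_rep0 hT)) fam_ipZr.
have -> : \sum_i T n (rc r *: x i) (h i) = rc r *: \sum_i T n (x i) (h i).
  rewrite scaler_sumr; apply: eq_bigr => i _.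
  rewrite -[rc r *: x i]addr0 (ccc_linear hT _ _ (Xx i) (fiber_0 n)).
  by rewrite rep_zero addr0.
rewrite (nrmZr _ (ltW r0)) exprMn [rc (r ^+ 2 * _)]rcM mulrCA.
rewrite ler_pM2l; last by rewrite -rc0 rc_lt exprn_gt0.
congr (_ <= _ * _); apply: eq_bigr => i _; exact: ip_sumr.
Qed.

Variable XH : fiber_tensor T.

Lemma tilde_spec n : bounded_op (@tilde _ _ _ _ _ _ XH n) /\
  forall x h, fiber x -> tilde (htensor_map (XH n) x h) = T n x h.
Proof.
have hs := ccc_rep0 hT.
have [||A [Ab _ AE]] := htensor_extension (XH n) hs (fiber_submodule n) (linear_subspaceT _)
  (psi := T n) (sqrtr_ge0 2%:R).
- by move=> c x h Xx _; exact: (linZ (ccc_bounded hT Xx).1).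
- by move=> k x h Xx _; rewrite sqr_sqrtr //; exact: rep_gram_bound.
apply: (@xgetPex _ (fun=> 0) [set A : XH n -> H | bounded_op A /\
    forall x h, fiber x -> A (htensor_map (XH n) x h) = T n x h]).
by exists A; split=> // x h Xx; exact: AE.
Qed.
Lemma tilde_bounded n : bounded_op (@tilde _ _ _ _ _ _ XH n).
Proof. by case: (tilde_spec n). Qed.
Lemma tildeE n x h : fiber x -> tilde (htensor_map (XH n) x h) = T n x h.
Proof. by case: (tilde_spec n) => _; exact. Qed.

Lemma fiber_tensor_bounded n x : fiber x -> bounded_op (htensor_map (XH n) x).
Proof.
move=> Xx; have hs := ccc_rep0 hT; apply/bounded_opP; split.
  by move=> c h k; rewrite (htensor_linr (XH n) hs (linear_subspaceT H)).
by exists (nrm x) => [|h]; [exact: nrm_ge0|exact: (nrm_htensor (XH n) hs)].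
Qed.

Lemma ip_adj_tilde n x h k : fiber x ->
  ip (htensor_map (XH n) x h) (adj (@tilde _ _ _ _ _ _ XH n) k) = ip (T n x h) k.
Proof. by move=> Xx; rewrite -(adjP (tilde_bounded n)) tildeE. Qed.
End Tilde.

(** * Ultraweak topologies and preduals *)

Section WeakTopology.
Variable R : realType.
Local Notation C := (cplx R).

Definition wball (V : Type) n (g : 'I_n -> V -> C) (e : R) (x y : V) : Prop :=
  forall i, nrm (g i y - g i x) < e.

Section One.
Variables (V : choiceType) (G : set (V -> C)).

Lemma wtop_cvg (F : set_system V) (x : V) : Filter F ->
  (forall g, G g -> g @ F --> g x) -> F --> (x : wtop G).
Proof.
move=> FF h; pose f := fun (y : wtop G) => (fun g : G => sval g y) : {ptws G -> C}.
have hf : f @ F --> f x.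
  apply/cvg_sup => -[g Gg] B [_ [[U oU <-] Ux] UB].
  apply: filterS UB _; rewrite nbhs_simpl.
  by apply: (h g (set_mem Gg)); exact: open_nbhs_nbhs.
move=> A; rewrite nbhsE => -[B [[U oU <-] xU] UA]; apply: filterS UA _.
by apply: hf; exact: open_nbhs_nbhs.
Qed.

Lemma wtop_continuous (g : V -> C) : G g -> continuous (g : wtop G -> C).
Proof.
move=> Gg x; pose f := fun (y : wtop G) => (fun g : G => sval g y) : {ptws G -> C}.
have hf : f @ (nbhs (x : wtop G)) --> f x by exact: initial_continuous.
have FF : Filter (nbhs (x : wtop G)) by exact: nbhs_filter.
pose i : G := exist _ g (mem_set Gg).
move=> B; rewrite nbhsE => -[U [oU Ux] UB].
have Ff : Filter (f @ nbhs (x : wtop G)) by exact: fmap_filter.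
have h := (@cvg_sup _ _ _ _ _ Ff).1 hf i [set k | U (k i)].
have {}h : nbhs (x : wtop G) [set y | U (g y)].
  by apply: h; exists [set k | U (k i)]; split=> //; exists U.
by apply: (@filterS _ _ FF _ _ _ h) => y; exact: UB.
Qed.

(** To find a ball in a neighbourhood, note that the sets containing a ball form a filter along
    which every functional in [G] converges; by [wtop_cvg] this filter contains all
    neighbourhoods. *)
Lemma wtop_nbhsP (x : V) (B : set V) : nbhs (x : wtop G) B <->
  exists n (g : 'I_n -> V -> C) e, [/\ 0 < e, forall i, G (g i) & wball g e x `<=` B].
Proof.
split=> [|[n [g [e [e0 Gg hB]]]]]; last first.
  have FF : Filter (nbhs (x : wtop G)) by exact: nbhs_filter.
  apply: (@filterS _ _ FF _ _ hB).
  apply: (@filter_forall _ _ (fun i y => nrm (g i y - g i x) < e) _ FF) => i.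
  have /cvgrPdist_lt := wtop_continuous (Gg i) (x := x).
  move=> /(_ (rc e)); rewrite -{1}rc0 rc_lt => /(_ e0).
  by apply: (@filterS _ _ FF) => y; rewrite nrmE rc_lt nrmBC.
pose F : set_system V := fun B => exists n (g : 'I_n -> V -> C) e,
  [/\ 0 < e, forall i, G (g i) & wball g e x `<=` B].
have FF : Filter F.
  split.
  - by exists 0%N, (fun i _ => 0), 1; split=> // -[].
  - move=> P Q [n [g [e [e0 Gg gP]]]] [m [k [d [d0 Gk kQ]]]].
    exists (n + m)%N, (fun i => match fintype.split i with inl j => g j | inr j => k j end).
    exists (Num.min e d); split; first by rewrite lt_min e0.
      by move=> i; case: fintype.split.
    move=> y hy; split; [apply: gP => i|apply: kQ => i].
      have := hy (lshift m i); case: split_ordP => j /eqP; rewrite ?eq_lshift ?eq_lrshift // => /eqP<-.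
      by rewrite lt_min => /andP[].
    have := hy (rshift n i); case: split_ordP => j /eqP; rewrite ?eq_rshift ?eq_rlshift // => /eqP<-.
    by rewrite lt_min => /andP[].
  - move=> P Q PQ [n [g [e [e0 Gg gP]]]]; exists n, g, e; split=> //.
    exact: subset_trans gP PQ.
have hF : F --> (x : wtop G).
  apply: wtop_cvg => g Gg; apply/cvgrPdist_lt => e /rc_gt0[r r0 ->].
  exists 1%N, (fun=> g), r; split=> // y /(_ ord0) /=.
  by rewrite nrmE rc_lt nrmBC.
exact: (hF B).
Qed.

Lemma wtop_closure (A : set V) (x : V) : closure (A : set (wtop G)) x ->
  forall n (g : 'I_n -> V -> C) e, 0 < e -> (forall i, G (g i)) ->
    exists2 a, A a & wball g e x a.
Proof.
move=> h n g e e0 Gg; have [|a [Aa ha]] := h (wball g e x).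
  by apply: (wtop_nbhsP x _).2; exists n, g, e; split=> // y.
by exists a.
Qed.
End One.

Lemma wtop_map (V W : choiceType) (G : set (V -> C)) (G' : set (W -> C)) (f : V -> W) :
  (forall g, G' g -> G (g \o f)) -> continuous (f : wtop G -> wtop G').
Proof.
move=> h x; have FF : Filter (nbhs (x : wtop G)) by exact: nbhs_filter.
have Ff : Filter (f @ nbhs (x : wtop G)) by exact: fmap_filter.
by apply: wtop_cvg => g /h Gg; exact: (wtop_continuous Gg (x := x)).
Qed.
End WeakTopology.

Section Predual.
Variable R : realType.
Local Notation C := (cplx R).

(** Alternating the sequences of two ultraweak functionals adds the functionals, so these are closed
    under linear combinations. *)
Definition interleave (V : Type) (u v : nat -> V) n := if odd n then v n./2 else u n./2.

Lemma series_interleave (V : zmodType) (u v : nat -> V) n :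
  series (interleave u v) n = series u (uphalf n) + series v n./2.
Proof.
elim: n => [|n IH]; first by rewrite /series /= !big_geq // addr0.
rewrite /series /= big_nat_recr //= [X in X + _]IH /interleave uphalf_half.
case: (odd n); rewrite /= /series /= ?add0n ?add1n !big_nat_recr //=.
  by rewrite !addrA.
by rewrite addrAC.
Qed.

Lemma conv_interleave (V : normedModType C) (u v : nat -> V) x y :
  conv (series u) x -> conv (series v) y -> conv (series (interleave u v)) (x + y).
Proof.
move=> hu hv e e0; have e2 : 0 < e / 2 by rewrite divr_gt0.
have [N hN] := hu _ e2; have [K hK] := hv _ e2.
exists (N + K).*2 => n hn; rewrite series_interleave opprD addrACA.
have h2 : (N + K <= n./2)%N by rewrite -(doubleK (N + K)%N) half_leq.
have h3 : (n./2 <= uphalf n)%N by rewrite uphalf_half leq_addl.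
apply: le_lt_trans (nrmD _ _) _; rewrite [e]splitr; apply: ltrD.
  by apply: hN; rewrite (leq_trans _ h3) // (leq_trans _ h2) ?leq_addr.
by apply: hK; rewrite (leq_trans _ h2) ?leq_addl.
Qed.

Lemma conv_single (V : normedModType C) (x : V) :
  conv (series (fun n => if n == 0%N then x else 0)) x.
Proof.
move=> e e0; exists 1%N => -[//|n] _; rewrite /series /= big_nat_recl //= big1 ?addr0 ?subrr ?nrm0 //.
Qed.

Lemma series_scale (V : lmodType C) c (u : nat -> V) n :
  series (fun i => c *: u i) n = c *: series u n.
Proof. by rewrite /series /= scaler_sumr. Qed.

Section Ultraweak.
Variable H : hilbertType R.

Lemma cvgC (u : nat -> C) (x : C) : u @ \oo --> x <-> conv (u : nat -> C^o) x.
Proof.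
split=> [/cvgrPdist_lt h e e0|h].
  have : 0 < rc e by rewrite -rc0 rc_lt.
  move=> /h [N _ hN]; exists N => n Nn; rewrite nrmBC -rc_lt -nrmE.
  exact: (hN n Nn).
apply/cvgrPdist_lt => e /rc_gt0[r r0 ->]; have [N hN] := h r r0.
exists N => // n Nn /=; have := hN n Nn; rewrite nrmBC -rc_lt -nrmE.
exact.
Qed.

Lemma uw_functionalP (f : (H -> H) -> C) : uw_functional f <->
  exists xi eta : nat -> H,
    [/\ exists x : C^o, conv (series (fun i => `|xi i| ^+ 2 : C^o)) x,
        exists x : C^o, conv (series (fun i => `|eta i| ^+ 2 : C^o)) x &
        forall S, bounded_op S ->
          conv (series (fun i => ip (xi i) (S (eta i)) : C^o)) (f S : C^o)].
Proof.
split=> -[xi [eta [h1 h2 h3]]]; exists xi, eta; split.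
- by move/cvg_ex: h1 => [x hx]; exists x; exact: (cvgC _ _).1.
- by move/cvg_ex: h2 => [x hx]; exists x; exact: (cvgC _ _).1.
- by move=> S /h3 h; exact: (cvgC _ _).1.
- by have [x hx] := h1; apply/cvg_ex; exists x; exact: (cvgC _ _).2.
- by have [x hx] := h2; apply/cvg_ex; exists x; exact: (cvgC _ _).2.
- by move=> S /h3 h; exact: (cvgC _ _).2.
Qed.

Lemma uw_functional_lin c f g : uw_functional f -> uw_functional g ->
  uw_functional (fun S : H -> H => c * f S + g S).
Proof.
move=> /uw_functionalP[xi [eta [[x hx] [y hy] hf]]] /uw_functionalP[xi' [eta' [[x' hx'] [y' hy'] hg]]].
apply/uw_functionalP; exists (interleave xi xi'), (interleave (fun i => c *: eta i) eta').
split.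
- exists (x + x'); have := conv_interleave hx hx'; congr (conv (series _) _).
  by apply/funext => n; rewrite /interleave; case: odd.
- exists (`|c| ^+ 2 * y + y').
  have hy2 : conv (series (fun i => `|c *: eta i| ^+ 2 : C^o)) (`|c| ^+ 2 * y).
    have := conv_scale (`|c| ^+ 2) hy; congr conv; apply/funext => n.
    by rewrite -series_scale; congr (series _ n); apply/funext => i; rewrite normrZ exprMn.
  have := conv_interleave hy2 hy'; congr (conv (series _) _).
  by apply/funext => n; rewrite /interleave; case: odd.
- move=> S Sb.
  have hf2 : conv (series (fun i => ip (xi i) (S (c *: eta i)) : C^o)) (c * f S).
    have := conv_scale c (hf S Sb); congr conv; apply/funext => n.
    by rewrite -series_scale; congr (series _ n); apply/funext => i; rewrite (linZ Sb.1) ipZr.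
  have := conv_interleave hf2 (hg S Sb); congr (conv (series _) _).
  by apply/funext => n; rewrite /interleave; case: odd.
Qed.

Lemma uw_functional_single (xi eta : H) : uw_functional (fun S => ip xi (S eta)).
Proof.
apply/uw_functionalP.
exists (fun n => if n == 0%N then xi else 0), (fun n => if n == 0%N then eta else 0).
split.
- exists (`|xi| ^+ 2); have := @conv_single C^o (`|xi| ^+ 2); congr (conv (series _) _).
  by apply/funext => -[|n] //=; rewrite normr0 expr0n.
- exists (`|eta| ^+ 2); have := @conv_single C^o (`|eta| ^+ 2); congr (conv (series _) _).
  by apply/funext => -[|n] //=; rewrite normr0 expr0n.
- move=> S Sb; have := @conv_single C^o (ip xi (S eta)); congr (conv (series _) _).
  by apply/funext => -[|n] //=; rewrite ip0l.
Qed.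

End Ultraweak.

Lemma functional_comb (V : lmodType C) n (w : 'I_n -> V -> C) (phi : V -> C) :
  (forall i, linear (w i : V -> C^o)) -> linear (phi : V -> C^o) ->
  (forall a, (forall i, w i a = 0) -> phi a = 0) ->
  exists c : 'I_n -> C, forall a, phi a = \sum_i c i * w i a.
Proof.
elim: n w phi => [|n IH] w phi wl pl h.
  by exists (fun=> 0) => a; rewrite big_ord0; apply: h => -[].
have [c0 hc0] : exists c0, forall a, (forall i, w (lift ord0 i) a = 0) ->
    phi a - c0 * w ord0 a = 0.
  have [hz|/existsNP[a0 /not_implyP[a0z /eqP a0n]]] :=
    pselect (forall a, (forall i, w (lift ord0 i) a = 0) -> w ord0 a = 0).
    exists 0 => a ha; rewrite mul0r subr0; apply: h => i.
    by case: (unliftP ord0 i) => [j|] ->; [exact: ha|exact: hz].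
  exists (phi a0 / w ord0 a0) => a ha.
  pose t := w ord0 a / w ord0 a0.
  have : phi (a - t *: a0) = 0.
    apply: h => i; rewrite (linB (wl i)) (linZ (wl i)).
    case: (unliftP ord0 i) => [j|] ->; first by rewrite ha a0z scaler0 subr0.
    by rewrite /t /GRing.scale /= divfK // subrr.
  rewrite (linB pl) (linZ pl) => e; rewrite -[RHS]e; congr (_ - _).
  by rewrite /t /GRing.scale /=; ring.
have [||c hc] := IH (fun i => w (lift ord0 i)) (fun a => phi a - c0 * w ord0 a) (fun i => wl _).
- move=> t a b; rewrite pl (wl ord0) /GRing.scale /=; ring.
- exact: hc0.
exists (fun i => if unlift ord0 i is Some j then c j else c0) => a.
rewrite big_ord_recl unlift_none; under eq_bigr => i _ do rewrite liftK.
by rewrite -hc addrC subrK.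
Qed.
End Predual.

(** * Preduals of von Neumann algebras *)

Section VonNeumann.
Variables (R : realType) (M : cstarType R) (v : vnAlgebra M).
Local Notation C := (cplx R).

Local Notation pi := (vn_rep (v := v)).

Lemma predual_lin c w w' : predual v w -> predual v w' ->
  predual v (fun a => c * w a + w' a).
Proof.
move=> [f fu ->] [g gu ->]; exists (fun S => c * f S + g S); last exact: erefl.
exact: uw_functional_lin.
Qed.
Lemma predual_single (xi eta : vn_space v) : predual v (fun a => ip xi (pi a eta)).
Proof. by exists (fun S => ip xi (S eta)) => //; exact: uw_functional_single. Qed.
Lemma predual_sum n (c : 'I_n -> C) (w : 'I_n -> M -> C) :
  (forall i, predual v (w i)) -> predual v (fun a => \sum_i c i * w i a).
Proof.
elim: n c w => [|n IH] c w hw.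
  have := predual_single 0 0; congr predual; apply/funext => a.
  by rewrite big_ord0 ip0l.
have := predual_lin (c ord0) (hw ord0) (IH (fun i => c (lift ord0 i)) (fun i => w (lift ord0 i)) (fun i => hw _)).
by congr predual; apply/funext => a; rewrite big_ord_recl.
Qed.
Lemma predual_linear w : predual v w -> linear (w : M -> C^o).
Proof.
move=> [f /uw_functionalP[xi [eta [_ _ hf]]] ->] c a b /=.
have hb := rep_bounded (vn_repP v).
apply: conv_uniq (hf _ (hb _)) _.
have := convD (conv_scale c (hf _ (hb a))) (hf _ (hb b)); congr conv; apply/funext => n.
rewrite -series_scale /series /= -big_split /=; apply: eq_bigr => i _.
by rewrite (rep_linl (vn_repP v)) ipDr ipZr.
Qed.

(** Normality is continuity between weak topologies. Continuity at 0 bounds the functional on a ball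
    given by finitely many [w i] of the predual; by scaling it vanishes on their common kernel, so
    it is a combination of them. *)
Lemma normal_predual (H : hilbertType R) (sigma : M -> H -> H) (d1 d2 : H) :
  representation sigma -> normal_rep v sigma ->
  predual v (fun a => ip d1 (sigma a d2)).
Proof.
move=> hs hn; pose phi a := ip d1 (sigma a d2).
have pl : linear (phi : M -> C^o).
  by move=> c a b; rewrite /phi (rep_linl hs) ipDr ipZr.
have h0 : phi @ nbhs (0 : wtop (predual v)) --> phi 0.
  apply: (@continuous_comp _ _ _ (sigma : wtop (predual v) -> wtop (@uw_functional R H))
     ((fun S => ip d1 (S d2)) : wtop (@uw_functional R H) -> C) 0); first exact: hn.
  exact: (wtop_continuous (uw_functional_single d1 d2)).
have /cvgrPdist_lt/(_ 1 ltr01) := h0.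
move=> /(wtop_nbhsP (predual v) (0 : M) _).1 [n [w [e [e0 hw hball]]]].
have [|c hc] := @functional_comb R M n w phi (fun i => predual_linear (hw i)) pl.
- move=> a ha; apply: nrm_le0; rewrite leNgt; apply/negP => p0.
  have := hball (rc (nrm (phi a))^-1 *: a); rewrite /= (lin0 pl) sub0r normrN (linZ pl).
  rewrite /GRing.scale /= normrM !nrmE nrm_rc_ge0 ?invr_ge0 ?nrm_ge0 // -rcM mulVf ?gt_eqF //.
  rewrite rc1 ltxx => /(_ _) h; suff : false by []; apply: h => i.
  rewrite (linZ (predual_linear (hw i))) ha (lin0 (predual_linear (hw i))) scaler0 subrr nrm0 //.
have := predual_sum c hw; congr predual; apply/funext => a; exact/esym/hc.
Qed.

(** The identity operator commutes with everything, so it is represented by an element, and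
    injectivity makes that element a unit. *)
Lemma vn_unit : exists e : M, [/\ astar e = e, forall a, e ** a = a & forall a, a ** e = a].
Proof.
have [//|e he] := @vn_bicommutant R M v (fun x => x) (@bounded_id _ _).
have el a : e ** a = a.
  by apply: (@vn_inj _ _ v); apply/funext => h; rewrite (repM (vn_repP v)) -he.
have es : astar e = e by rewrite -[LHS]el -{1}[e]astarK -astarM el astarK.
exists e; split=> // a; by rewrite -[a]astarK -{1}es -astarM el.
Qed.

(* The square root [1 - g] of [1 - pi (a^* a)] commutes with the commutant, hence
   lies in the algebra, and [1 - a^* a] is positive there. *)
Lemma vn_rep_isometric a c : 0 <= c -> (forall xi, nrm (pi a xi) <= c * nrm xi) ->
  nrm a <= c.
Proof.
have hp := vn_repP v; have [e [es el er]] := vn_unit.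
have e1 : nrm e <= 1.
  have := nrm_star_amul e; rewrite es el => h.
  have [e0|] := ltP 0 (nrm e); last by move/le_trans; apply.
  by rewrite -(ler_pM2l e0) mulr1 -expr2 -h.
have main b : (forall xi, nrm (pi b xi) <= nrm xi) -> nrm b <= 1.
  move=> hb; pose f := pi (astar b ** b).
  have fl : linear f by exact: rep_linr hp _.
  have f1 x : nrm (f x) <= nrm x.
    rewrite /f (repM hp); have hb' y : nrm (pi (astar b) y) <= 1 * nrm y.
      have <- : adj (pi b) = pi (astar b).
        by apply: adj_uniq; [exact: rep_bounded|move=> u w; rewrite (rep_adj hp)].
      by apply: adj_bound => // [|u]; [exact: rep_bounded|rewrite mul1r].
    by apply: le_trans (hb' _) _; rewrite mul1r.
  have [g [gl g1 gc _ gf]] := sqrt_iter_lim fl f1.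
  have gb : bounded_op g.
    by apply/bounded_opP; split=> //; exists 1 => // x; rewrite mul1r.
  have [S' Sb hS h|k gk] := vn_bicommutant gb.
    have hn n x : S' (sqrt_iter f n x) = sqrt_iter f n (S' x).
      elim: n x => [|n IH] x /=; first exact: lin0 Sb.1.
      by rewrite (linZ Sb.1) (linD Sb.1) !IH hS.
    apply: conv_uniq (gc _) _; have := bounded_conv Sb (gc h).
    by congr conv; apply/funext => n; exact: hn.
  have gs x y : ip (g x) y = ip x (g y).
    have hn n : ip (sqrt_iter f n x) y = ip x (sqrt_iter f n y).
      elim: n x y => [|n IH] x y /=; first by rewrite ip0l ip0r.
      by rewrite ipZl ipZr rc_conj ipDl ipDr !IH /f (rep_adj hp) astarM astarK.
    apply: (conv_uniq _ (ip_conv x (gc y))).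
    have h1 := ip_conv y (gc x).
    have : conv (fun n => (ip y (sqrt_iter f n x))^* : C^o) (ip y (g x))^*.
      apply: null_le h1 _ => n; by rewrite -rmorphB /= nrm_conj.
    by rewrite ipC; congr conv; apply/funext => n; rewrite ipC hn.
  have ks : astar k = k.
    apply: (@vn_inj _ _ v); apply/funext => x; apply: ip_ext => y.
    by rewrite -(rep_adj hp) -gk gs.
  have kk : astar b ** b = rc 2 *: k - k ** k.
    apply: (@vn_inj _ _ v); apply/funext => x.
    rewrite (linB (rep_linl hp x)) (linZ (rep_linl hp x)) (repM hp k k) -gk; exact: gf.
  have pq : mpos (e - astar b ** b).
    have -> : e - astar b ** b = astar (e - k) ** (e - k).
      rewrite astarD astarN es ks amulDl !amulDr !amulNl !amulNr el er el kk rc_nat opprK.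
      by set kk2 := k ** k; lmodC.
    exact: mpos_star_mul.
  have := mpos_nrm_le (mpos_star_mul b) pq; rewrite addrC subrK => /le_trans /(_ e1).
  by rewrite nrm_star_amul expr_le1 ?nrm_ge0.
move=> c0 hc; apply/ler_addgt0Pr => t t0.
have ct : 0 < c + t by rewrite ltr_wpDl.
have ci : 0 <= (c + t)^-1 by rewrite invr_ge0 ltW.
have /main : forall xi, nrm (pi (rc (c + t)^-1 *: a) xi) <= nrm xi.
  move=> xi; rewrite (linZ (rep_linl hp xi)) (nrmZr _ ci) ler_pdivrMl //.
  by apply: le_trans (hc _) _; rewrite ler_wpM2r ?nrm_ge0 // lerDl ltW.
by rewrite (nrmZr _ ci) ler_pdivrMl // mulr1.
Qed.
End VonNeumann.

Section SigmaTopology.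
Variables (R : realType) (M : cstarType R) (v : vnAlgebra M).
Local Notation C := (cplx R).

Local Notation pi := (vn_rep (v := v)).

Lemma null_geometric (r c : R) : 0 <= r -> r < 1 -> null (fun n => c * r ^+ n).
Proof.
move=> r0 r1; apply: nullM => [n|e e0]; first exact: exprn_ge0.
have /cvgrPdist_lt/(_ e e0)[N _ hN] := cvg_expr (z := r) (ltac:(by rewrite ger0_norm)).
by exists N => n /hN; rewrite /= sub0r normrN; apply: le_lt_trans; exact: ler_norm.
Qed.

(** Inverts [1 - a] on the module by iterating [x |-> z + x a]. *)
Lemma right_fixpoint (F : hmodType M) (z : F) (a : M) : nrm a < 1 ->
  exists x, x = z + ract x a.
Proof.
move=> a1; have a0 := nrm_ge0 a; pose u := fix u n := if n is m.+1 then z + ract (u m) a else 0 : F.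
have i0 : 0 < 1 - nrm a by rewrite subr_gt0.
have ub n : nrm (u n) <= nrm z / (1 - nrm a).
  elim: n => [|n IH] /=; first by rewrite nrm0 divr_ge0 ?nrm_ge0 // ltW.
  apply: le_trans (nrmD _ _) _; apply: le_trans (_ : nrm z + nrm z / (1 - nrm a) * nrm a <= _).
    by rewrite lerD2l; apply: le_trans (nrm_ract _ _) _; rewrite ler_wpM2r.
  rewrite -{1}[nrm z](divfK (lt0r_neq0 i0)) -mulrDr subrK mulr1 //.
have ud n k : nrm (u (n + k)%N - u n) <= nrm z / (1 - nrm a) * nrm a ^+ n.
  elim: n => [|n IH] /=; first by rewrite add0n subr0 mulr1.
  have -> : z + ract (u (n + k)%N) a - (z + ract (u n) a) = ract (u (n + k)%N - u n) a.
    by rewrite (linB (ract_linl a)); lmodC.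
  apply: le_trans (nrm_ract _ _) _; rewrite exprSr mulrA; exact: ler_wpM2r.
have [x ux _] := cauchy_conv (null_geometric _ a0 a1) ud.
exists x; apply: conv_uniq (conv_shift 1 ux) _.
have ab : bounded_op (fun y : F => ract y a).
  apply/bounded_opP; split; first exact: ract_linl.
  by exists (nrm a) => // y; rewrite mulrC nrm_ract.
have := convD (conv_cst z) (bounded_conv ab ux); congr conv; apply/funext => n.
by rewrite addn1.
Qed.

Section Unit.
Variable e : M.
Hypotheses (es : astar e = e) (el : forall a : M, e ** a = a) (er : forall a : M, a ** e = a).

Lemma nrm_unit : nrm e <= 1.
Proof.
have := nrm_star_amul e; rewrite es el => h.
have [e0|] := ltP 0 (nrm e); last by move/le_trans; apply.
by rewrite -(ler_pM2l e0) mulr1 -expr2 -h.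
Qed.

Lemma ract_unit (F : hmodType M) (x : F) : ract x e = x.
Proof.
by apply: minner_ext => z; rewrite minnerMr er.
Qed.

(* [y = y' c] with [c] the positive square root of [<y, y> + eps]. *)
Lemma module_factor (F : hmodType M) (y : F) (eps : R) : 0 < eps ->
  exists c (y' : F), [/\ astar c = c, c ** c = minner y y + rc eps *: e,
    y = ract y' c & nrm y' <= 1].
Proof.
move=> e0; set b : M := minner y y; pose K := nrm b + eps.
have K0 : 0 < K by rewrite ltr_wpDl ?nrm_ge0.
have Ki : 0 <= K^-1 by rewrite invr_ge0 ltW.
have bs : astar b = b by rewrite minnerC.
(* Chosen so that [b + eps = K (1 - a)] with [|a| < 1]: then [1 - a] has the root [1 - g] and is
   invertible on modules. *)
pose a := rc K^-1 *: (rc (nrm b) *: e - b).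
have as_ : astar a = a by rewrite astarZ rc_conj astarD astarN astarZ rc_conj es bs.
have a1 : nrm a < 1.
  rewrite /a (nrmZr _ Ki) ltr_pdivrMl // mulr1.
  have bp : mpos b by exact: minner_mpos.
  have pp : mpos (rc (nrm b) *: e - b).
    by have := mle_conj e bp; rewrite /mle es el er el.
  have := mpos_nrm_le pp bp; rewrite subrK => /le_lt_trans; apply.
  rewrite nrmZr ?nrm_ge0 //; apply: le_lt_trans (_ : nrm b < _); last by rewrite /K ltrDl.
  by rewrite ler_piMr ?nrm_ge0 ?nrm_unit.
have [g gs ga] := star_mul_sqrt as_ (ltW a1).
have bK : b + rc eps *: e = rc K *: (e - a).
  rewrite /a scalerBr scalerA -rcM mulfV ?gt_eqF // rc1 /K rcD; lmodC.
pose c := rc (Num.sqrt K) *: (e - g).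
have cs : astar c = c by rewrite astarZ rc_conj astarD astarN es gs.
have cc : c ** c = b + rc eps *: e.
  rewrite bK /c amulZl amulZr scalerA -rcM -expr2 sqr_sqrtr ?ltW //; congr (_ *: _).
  rewrite amulDl !amulDr !amulNl !amulNr el er el ga rc_nat opprK.
  by set gg := g ** g; lmodC.
clearbody c.
have inj (w : F) : ract (ract w c) c = 0 -> w = 0.
  rewrite -ractA cc bK ractZr => h.
  have {}h : ract w (e - a) = 0.
    have := congr1 (fun x => rc K^-1 *: x) h.
    by rewrite scalerA -rcM mulVf ?gt_eqF // rc1 scale1r scaler0.
  have wa : w = ract w a.
    by apply/eqP; rewrite -subr_eq0 -{1}[w]ract_unit -(linB (ract_linr w)) h.
  apply: nrm_le0; have := nrm_ract w a; rewrite -wa => hw.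
  have : nrm w * (1 - nrm a) <= 0 by rewrite mulrBr mulr1 subr_le0.
  by rewrite pmulr_lle0 // subr_gt0.
(* As [c^2 = K (1 - a)], this [y'] solves [y' c^2 = y c]; cancelling one [c] by [inj] gives
   [y' c = y]. *)
have [y' hy'] := right_fixpoint (ract (rc K^-1 *: y) c) a1.
have yc2 : ract (ract y' c) c = ract y c.
  rewrite -ractA cc bK ractZr (linB (ract_linr y')) ract_unit {1}hy' addrK.
  by rewrite ractZl scalerA -rcM mulfV ?gt_eqF // rc1 scale1r.
have yc : ract y' c = y.
  have : ract (ract (ract y' c - y) c) c = 0.
    by rewrite (linB (ract_linl c)) yc2 subrr (lin0 (ract_linl c)).
  by move=> /inj/eqP; rewrite subr_eq0 => /eqP.
exists c, y'; split=> //.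
pose p : M := minner y' y'; pose q := e - p.
have qs : astar q = q by rewrite astarD astarN es minnerC.
have cqc : c ** q ** c = rc eps *: e.
  rewrite /q amulDr amulNr er amulDl amulNl cc.
  have -> : c ** p ** c = b by rewrite /b -[in RHS]yc minnerMl minnerMr cs amulA.
  by rewrite addrAC subrr add0r.
(* [c q] and [q c] are [eps] times a left and a right inverse of [c], so they agree; then [eps q]
   equals [(c q)^* (c q)]. *)
have qc : q ** c = c ** q.
  have h1 : c ** (q ** c) = rc eps *: e by rewrite amulA.
  have h2 : (c ** q) ** c = rc eps *: e by [].
  have : (c ** q) ** (c ** (q ** c)) = (c ** q ** c) ** (q ** c) by rewrite !amulA.
  rewrite h1 h2 amulZl amulZr el er => /(congr1 (fun x => rc eps^-1 *: x)).
  by rewrite !scalerA -rcM mulVf ?gt_eqF // rc1 !scale1r.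
have qp : mpos q.
  have -> : q = rc eps^-1 *: (astar (c ** q) ** (c ** q)).
    by rewrite astarM cs qs qc amulA cqc amulZl el scalerA -rcM mulVf ?gt_eqF // rc1 scale1r.
  by apply: mposZ; [rewrite invr_ge0 ltW|exact: mpos_star_mul].
have := mpos_nrm_le (minner_mpos y') qp; rewrite addrC subrK nrm_minner => h.
by rewrite -(@expr_le1 _ 2) ?nrm_ge0 //; apply: le_trans h nrm_unit.
Qed.

Lemma rep_unit (H : hilbertType R) (sigma : M -> H -> H) h :
  representation sigma -> sigma e h = h.
Proof.
move=> hs; have [sb sl sM sa dense] := hs.
apply: (@eq_bounded_closure _ _ _ (sigma e) (fun x => x)
   [set x | exists a h, x = sigma a h]) => //.
- exact: bounded_id.
- by move=> _ [a [k ->]]; rewrite -sM el.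
- by rewrite dense.
Qed.
End Unit.

Lemma cvg_series_geometric (a : nat -> R) K : (forall n, 0 <= a n <= K * 2^-1 ^+ n) ->
  exists x : C^o, conv (series (fun n => rc (a n) : C^o)) x.
Proof.
move=> ha; have [|n k|x hx] := @cauchy_conv_complex R (series (fun n => rc (a n) : C))
    (fun n => 2 * K * 2^-1 ^+ n).
- by apply: null_geometric; rewrite ?invr_ge0 // invf_lt1 // ltr1n.
- suff : nrm (series (fun n => rc (a n) : C) (n + k)%N - series (fun n => rc (a n) : C) n) <=
    2 * K * (2^-1 ^+ n - 2^-1 ^+ (n + k)).
    move=> /le_trans; apply; have := ha 0%N; rewrite mulr1 => /andP[h0 h1].
    have K0 : 0 <= K := le_trans h0 h1.
    by rewrite ler_wpM2l ?mulr_ge0 // gerBl exprn_ge0 // invr_ge0.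
  elim: k => [|k IH]; first by rewrite addn0 !subrr nrm0 mulr0.
  rewrite addnS /series /= big_nat_recr //= addrAC.
  apply: le_trans (nrmD _ _) _; apply: le_trans (lerD IH (lexx _)) _.
  have /andP[h0 h1] := ha (n + k)%N; rewrite nrm_rc_ge0 // exprS.
  by move: h1; lra.
- by exists x.
Qed.

Lemma sigma_closure (F : hmodType M) (A : set F) (z : F) (phi psi : F -> C) :
  closure_in (WstarSetting v) A z ->
  sigma_functional v setT phi -> sigma_functional v setT psi ->
  (forall a, A a -> phi a = psi a) -> phi z = psi z.
Proof.
move=> hz hphi hpsi hA; apply/eqP; rewrite -subr_eq0; apply/eqP/nrm_le0.
apply/ler_addgt0Pr => t t0; rewrite add0r.
have hz' : closure (A : set (wtop (sigma_functional v [set: F]))) z by exact: hz.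
pose g (i : 'I_2) := if i == ord0 then phi else psi.
have t2 : 0 < t / 2 by rewrite divr_gt0.
have gs i : sigma_functional v [set: F] (g i) by rewrite /g; case: eqP.
have [a Aa ha] := wtop_closure hz' t2 gs.
have h1 : nrm (phi a - phi z) < t / 2 := ha ord0.
have h2 : nrm (psi a - psi z) < t / 2 := ha (lift ord0 ord0).
have -> : phi z - psi z = (phi z - phi a) + (psi a - psi z) by rewrite (hA a Aa); ring.
apply: le_trans (nrmD _ _) _; rewrite [t]splitr; apply: lerD; last exact: ltW.
by rewrite nrmBC; exact: ltW.
Qed.

Section Tensor.
Variables (F : hmodType M) (H : hilbertType R) (D : set H) (sigma : M -> H -> H).
Variable K : htensor (setT : set F) D sigma.
Hypothesis hs : representation sigma.
Hypothesis hn : normal_rep v sigma.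

Notation t := (htensor_map K).

(** The difficulty is that [y (x) d] may be small while [y] is not. After projecting, [kappa] is a
    series of vectors [y n (x) d] of order [2^-n]. Factoring [y n = y' c] with [|y'| <= 1] moves the
    smallness to [c d], so that the functionals [a |-> <c d, a d>] have summable norms. *)
Lemma tensor_sigma_functional (kappa : K) d : D d ->
  sigma_functional v setT (fun x => ip kappa (t x d)).
Proof.
move=> Dd; have [e [es el er]] := vn_unit v.
have tl x y c : t (c *: x + y) d = c *: t x d + t y d.
  exact: (htensor_linl K hs (right_submoduleT F)).
have tB x y : t (x - y) d = t x d - t y d.
  exact: (linB (f := fun x => t x d) (fun c x y => tl x y c)).
have [k' kc kp] := projection_exists (range (fun x => t x d)) kappa.
have kE x : ip kappa (t x d) = ip k' (t x d).
  apply/eqP; rewrite -subr_eq0 -ipBl -ipC kp ?conjC0 //; by exists x.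
have /choice[x hx] : forall n, exists x, nrm (t x d - k') < 2^-1 ^+ n.
  move=> n; have e0 : 0 < 2^-1 ^+ n :> R by rewrite exprn_gt0 // invr_gt0.
  have [u us hu] := (closureP _ _).1 kc _ e0.
  suff [y yE] : exists y, u = t y d by exists y; rewrite -yE.
  move: u us {hu}; apply: lin_spanP.
    by exists 0; rewrite (lin0 (f := fun x => t x d) (fun c x y => tl x y c)).
  by move=> c _ _ [y _ <-] [y' ->]; exists (c *: y + y'); rewrite tl.
pose y n := if n is m.+1 then x m.+1 - x m else x 0%N.
have ysum n : \sum_(0 <= i < n.+1) y i = x n.
  elim: n => [|n IH]; first by rewrite big_nat1.
  by rewrite big_nat_recr //= IH addrC subrK.
pose B := nrm k' + 4.
have yB n : nrm (t (y n) d) <= B * 2^-1 ^+ n.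
  case: n => [|n] /=.
    have := nrmD (t (x 0%N) d - k') k'; rewrite subrK expr0 mulr1 => /le_trans; apply.
    by have := hx 0%N; rewrite expr0 /B; lra.
  rewrite tB; apply: le_trans (nrmT k' _ _) _; have := hx n; have := hx n.+1.
  rewrite [nrm (k' - _)]nrmBC exprS; have := nrm_ge0 k'.
  have : 0 < 2^-1 ^+ n :> R by rewrite exprn_gt0 // invr_gt0.
  by rewrite /B; set r := 2^-1 ^+ n; nra.
(* With [eps = 4^-n] one gets [|c d|^2 = |y n (x) d|^2 + 4^-n |d|^2], still of order [4^-n]. *)
have eps0 n : 0 < (2^-1 ^+ n) ^+ 2 :> R by rewrite !exprn_gt0 // invr_gt0.
have /choice[f hf] : forall n, exists p : M * F, [/\ astar p.1 = p.1,
    p.1 ** p.1 = minner (y n) (y n) + rc ((2^-1 ^+ n) ^+ 2) *: e,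
    y n = ract p.2 p.1 & nrm p.2 <= 1].
  move=> n; have [c [y' h]] := module_factor es el er (y n) (eps0 n).
  by exists (c, y').
pose k n := sigma (f n).1 d.
pose b n := (B + nrm d) * 2^-1 ^+ n.
have B0 : 0 <= B by rewrite addr_ge0 ?nrm_ge0.
have kb n : nrm (k n) <= b n.
  have r0 : 0 <= 2^-1 ^+ n :> R by rewrite exprn_ge0 // invr_ge0.
  have [cs cc _ _] := hf n.
  apply: le_sqr; first by rewrite mulr_ge0 // addr_ge0 ?nrm_ge0.
  have -> : nrm (k n) ^+ 2 = nrm (t (y n) d) ^+ 2 + (2^-1 ^+ n) ^+ 2 * nrm d ^+ 2.
    apply: rc_inj; rewrite rcD [rc ((2^-1 ^+ n) ^+ 2 * _)]rcM -!ipxx htensor_ip // /k (rep_adj hs) cs -(repM hs) cc.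
    by rewrite (linD (rep_linl hs d)) (linZ (rep_linl hs d)) (rep_unit el _ hs) ipDr ipZr.
  rewrite /b mulrDl sqrrD addrAC; apply: (@le_trans _ _ ((B * 2^-1 ^+ n) ^+ 2 + (nrm d * 2^-1 ^+ n) ^+ 2)).
    rewrite [(nrm d * _) ^+ 2]exprMn mulrC lerD2r.
    by rewrite ler_sqr ?nnegrE ?nrm_ge0 ?mulr_ge0.
  rewrite lerDl mulrn_wge0 // mulr_ge0 // mulr_ge0 ?nrm_ge0 //.
pose w n a := ip (k n) (sigma a d).
exists w, (fun n => (f n).2), (fun n => rc (b n * nrm d)); split.
- by move=> i; split=> //; exact: normal_predual.
- move=> i a; rewrite [`|a|]nrmE nrmE -rcM rc_le; apply: le_trans (ip_CS _ _) _.
  rewrite -mulrA; apply: ler_pM; rewrite ?nrm_ge0 //.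
  by rewrite mulrC; exact: nrm_rep.
- have b0 n : 0 <= b n by apply: le_trans (kb n); exact: nrm_ge0.
  have [|s hsum] := @cvg_series_geometric (fun n => b n * nrm d * nrm (f n).2) ((B + nrm d) * nrm d).
    move=> n; have [_ _ _ f1] := hf n; have bd0 : 0 <= b n * nrm d by rewrite mulr_ge0 ?nrm_ge0.
    rewrite mulr_ge0 ?nrm_ge0 //=.
    have -> : (B + nrm d) * nrm d * 2^-1 ^+ n = b n * nrm d by rewrite /b; ring.
    by rewrite ler_piMr.
  apply/cvg_ex; exists s; apply: (cvgC _ _).2; move: hsum; congr (conv (series _) _).
  by apply/funext => n; rewrite [`|_|]nrmE rcM.
- move=> z; apply: (cvgC _ _).2.
  have wE n : w n (minner (f n).2 z) = ip (t (y n) d) (t z d).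
    have [cs _ yf _] := hf n.
    rewrite htensor_ip // yf minnerMl cs (repM hs) /w /k (rep_adj hs) cs //.
  have sE n : series (fun i => w i (minner (f i).2 z)) n.+1 = ip (t (x n) d) (t z d).
    rewrite /series /= (eq_bigr _ (fun n _ => wE n)) -ip_suml; congr (ip _ _).
    rewrite -ysum; symmetry.
    by apply: (lin_sum (f := fun x => t x d) (fun c x y => tl x y c)).
  rewrite kE; move=> r r0.
  have [N hN] := null_geometric (nrm (t z d)) (r := 2^-1) (ltac:(by rewrite invr_ge0)) (ltac:(by rewrite invf_lt1 // ltr1n)) r0.
  exists N.+1 => -[//|n] Nn; rewrite sE -ipBl; apply: le_lt_trans (ip_CS _ _) _.
  apply: le_lt_trans (hN n _); last by [].
  by rewrite mulrC ler_wpM2l ?nrm_ge0 // ltW.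
Qed.
End Tensor.

Lemma vn_rep_normal : normal_rep v pi.
Proof. by apply: wtop_map => g hg; exists g. Qed.

End SigmaTopology.

(** * Products in subproduct systems *)

Section Density.
Variables (R : realType) (M : cstarType R) (s : setting M).

Definition normal_in (H : hilbertType R) (sigma : M -> H -> H) : Prop :=
  match s with CstarSetting => True | WstarSetting v => normal_rep v sigma end.

Lemma subset_closure_in (F : hmodType M) (A : set F) : A `<=` closure_in s A.
Proof. by case: s => [|v] a Aa B /nbhs_singleton Ba; exists a. Qed.

(** In the C*-setting both sides are norm continuous in [z]; in the W*-setting they are functionals
    that generate the sigma-topology. Identities can thus be verified on generators in both
    settings. *)
Lemma closure_in_tensor (F : hmodType M) (H : hilbertType R) (D : set H)
    (sigma : M -> H -> H) (K : htensor (setT : set F) D sigma) (A : set F)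
    (k k' : K) d d' z :
  representation sigma -> normal_in sigma ->
  D d -> D d' -> closure_in s A z ->
  (forall a, A a -> ip k (htensor_map K a d) = ip k' (htensor_map K a d')) ->
  ip k (htensor_map K z d) = ip k' (htensor_map K z d').
Proof.
move=> hs; rewrite /normal_in /closure_in; case: s => [_|v hn] Dd Dd' hz hA; last first.
  have h1 := tensor_sigma_functional hs hn k Dd.
  have h2 := tensor_sigma_functional hs hn k' Dd'.
  exact: (sigma_closure hz h1 h2 hA).
have tb c : D c -> bounded_op (fun x => htensor_map K x c).
  move=> Dc; apply/bounded_opP; split.
    by move=> t x y; exact: (htensor_linl K hs (right_submoduleT F)).
  by exists (nrm c) => [|x]; rewrite ?nrm_ge0 // mulrC; exact: (nrm_htensor K hs).
have [u uA uz] := (closure_conv A z).1 hz.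
have h1 := bounded_conv (bounded_comp (ip_bounded k) (tb d Dd)) uz.
have h2 := bounded_conv (bounded_comp (ip_bounded k') (tb d' Dd')) uz.
apply: conv_uniq h1 _; move: h2; congr conv; apply/funext => n /=.
exact/esym/hA.
Qed.

End Density.

Section Projection.
Variables (R : realType) (M : cstarType R) (F : hmodType M) (X : set F).
Hypothesis hX : right_submodule X.

(** Relational form of [orth_proj], which can be combined linearly without knowing that every vector
    has a projection. *)
Definition projects (y x : F) : Prop := X x /\ forall w, X w -> minner w (y - x) = 0 :> M.

Lemma submodule_sub x y : X x -> X y -> X (x - y).
Proof. by case: hX => _ XD _ hx hy; rewrite addrC -scaleN1r; exact: XD. Qed.

Lemma projects_uniq y x x' : projects y x -> projects y x' -> x = x'.
Proof.
move=> [Xx hx] [Xx' hx']; apply/eqP; rewrite -subr_eq0; apply/eqP/minner_eq0.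
have Xd := submodule_sub Xx Xx'.
have -> : x - x' = (y - x') - (y - x) by lmodC.
have -> : y - x' - (y - x) = x - x' by lmodC.
by rewrite (_ : x - x' = (y - x') - (y - x)) in Xd *; first rewrite minnerBr hx // hx' // subrr; lmodC.
Qed.
Lemma orth_proj_eq y x : projects y x -> orth_proj X y = x.
Proof.
move=> h; apply: projects_uniq (h); rewrite /orth_proj.
exact: (xgetI 0 (P := [set x | X x /\ forall w, X w -> minner w (y - x) = 0 :> M]) h).
Qed.
Lemma projects_lin c y x y' x' : projects y x -> projects y' x' ->
  projects (c *: y + y') (c *: x + x').
Proof.
move=> [Xx hx] [Xx' hx']; case: (hX) => _ XD _; split; first exact: XD.
move=> w Xw; rewrite (_ : _ - _ = c *: (y - x) + (y' - x')); last by lmodC.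
by rewrite minnerDr minnerZr hx // hx' // scaler0 addr0.
Qed.
Lemma projects_self x : X x -> projects x x.
Proof. by move=> Xx; split=> // w _; rewrite subrr minner0r. Qed.
Lemma projects_inner y x w : projects y x -> X w -> minner w x = minner w y :> M.
Proof. by move=> [_ h] /h; rewrite minnerBr => /eqP; rewrite subr_eq0 => /eqP. Qed.
Lemma projects_gram y x y' x' : projects y x -> projects y' x' ->
  minner (y - x) (y' - x') = minner y y' - minner x x' :> M.
Proof.
move=> [Xx hx] [Xx' hx']; rewrite minnerBl (hx' _ Xx) subr0 minnerBr; congr (_ - _).
by apply/eqP; rewrite -subr_eq0 -minnerBl -minnerC hx // astar0.
Qed.
Lemma projects_nrm y x : projects y x -> nrm x <= nrm y.
Proof.
move=> h; apply: nrm_le_minner; rewrite /mle -(projects_gram h h); exact: minner_mpos.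
Qed.
End Projection.

Lemma setting_impl (R : realType) (M : cstarType R) (s : setting M)
    (P Q : vnAlgebra M -> Prop) : (forall v, P v -> Q v) ->
  match s with CstarSetting => True | WstarSetting v => P v end ->
  match s with CstarSetting => True | WstarSetting v => Q v end.
Proof. by case: s => //= v; exact. Qed.

(** The approximants of [z] may leave [Y], where nothing is known of [f], so their projections take
    their place. These still approximate [z]: projecting does not increase norms, and the
    functionals that generate the sigma-topology of [Y] do not distinguish a vector from its
    projection. *)
Lemma continuous_orth_closure (R : realType) (M : cstarType R) (s : setting M)
    (F : hmodType M) (Y : set F) (H : hilbertType R) (f : F -> H -> H) h k c
    (A : set F) z :
  right_submodule Y ->
  (forall x y, Y x -> Y y -> nrm (f x h - f y h) <= c * nrm (x - y)) ->
  match s with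
  | CstarSetting => True
  | WstarSetting v => {within (Y : set (wtop (sigma_functional v Y))),
      continuous (f : wtop (sigma_functional v Y) -> wtop (@uw_functional R H))}
  end ->
  closure_in s A z -> Y z ->
  (forall a, A a -> exists2 p, projects Y a p & ip k (f p h) = 0) ->
  ip k (f z h) = 0.
Proof.
move=> sub hN; case: s => [_|v hf] hz Yz hA.
  have /closure_conv[u uA uz] := hz.
  have /choice[p hp] : forall n, exists p, projects Y (u n) p /\ ip k (f p h) = 0.
    by move=> n; have [p hp h0] := hA _ (uA n); exists p.
  apply: nrm_le0; apply: null_const; apply: null_le (nullM (nrm k * `|c|) (fun n => nrm_ge0 _) uz) _ => n.
  have [[Yp hpp] p0] := hp n.
  have -> : ip k (f z h) = - ip k (f (p n) h - f z h) by rewrite ipBr p0 sub0r opprK.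
  rewrite nrmN; apply: le_trans (ip_CS _ _) _; rewrite -mulrA ler_wpM2l ?nrm_ge0 //.
  apply: le_trans (hN _ _ Yp Yz) _.
  have hd : projects Y (u n - z) (p n - z).
    have := projects_lin sub (-1) (projects_self Yz) (hp n).1.
    by rewrite !scaleN1r ![- z + _]addrC.
  apply: (@le_trans _ _ (`|c| * nrm (p n - z))); first by rewrite ler_wpM2r ?nrm_ge0 // ler_norm.
  by rewrite ler_wpM2l // (projects_nrm hd).
apply: nrm_le0; apply/ler_addgt0Pr => t t0; rewrite add0r.
have h1 : (fun x => ip k (f x h)) @ within Y (nbhs (z : wtop (sigma_functional v Y))) --> ip k (f z h).
  have hz2 : f @ within Y (nbhs (z : wtop (sigma_functional v Y))) -->
    (f z : wtop (@uw_functional R H)) := (subspace_continuousP _ _).1 hf z Yz.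
  have hc : (fun S => ip k (S h)) @ nbhs (f z : wtop (@uw_functional R H)) --> ip k (f z h).
    exact: (wtop_continuous (uw_functional_single k h) (x := f z)).
  exact: (cvg_comp f (fun S => ip k (S h)) hz2 hc).
have : 0 < rc t by rewrite -rc0 rc_lt.
move/cvgrPdist_lt: h1 => h1 /h1 {}h1.
have [n [g [e [e0 Gg hB]]]] := (wtop_nbhsP (sigma_functional v Y) z _).1 h1.
have hz' : closure (A : set (wtop (sigma_functional v [set: F]))) z by exact: hz.
have GT i : sigma_functional v [set: F] (g i).
  have [w [eta [b [h2 h3 h4 h5]]]] := Gg i; exists w, eta, b; split=> // j.
  by have [] := h2 j.
have [u Au hu] := wtop_closure hz' e0 GT; have [p hp p0] := hA u Au.
have gE i : g i p = g i u.
  have [w [eta [b [h2 h3 h4 h5]]]] := Gg i.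
  apply: (conv_uniq ((cvgC _ _).1 (h5 p))); have := (cvgC _ _).1 (h5 u).
  congr (conv (series _) _); apply/funext => j; congr (w j _).
  by have [_ Ye] := h2 j; rewrite (projects_inner hp Ye).
have := hB p; rewrite /= => /(_ _ hp.1) hh.
have : `|ip k (f z h) - ip k (f p h)| < rc t.
  by apply: hh => i; rewrite gE; exact: hu.
by rewrite p0 subr0 nrmE rc_lt => /ltW.
Qed.

Section Fibers.
Variables (R : realType) (M : cstarType R) (s : setting M).
Variables (X : subproduct_system s).
Notation fib n := (@fiber _ _ _ X n).

Definition smul n m (x : pow X n) (y : pow X m) : pow X (n + m)%N :=
  orth_proj (fib (n + m)%N) (tmul x y).

Lemma tmul_inner n m (x x' : pow X n) (y y' : pow X m) :
  minner (tmul x y) (tmul x' y') = minner y (lact (minner x x' : M) y') :> M.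
Proof. by case: (tmul_tensor (powers X) n m) => ->. Qed.

Definition products n m : set (pow X (n + m)%N) :=
  [set z | exists x y, [/\ fib n x, fib m y & z = tmul x y]].

Lemma smul_projects n m (x : pow X n) (y : pow X m) : fib n x -> fib m y ->
  projects (fib (n + m)%N) (tmul x y) (smul x y).
Proof.
move=> Xx Xy; have [_ /(_ (tmul x y))[|p Xp hp]] := fiber_complementable X n m.
  by apply: subset_closure_in; apply: lin_span_sub; exists x, y.
have hpr : projects (fib (n + m)%N) (tmul x y) p by [].
by rewrite /smul (orth_proj_eq (fiber_submodule X _) hpr).
Qed.
Lemma fiber_smul n m (x : pow X n) (y : pow X m) : fib n x -> fib m y -> fib _ (smul x y).
Proof. by move=> Xx /(smul_projects Xx)[]. Qed.

Lemma fiber_closure n m z : fib (n + m)%N z ->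
  closure_in s (lin_span (@products n m)) z.
Proof. by case: (fiber_complementable X n m) => h _; exact: h. Qed.

Section Rep.
Variables (H : hilbertType R) (T : op_family X H).
Arguments T : clear implicits.
Hypothesis hT : ccc_rep T.

Lemma rep_smul n m x y h : fib n x -> fib m y -> T _ (smul x y) h = T n x (T m y h).
Proof. exact: ccc_mul. Qed.

Lemma nrm_rep_le n x h : fib n x -> nrm (T n x h) <= Num.sqrt 2 * nrm x * nrm h.
Proof.
move=> Xx; have := @rep_gram_bound _ _ _ _ _ _ hT n 'I_1 (fun=> x) (fun=> h) (fun=> Xx).
rewrite !big_ord1 => hh; apply: le_sqr; first by rewrite !mulr_ge0 ?nrm_ge0 ?sqrtr_ge0.
rewrite !exprMn sqr_sqrtr //; set z := ip h _ in hh.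
have zn : nrm z <= nrm x ^+ 2 * nrm h ^+ 2.
  apply: le_trans (ip_CS _ _) _; rewrite [_ ^+ 2 * _]mulrC [nrm h ^+ 2]expr2 -mulrA.
  rewrite ler_wpM2l ?nrm_ge0 //; apply: le_trans (nrm_rep (ccc_rep0 hT) _ _) _.
  by rewrite nrm_minner mulrC.
rewrite -mulrA; apply: (@le_trans _ _ (2 * nrm z)); last by rewrite ler_wpM2l.
have z0 : 0 <= rc 2 * z by apply: le_trans hh; rewrite -rc0 rc_le sqr_ge0.
rewrite -rc_le; apply: le_trans hh _; rewrite rcM -nrmE ger0_norm //.
by move: z0; rewrite pmulr_rge0 // -rc0 rc_lt.
Qed.

Lemma products_rep n m h k u :
  (forall x y, fib n x -> fib m y -> ip k (T n x (T m y h)) = 0) ->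
  lin_span (@products n m) u ->
  exists2 p, projects (fib (n + m)%N) u p & ip k (T _ p h) = 0.
Proof.
move=> hk; move: u; apply: lin_spanP.
  exists 0; first exact: projects_self (fiber_0 X _).
  by rewrite (rep_zero hT) ip0r.
move=> c _ u [x [y [Xx Xy ->]]] [p hp hp0].
exists (c *: smul x y + p); first exact: (projects_lin (fiber_submodule X _) c (smul_projects Xx Xy)).
rewrite (ccc_linear hT) ?ipDr ?ipZr ?hp0 ?rep_smul ?hk ?mulr0 ?addr0 //.
  exact: fiber_smul.
by case: hp.
Qed.

(** Combines density of products with the continuity of T_(n+m), in norm or from the sigma-topology;
    it is the way in which arguments about products reach a general [z]. *)
Lemma rep_products_orth n m h k :
  (forall x y, fib n x -> fib m y -> ip k (T n x (T m y h)) = 0) ->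
  forall z, fib (n + m)%N z -> ip k (T _ z h) = 0.
Proof.
move=> hk z Xz; have sub := fiber_submodule X (n + m)%N; have [_ XD _] := sub.
have hN x y : fib (n + m)%N x -> fib (n + m)%N y ->
    nrm (T _ x h - T _ y h) <= Num.sqrt 2 * nrm h * nrm (x - y).
  move=> Xx Xy; have -> : T _ x h - T _ y h = T _ (x - y) h.
    by rewrite [x - y]addrC -[- y]scaleN1r (ccc_linear hT) // scaleN1r addrC.
  by rewrite mulrAC; apply: nrm_rep_le; exact: submodule_sub.
apply: (continuous_orth_closure sub hN _ (fiber_closure Xz) Xz) => [|u hu].
  by refine (setting_impl _ (ccc_normal hT)) => v [_]; exact.
exact: products_rep hk hu.
Qed.
End Rep.
End Fibers.

(** * The shift and its inflations *)

Section AdjointableExtension.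
Variables (R : realType) (M : cstarType R).
Local Notation C := (cplx R).

Lemma bounded_of_nrm (V W : normedModType C) (f : V -> W) c : linear f ->
  (forall x, nrm (f x) <= c * nrm x) -> bounded_op f.
Proof.
move=> fl fc; apply/bounded_opP; split=> //; exists `|c| => // x.
by apply: le_trans (fc x) _; rewrite ler_wpM2r ?nrm_ge0 // ler_norm.
Qed.

Section Norm.
Variables (F : hmodType M) (Y : Type) (phi psi : Y -> F) (c : R).
Hypothesis dense : closure (lin_span (range phi)) = setT.
Hypothesis c0 : 0 <= c.
Hypothesis hc : forall l, nrm (comb psi l) <= c * nrm (comb phi l).
Hypothesis hadj : forall y0, exists u, forall y,
  minner u (phi y) = minner (phi y0) (psi y) :> M.

(** The adjoint is known on generators. Its bound [|u| <= c |z|] makes it converge along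
    approximations of an arbitrary [z] by combinations of generators. *)
Lemma norm_adjointable_extension :
  exists S : F -> F, adjointable S /\ forall y, S (phi y) = psi y.
Proof.
have [S [Sb Sc Sphi]] := dense_extension c0 hc dense.
have Sl := Sb.1.
have bl u : bounded_op (fun x : F => minner u (S x) : M) by exact: bounded_comp (minner_bounded u) Sb.
suff /choice[B hB] : forall z, exists u, forall x, minner u x = minner z (S x) :> M.
  exists S; split=> //; exists B => x y.
  by rewrite -minnerC -hB minnerC.
pose P z := exists u, forall x, minner u x = minner z (S x) :> M.
have Pbound z u : (forall x, minner u x = minner z (S x) :> M) -> nrm u <= c * nrm z.
  move=> hu; have [u0|/nrm_le0 ->] := ltP 0 (nrm u); last by rewrite nrm0 mulr_ge0 ?nrm_ge0.
  rewrite -(ler_pM2r u0) -expr2 -nrm_minner hu; apply: le_trans (minner_CS _ _) _.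
  by rewrite [c * _]mulrC -mulrA ler_wpM2l ?nrm_ge0.
have PS t z u z' u' : (forall x, minner u x = minner z (S x) :> M) ->
    (forall x, minner u' x = minner z' (S x) :> M) ->
    forall x, minner (t *: u + u') x = minner (t *: z + z') (S x) :> M.
  by move=> h h' x; rewrite !minnerDl !minnerZl h h'.
have Pspan z : lin_span (range phi) z -> P z.
  move: z; apply: lin_spanP; first by exists 0 => x; rewrite !minner0l.
  move=> t _ z [y0 _ <-] [u' hu']; have [u hu] := hadj y0.
  exists (t *: u + u'); apply: PS => // x.
  apply: (@eq_bounded_closure _ _ _ (minner u) (fun x => minner (phi y0) (S x)) (range phi)).
  - exact: minner_bounded.
  - exact: bl.
  - by move=> _ [y _ <-]; rewrite Sphi.
  - by rewrite dense.
move=> z; have /closure_seq[w wl hw] : closure (lin_span (range phi)) z by rewrite dense.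
have /choice[u hu] : forall n, exists u, forall x, minner u x = minner (w n) (S x) :> M.
  by move=> n; exact: Pspan.
have wz : conv w z by apply: null_le null_inv _ => n; exact/ltW/hw.
have ud n k : nrm (u (n + k)%N - u n) <= c * (2 * n.+1%:R^-1).
  have h := PS (-1) _ _ _ _ (hu n) (hu (n + k)%N).
  have := Pbound _ _ h; rewrite !scaleN1r addrC => /le_trans; apply.
  rewrite ler_wpM2l // addrC; apply: le_trans (nrmT z _ _) _.
  rewrite mulrDl mul1r; apply: lerD; last by rewrite nrmBC; exact/ltW/hw.
  by apply: le_trans (ltW (hw _)) _; rewrite lef_pV2 ?posrE // ler_nat ltnS leq_addr.
have n0 : null (fun n => c * (2 * n.+1%:R^-1 : R)).
  by apply: nullM => [n|]; [rewrite mulr_ge0 // invr_ge0|apply: nullM null_inv => n; rewrite invr_ge0].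
have [v uv _] := cauchy_conv n0 ud.
have lim (p : nat -> F) q x : conv p q -> conv (fun n => minner (p n) x : M) (minner q x).
  move=> hp; apply: null_le (nullM (nrm x) (fun n => nrm_ge0 _) hp) _ => n.
  by rewrite -minnerBl mulrC; exact: minner_CS.
exists v => x; apply: conv_uniq (lim _ _ x uv) _.
by have := lim _ _ (S x) wz; congr conv; apply/funext => n; rewrite hu.
Qed.
End Norm.

Section Weak.
Variables (v : vnAlgebra M) (F : hmodType M) (Y : Type) (phi psi : Y -> F).
Hypothesis sd : self_dual F.
Hypothesis dense : closure_in (WstarSetting v) (lin_span (range phi)) = setT.

Local Notation pi := (vn_rep (v := v)).
Variable G : htensor (setT : set F) (setT : set (vn_space v)) pi.
Notation t := (htensor_map G).
Variable Sh : G -> G.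
Hypotheses (Shb : bounded_op Sh) (Sphi : forall y xi, Sh (t (phi y) xi) = t (psi y) xi).

(* [b] is the matrix coefficient [L_z^* Sh L_zeta], where [L_z xi = z (x) xi]; it
   commutes with the commutant of M, first for [zeta] in the range of [phi]. *)
Lemma weak_coefficient z zeta : exists b : M, forall xi eta,
  ip (t z xi) (Sh (t zeta eta)) = ip xi (pi b eta).
Proof.
have hp := vn_repP v.
have tb x : bounded_op (fun xi => t x xi).
  apply: (@bounded_of_nrm _ _ _ (nrm x)); last by move=> xi; exact: (nrm_htensor G hp).
  by move=> c h k; exact: (htensor_linr G hp (linear_subspaceT _)).
pose B eta := adj (t z) (Sh (t zeta eta)).
have BE xi eta : ip xi (B eta) = ip (t z xi) (Sh (t zeta eta)) by rewrite -(adjP (tb z)).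
have Bb : bounded_op B by apply: bounded_comp (adj_bounded (tb z)) (bounded_comp Shb (tb zeta)).
have [S' Sb hS eta|b hb] := vn_bicommutant Bb; last by exists b => xi eta; rewrite -BE hb.
apply: ip_ext => xi; rewrite BE (adjPr Sb) BE !(adjPr Shb).
have hz : closure_in (WstarSetting v) (lin_span (range phi)) zeta by rewrite dense.
apply: (closure_in_tensor hp (s := WstarSetting v) _ _ _ hz) => //.
  exact: vn_rep_normal.
apply: (@eq_lin_span R F C^o (fun a => ip (adj Sh (t z xi)) (t a (S' eta)))
  (fun a => ip (adj Sh (t z (adj S' xi))) (t a eta)) (range phi)) => [c x y|c x y|_ [y _ <-]].
- by rewrite (htensor_linl G hp (right_submoduleT F)) // ipDr ipZr.
- by rewrite (htensor_linl G hp (right_submoduleT F)) // ipDr ipZr.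
- by rewrite -!(adjPr Shb) !Sphi !htensor_ip // -hS (adjPr Sb).
Qed.

(** The coefficients [b (z, zeta)] form a bounded M-valued form. Self-duality in the second argument
    yields the adjoint [B], and self-duality in the first, after taking stars, yields [S].
    Boundedness of [b] needs that the representation of M is isometric. *)
Lemma weak_adjointable_extension :
  exists S : F -> F, adjointable S /\ forall y, S (phi y) = psi y.
Proof.
have hp := vn_repP v.
have /choice[b hb] : forall p : F * F, exists b : M, forall xi eta,
    ip (t p.1 xi) (Sh (t p.2 eta)) = ip xi (pi b eta).
  by move=> p; exact: weak_coefficient.
have uniq (a a' : M) : (forall xi eta, ip xi (pi a eta) = ip xi (pi a' eta)) -> a = a'.
  move=> h; apply: (@vn_inj _ _ v); apply/funext => eta; apply: ip_ext => xi; exact: h.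
have [Shl [c c0 Shc]] := (bounded_opP _).1 Shb.
have tl x y xi r : t (r *: x + y) xi = r *: t x xi + t y xi.
  exact: (htensor_linl G hp (right_submoduleT F)).
have tm x a xi : t (ract x a) xi = t x (pi a xi).
  exact: (htensor_ract G hp (right_submoduleT F)).
have bn z zeta : nrm (b (z, zeta)) <= c * nrm z * nrm zeta.
  apply: (@vn_rep_isometric _ _ v); first by rewrite !mulr_ge0 ?nrm_ge0.
  move=> eta; set w := pi _ eta.
  have [w0|/nrm_le0 ->] := ltP 0 (nrm w); last by rewrite nrm0 !mulr_ge0 ?nrm_ge0.
  rewrite -(ler_pM2l w0); have -> : nrm w * nrm w = nrm (ip w w).
    by rewrite ipxx nrm_rc_ge0 ?sqr_ge0.
  rewrite {2}/w -(hb (z, zeta)); apply: le_trans (ip_CS _ _) _.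
  apply: (@le_trans _ _ ((nrm z * nrm w) * (c * (nrm zeta * nrm eta)))).
    apply: ler_pM; rewrite ?nrm_ge0 //; first exact: (nrm_htensor G hp).
    apply: le_trans (Shc _) _; rewrite ler_wpM2l //; exact: (nrm_htensor G hp).
  by rewrite le_eqVlt; apply/orP; left; apply/eqP; ring.
have bl z : linear (fun zeta => b (z, zeta)).
  move=> r x y; apply: uniq => xi eta; rewrite -hb /= tl Shl ipDr ipZr.
  by rewrite (rep_linl hp) ipDr ipZr -!hb.
have /choice[B hB] : forall z, exists y, forall zeta, b (z, zeta) = minner y zeta.
  move=> z; apply: sd; first exact: bl.
    by have [] := bounded_of_nrm (bl z) (bn z).
  by move=> zeta a; apply: uniq => xi eta; rewrite -hb /= tm (repM hp) -hb.
have bl' zeta : linear (fun z => astar (b (z, zeta))).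
  move=> r x y; have -> : b (r *: x + y, zeta) = r^* *: b (x, zeta) + b (y, zeta).
    apply: uniq => xi eta; rewrite -hb /= tl ipDl ipZl.
    by rewrite (rep_linl hp) ipDr ipZr -!hb.
  by rewrite astarD astarZ conjCK.
have bn' zeta z : nrm (astar (b (z, zeta))) <= c * nrm zeta * nrm z.
  by rewrite nrm_astar mulrAC.
have /choice[S hS] : forall zeta, exists u, forall z, astar (b (z, zeta)) = minner u z.
  move=> zeta; apply: sd; first exact: bl'.
    by have [] := bounded_of_nrm (bl' zeta) (bn' zeta).
  move=> z a; have -> : b (ract z a, zeta) = astar a ** b (z, zeta).
    by apply: uniq => xi eta; rewrite -hb /= tm (repM hp) -(rep_adj hp) -hb.
  by rewrite astarM astarK.
exists S; split.
  by exists B => zeta z; rewrite -hS hB minnerC.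
move=> y; apply: minner_ext => z; rewrite -[minner z (S _)]minnerC -hS astarK.
by apply: uniq => xi eta; rewrite -hb /= Sphi htensor_ip.
Qed.
End Weak.

(** Each setting has its own criterion. Containment of [closure_in] in the norm closure marks the
    C*-setting without a case distinction, so adjoints on generators are asked for under that
    premise. *)
Lemma adjointable_extension (s : setting M) (F : corrType M) (Y : Type) (phi psi : Y -> F) c :
  corr_in s F -> closure_in s (lin_span (range phi)) = setT -> 0 <= c ->
  (forall l, nrm (comb psi l) <= c * nrm (comb phi l)) ->
  ((forall (G : hmodType M) (A : set G) z, closure_in s A z -> closure A z) ->
    forall y0, exists u, forall y, minner u (phi y) = minner (phi y0) (psi y) :> M) ->
  (forall (H : hilbertType R) (sigma : M -> H -> H), representation sigma ->
    forall G : htensor (setT : set F) (setT : set H) sigma,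
    exists2 A : G -> G, bounded_op A &
      forall y xi, A (htensor_map G (phi y) xi) = htensor_map G (psi y) xi) ->
  exists S : F -> F, adjointable S /\ forall y, S (phi y) = psi y.
Proof.
case: s => [_|v [sd _]] hd c0 hc hadj hG.
  by apply: (norm_adjointable_extension hd c0 hc); exact: hadj.
have [G] := htensor_exists (X := (setT : set F)) (D := setT) (vn_repP v) I I.
have [A Ab hA] := hG _ _ (vn_repP v) G.
have := weak_adjointable_extension sd hd Ab hA. exact.
Qed.
End AdjointableExtension.

Section Shift.
Variables (R : realType) (M : cstarType R) (s : setting M).
Local Notation C := (cplx R).
Variables (X : subproduct_system s) (F : fock_module X).
Notation fib n := (@fiber _ _ _ X n).
Notation inc := (fock_inc F).

(** Families indexed by all of [pow X n] need a value outside the fibre; 0 contributes nothing to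
    spans. *)
Definition in_fiber n (y : pow X n) : pow X n := if pselect (fib n y) then y else 0.
Lemma in_fiberP n (y : pow X n) : fib n (in_fiber y).
Proof. by rewrite /in_fiber; case: (pselect (fib n y)) => [//|_] /=; exact: fiber_0. Qed.
Lemma in_fiberE n (y : pow X n) : fib n y -> in_fiber y = y.
Proof. by rewrite /in_fiber; case: pselect. Qed.

Notation elt := {m : nat & pow X m}.
Definition elt_inc (u : elt) : F := inc (in_fiber (tagged u)).

Lemma fock_dense_elt : closure_in s (lin_span (range elt_inc)) = setT.
Proof.
rewrite -(fock_dense F); congr (closure_in s (lin_span _)); apply/seteqP; split=> z.
  by move=> [[n y] _ <-]; exists n, (in_fiber y); split=> //; exact: in_fiberP.
by move=> [n [y [Xy ->]]]; exists (Tagged (pow X) y) => //; rewrite /elt_inc /= in_fiberE.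
Qed.

(** Transported along the equality of degrees. It lets sums over degrees run over a fixed range,
    with one family of vectors per degree. *)
Definition component N (u : elt) : pow X N :=
  if tag u =P N is ReflectT e then eq_rect _ (fun m => pow X m : Type) (in_fiber (tagged u)) _ e else 0.

Lemma component_same m (y : pow X m) : component m (Tagged (pow X) y) = in_fiber y.
Proof. by rewrite /component; case: eqP => //= e; rewrite (eq_irrelevance e erefl). Qed.
Lemma component_diff m N (y : pow X m) : m != N -> component N (Tagged (pow X) y) = 0.
Proof. by rewrite /component; case: eqP => //= e /eqP. Qed.
Lemma component_fiber N u : fib N (component N u).
Proof.
by rewrite /component; case: eqP => [e|_]; [case: N / e; exact: in_fiberP|exact: fiber_0].
Qed.

Variables (n : nat) (x : pow X n).
Hypothesis Xx : fib n x.

Definition elt_shift (u : elt) : F := inc (smul x (in_fiber (tagged u))).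

Lemma smul0 m : smul x (0 : pow X m) = 0.
Proof.
apply: (projects_uniq (fiber_submodule X _) (smul_projects Xx (fiber_0 X m))).
have -> : tmul x (0 : pow X m) = 0.
  by apply: minner_eq0; rewrite tmul_inner minner0l.
exact: projects_self (fiber_0 X _).
Qed.

Lemma elt_inc_inner m (y : pow X m) u :
  minner (elt_inc (Tagged (pow X) y)) (elt_inc u) = minner (in_fiber y) (component m u) :> M.
Proof.
case: u => m' y'; rewrite /elt_inc /=; have [e|ne] := eqVneq m' m.
  by case: m / e y => y; rewrite component_same fock_inc_inner //; exact: in_fiberP.
rewrite component_diff // minner0r fock_inc_orth //; try exact: in_fiberP.
by apply/eqP; rewrite eq_sym.
Qed.
Lemma elt_shift_inner m (y : pow X m) u :
  minner (elt_shift (Tagged (pow X) y)) (elt_shift u) =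
  minner (smul x (in_fiber y)) (smul x (component m u)) :> M.
Proof.
case: u => m' y'; rewrite /elt_shift /=; have [e|ne] := eqVneq m' m.
  case: m / e y => y; rewrite component_same fock_inc_inner //;
    by apply: fiber_smul => //; exact: in_fiberP.
rewrite component_diff // smul0 minner0r fock_inc_orth //;
  try by apply: fiber_smul => //; exact: in_fiberP.
by move/addnI => e; rewrite e eqxx in ne.
Qed.

Lemma nrm_tmul m (y : pow X m) : nrm (tmul x y) <= nrm x * nrm y.
Proof.
apply: le_sqr; first by rewrite mulr_ge0 ?nrm_ge0.
rewrite -nrm_minner tmul_inner; apply: le_trans (minner_CS _ _) _.
apply: (@le_trans _ _ (nrm y * (nrm x ^+ 2 * nrm y))).
  by rewrite ler_wpM2l ?nrm_ge0 // -nrm_minner; exact: nrm_lact.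
by rewrite le_eqVlt; apply/orP; left; apply/eqP; ring.
Qed.

(* With [<x, x> = |x|^2 (2 g - g^2)]. *)
Lemma shift_gram : exists g : M, forall B (u u' : elt), (tag u < B)%N ->
  rc (nrm x ^+ 2) *: minner (elt_inc u) (elt_inc u') -
    minner (elt_shift u) (elt_shift u') =
  \sum_(N < B)
    (rc (nrm x ^+ 2) *: minner (component N u - lact g (component N u))
                               (component N u' - lact g (component N u')) +
     minner (tmul x (component N u) - smul x (component N u))
            (tmul x (component N u') - smul x (component N u'))) :> M.
Proof.
have [g gs hg] : exists2 g : M, astar g = g & minner x x = rc (nrm x ^+ 2) *: (rc 2 *: g - g ** g).
  have [x0|/nrm_le0 x0] := ltP 0 (nrm x); last first.
    by exists 0; rewrite ?astar0 // x0 nrm0 expr0n rc0 scale0r minner0l.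
  have K0 : 0 < nrm x ^+ 2 by rewrite exprn_gt0.
  have Ki : 0 <= (nrm x ^+ 2)^-1 by rewrite invr_ge0 ltW.
  have [||g gs hg] := @star_mul_sqrt R M (rc (nrm x ^+ 2)^-1 *: minner x x).
  - by rewrite astarZ rc_conj minnerC.
  - by rewrite (nrmZr _ Ki) nrm_minner mulVf // gt_eqF.
  by exists g => //; rewrite -hg scalerA -rcM mulfV ?gt_eqF // rc1 scale1r.
exists g => B [m y] u' mB; rewrite elt_inc_inner elt_shift_inner.
(* Here [<x (x) z, x (x) z'> = <z, <x, x> z'>], and [1 - (2 g - g^2)] is the square of [1 - g]; what
   projecting onto the fibre removes is the second Gram term. *)
have key N (z z' : pow X N) : fib N z -> fib N z' ->
    rc (nrm x ^+ 2) *: minner z z' - minner (smul x z) (smul x z') =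
    rc (nrm x ^+ 2) *: minner (z - lact g z) (z' - lact g z') +
    minner (tmul x z - smul x z) (tmul x z' - smul x z') :> M.
  move=> Xz Xz'; rewrite (projects_gram (smul_projects Xx Xz) (smul_projects Xx Xz')).
  rewrite tmul_inner hg lactZ (linB (lact_linl z')) lactZ lactM !minnerZr [minner z (_ - _)]minnerBr minnerZr.
  rewrite minnerBl !minnerBr !(lact_adj g) gs rc_nat.
  set p := minner z z'; set q := minner z (lact g z'); set r := minner z (lact g _).
  by lmodC.
rewrite key; [|exact: in_fiberP|exact: component_fiber].
rewrite (bigD1 (Ordinal mB)) //= component_same big1 ?addr0 // => i /eqP ne.
have ne' : m != i by apply/eqP => e; apply: ne; apply: val_inj; exact: esym e.
rewrite component_diff // smul0 (lin0 (lact_linear g)) subrr minner0l scaler0 add0r.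
have -> : tmul x (0 : pow X i) = 0 by apply: minner_eq0; rewrite tmul_inner minner0l.
by rewrite subrr minner0l.
Qed.

Lemma tag_bound k (u : 'I_k -> elt) : exists B, forall i, (tag (u i) < B)%N.
Proof. by exists (\max_i tag (u i)).+1 => i; rewrite ltnS (leq_bigmax i). Qed.

(** By [shift_gram], the difference of the two module squares is a sum over degrees of elements
    [<v, v>]. *)
Lemma nrm_comb_shift (l : seq (C * elt)) :
  nrm (comb elt_shift l) <= nrm x * nrm (comb elt_inc l).
Proof.
pose p (i : 'I_(size l)) := nth (0, Tagged (pow X) (0 : pow X 0%N)) l i.
have [B hB] := tag_bound (fun i => (p i).2); have [g hg] := shift_gram.
have cE (V : lmodType C) (f : elt -> V) : comb f l = \sum_i (p i).1 *: f (p i).2.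
  by rewrite /comb (big_nth (0, Tagged (pow X) (0 : pow X 0%N))) big_mkord.
have mE (E : hmodType M) (f : elt -> E) :
    minner (\sum_i (p i).1 *: f (p i).2) (\sum_i (p i).1 *: f (p i).2) =
    \sum_i \sum_j ((p i).1^* * (p j).1) *: minner (f (p i).2) (f (p j).2) :> M.
  rewrite minner_suml; apply: eq_bigr => i _; rewrite minner_sumr.
  by apply: eq_bigr => j _; rewrite minnerZl minnerZr scalerA.
apply: le_sqr; first by rewrite mulr_ge0 ?nrm_ge0.
rewrite exprMn -[nrm (comb elt_shift l) ^+ 2]nrm_minner -[nrm (comb elt_inc l) ^+ 2]nrm_minner.
rewrite -(nrmZr _ (sqr_ge0 (nrm x))); apply: mle_nrm; first exact: minner_mpos.
rewrite /mle !cE !mE.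
have -> : rc (nrm x ^+ 2) *: (\sum_i \sum_j ((p i).1^* * (p j).1) *:
      minner (elt_inc (p i).2) (elt_inc (p j).2)) -
    \sum_i \sum_j ((p i).1^* * (p j).1) *: minner (elt_shift (p i).2) (elt_shift (p j).2) =
    \sum_(N < B) (rc (nrm x ^+ 2) *:
      minner (\sum_i (p i).1 *: (component N (p i).2 - lact g (component N (p i).2)))
             (\sum_i (p i).1 *: (component N (p i).2 - lact g (component N (p i).2))) +
      minner (\sum_i (p i).1 *: (tmul x (component N (p i).2) - smul x (component N (p i).2)))
             (\sum_i (p i).1 *: (tmul x (component N (p i).2) - smul x (component N (p i).2)))) :> M.
  transitivity (\sum_i \sum_j ((p i).1^* * (p j).1) *:
    (rc (nrm x ^+ 2) *: minner (elt_inc (p i).2) (elt_inc (p j).2) -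
     minner (elt_shift (p i).2) (elt_shift (p j).2)) : M).
    rewrite scaler_sumr -sumrB; apply: eq_bigr => i _; rewrite scaler_sumr -sumrB.
    by apply: eq_bigr => j _; rewrite scalerBr !scalerA [_ * rc _]mulrC.
  under eq_bigr => i _ do under eq_bigr => j _ do rewrite (hg B) // scaler_sumr.
  under eq_bigr => i _ do rewrite exchange_big /=.
  rewrite exchange_big /=; apply: eq_bigr => N _.
  rewrite (mE _ (fun u => component N u - lact g (component N u))).
  rewrite (mE _ (fun u => tmul x (component N u) - smul x (component N u))).
  rewrite scaler_sumr -big_split; apply: eq_bigr => i _ /=.
  rewrite scaler_sumr -big_split; apply: eq_bigr => j _ /=.
  by rewrite scalerDr !scalerA [_ * rc _]mulrC.
apply: mpos_sum => N _; apply: mposD; last exact: minner_mpos.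
by apply: mposZ; [exact: sqr_ge0|exact: minner_mpos].
Qed.

(** The estimate of [nrm_comb_shift] after applying [sigma]; positivity in each degree is now
    supplied by [gram_ge0]. *)
Lemma tensor_shift (H : hilbertType R) (sigma : M -> H -> H) (D : set H)
    (K : htensor (setT : set F) D sigma) :
  representation sigma -> D 0 ->
  exists2 A : K -> K, bounded_op A & forall u d, D d ->
    A (htensor_map K (elt_inc u) d) = htensor_map K (elt_shift u) d.
Proof.
move=> hs D0; have [g hg] := shift_gram.
pose dh d := if pselect (D d) then d else 0.
have Dd d : D (dh d) by rewrite /dh; case: pselect.
have dhE d : D d -> dh d = d by rewrite /dh; case: pselect.
have [|A [Ab _ AE]] := @hilbert_extension R (elt * H) K K
   (fun q => htensor_map K (elt_inc q.1) (dh q.2))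
   (fun q => htensor_map K (elt_shift q.1) (dh q.2)) (nrm x) (nrm_ge0 x); last first.
  by exists A => // u d Dd1; have := AE (u, d); rewrite /= dhE.
move=> l; pose p (i : 'I_(size l)) := nth (0, (Tagged (pow X) (0 : pow X 0%N), 0)) l i.
have [B hB] := tag_bound (fun i => (p i).2.1).
pose h i := (p i).1 *: dh (p i).2.2.
apply: le_sqr; first by rewrite mulr_ge0 ?nrm_ge0.
rewrite exprMn -rc_le [rc (nrm x ^+ 2 * _)]rcM.
rewrite -[rc (nrm (comb _ l) ^+ 2)]ipxx -[rc (nrm (comb (fun q => htensor_map K (elt_inc _) _) l) ^+ 2)]ipxx.
rewrite !ip_comb -subr_ge0.
have -> : rc (nrm x ^+ 2) * (\sum_(p <- l) \sum_(q <- l) p.1^* * q.1 *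
     ip (htensor_map K (elt_inc p.2.1) (dh p.2.2)) (htensor_map K (elt_inc q.2.1) (dh q.2.2))) -
   \sum_(p <- l) \sum_(q <- l) p.1^* * q.1 *
     ip (htensor_map K (elt_shift p.2.1) (dh p.2.2)) (htensor_map K (elt_shift q.2.1) (dh q.2.2)) =
   \sum_i \sum_j ip (h i) (sigma
     (rc (nrm x ^+ 2) *: minner (elt_inc (p i).2.1) (elt_inc (p j).2.1) -
      minner (elt_shift (p i).2.1) (elt_shift (p j).2.1)) (h j)).
  rewrite !(big_nth (0, (Tagged (pow X) (0 : pow X 0%N), 0))) !big_mkord mulr_sumr -sumrB.
  apply: eq_bigr => i _; rewrite !(big_nth (0, (Tagged (pow X) (0 : pow X 0%N), 0))) !big_mkord mulr_sumr -sumrB.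
  apply: eq_bigr => j _; rewrite !htensor_ip // /h (linZ (rep_linr hs _)) ipZl ipZr.
  rewrite (linB (rep_linl hs _)) (linZ (rep_linl hs _)) ipBr ipZr; ring.
under eq_bigr => i _ do under eq_bigr => j _ do
  rewrite (hg B) // (lin_sum (rep_linl hs _)) ip_sumr.
under eq_bigr => i _ do rewrite exchange_big /=.
rewrite exchange_big /=; apply: sumr_ge0 => N _.
have -> : \sum_i \sum_j ip (h i) (sigma (rc (nrm x ^+ 2) *:
      minner (component N (p i).2.1 - lact g (component N (p i).2.1))
             (component N (p j).2.1 - lact g (component N (p j).2.1)) +
      minner (tmul x (component N (p i).2.1) - smul x (component N (p i).2.1))
             (tmul x (component N (p j).2.1) - smul x (component N (p j).2.1))) (h j)) =
   rc (nrm x ^+ 2) * (\sum_i \sum_j ip (h i) (sigma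
      (minner (component N (p i).2.1 - lact g (component N (p i).2.1))
             (component N (p j).2.1 - lact g (component N (p j).2.1))) (h j))) +
   \sum_i \sum_j ip (h i) (sigma
      (minner (tmul x (component N (p i).2.1) - smul x (component N (p i).2.1))
             (tmul x (component N (p j).2.1) - smul x (component N (p j).2.1))) (h j)).
  rewrite mulr_sumr -big_split; apply: eq_bigr => i _ /=.
  rewrite mulr_sumr -big_split; apply: eq_bigr => j _ /=.
  by rewrite (rep_linl hs) ipDr ipZr.
apply: addr_ge0; last exact: (gram_ge0 (fun i => tmul x (component N (p i).2.1) - _)).
apply: mulr_ge0; first by rewrite -rc0 rc_le sqr_ge0.
exact: (gram_ge0 (fun i => component N (p i).2.1 - _)).
Qed.
End Shift.

Section ShiftExistence.
Variables (R : realType) (M : cstarType R) (s : setting M).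
Local Notation C := (cplx R).
Variables (X : subproduct_system s) (F : fock_module X).
Notation fib n := (@fiber _ _ _ X n).
Notation inc := (fock_inc F).
Notation elt := {m : nat & pow X m}.
Notation fshift := (@Defs.shift _ _ _ _ F _).

Lemma fock_inc_lin n c (x y : pow X n) : fib n x -> fib n y ->
  inc (c *: x + y) = c *: inc x + inc y.
Proof.
move=> Xx Xy; have [X0 XD _] := fiber_submodule X n; have Xc := XD c _ _ Xx Xy.
pose z := inc (c *: x + y) - (c *: inc x + inc y).
have h a : fib n a -> minner (inc a) z = 0 :> M.
  move=> Xa; rewrite /z minnerBr minnerDr minnerZr !fock_inc_inner //.
  by rewrite minnerDr minnerZr subrr.
apply/eqP; rewrite -subr_eq0; apply/eqP/minner_eq0.
by rewrite -/z {1}/z minnerBl minnerDl minnerZl !h // scaler0 addr0 subrr.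
Qed.
Lemma nrm_fock_inc n (x : pow X n) : fib n x -> nrm (inc x) = nrm x.
Proof.
move=> Xx; apply/eqP; rewrite -(@eqrXn2 _ 2) ?nrm_ge0 //; apply/eqP.
by rewrite -!nrm_minner fock_inc_inner.
Qed.
Lemma fock_incB n (x y : pow X n) : fib n x -> fib n y -> inc (x - y) = inc x - inc y.
Proof.
by move=> Xx Xy; rewrite addrC -scaleN1r fock_inc_lin // scaleN1r addrC.
Qed.

Variables (n : nat) (x : pow X n).
Hypothesis Xx : fib n x.

(** On [x' (x) y'] the adjoint of [y |-> x (x) y] is [<x, x'> y']. *)
Lemma products_adjoint m w : lin_span (@products _ _ _ X n m) w ->
  exists2 u, fib m u & forall y, fib m y -> minner u y = minner w (tmul x y) :> M.
Proof.
have [X0 XD _] := fiber_submodule X m.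
move: w; apply: lin_spanP; first by exists 0 => // y _; rewrite !minner0l.
move=> c _ w [x' [y' [Xx' Xy' ->]]] [u Xu hu].
have Xl := fiber_lact (minner x x') Xy'.
exists (c *: lact (minner x x') y' + u); first exact: XD.
move=> y Xy; rewrite !minnerDl !minnerZl hu //; congr (_ *: _ + _).
by rewrite tmul_inner lact_adj minnerC.
Qed.

(** In degree [N < n] the adjoint vanishes; for [N = n + m] it is a limit of the vectors from
    [products_adjoint]. The limit is taken in the Fock module, so closedness of the fibre need not
    be shown. *)
Lemma shift_adjoint_generators :
  (forall (G : hmodType M) (A : set G) z, closure_in s A z -> closure A z) ->
  forall y0 : elt, exists u : F, forall y : elt,
    minner u (elt_inc F y) = minner (elt_inc F y0) (elt_shift F x y) :> M.
Proof.
move=> hs [N w0]; rewrite /elt_inc /=; have := in_fiberP w0; set w := in_fiber w0.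
clearbody w; clear w0 => Xw; have [nN|Nn] := leqP n N; last first.
  exists 0 => -[m y] /=; rewrite minner0l fock_inc_orth //; first last.
    by apply: fiber_smul => //; exact: in_fiberP.
  by move=> e; move: Nn; rewrite e ltnNge leq_addr.
have [m Nm] : exists m, N = (n + m)%N by exists (N - n)%N; rewrite subnKC.
subst N; have /closure_seq[p pl hp] := hs _ _ _ (fiber_closure Xw).
have /choice[u hu] : forall j, exists u, fib m u /\
    forall y, fib m y -> minner u y = minner (p j) (tmul x y) :> M.
  by move=> j; have [u Xu h] := products_adjoint (pl j); exists u.
have un j k : nrm (u j - u k) <= nrm x * nrm (p j - p k).
  have Xd : fib m (u j - u k) := submodule_sub (fiber_submodule X m) (hu j).1 (hu k).1.
  have [u0|/nrm_le0 ->] := ltP 0 (nrm (u j - u k)); last by rewrite nrm0 mulr_ge0 ?nrm_ge0.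
  rewrite -(ler_pM2r u0) -expr2 -nrm_minner {1}minnerBl.
  rewrite (hu j).2 // (hu k).2 // -minnerBl; apply: le_trans (minner_CS _ _) _.
  rewrite [nrm x * _]mulrC -mulrA ler_wpM2l ?nrm_ge0 //; exact: nrm_tmul.
have pw : conv p w by apply: null_le null_inv _ => j; exact/ltW/hp.
have ud j k : nrm (inc (u (j + k)%N) - inc (u j)) <= nrm x * (2 * j.+1%:R^-1).
  have Xj := (hu j).1; have Xk := (hu (j + k)%N).1.
  have Xd : fib m (u (j + k)%N - u j) := submodule_sub (fiber_submodule X m) Xk Xj.
  rewrite -fock_incB // nrm_fock_inc //.
  apply: le_trans (un _ _) _; rewrite ler_wpM2l ?nrm_ge0 //.
  apply: le_trans (nrmT w _ _) _; rewrite mulrDl mul1r; apply: lerD.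
    by apply: le_trans (ltW (hp _)) _; rewrite lef_pV2 ?posrE // ler_nat ltnS leq_addr.
  by rewrite nrmBC; exact/ltW/hp.
have n0 : null (fun j => nrm x * (2 * j.+1%:R^-1 : R)).
  by apply: nullM => [j|]; [rewrite mulr_ge0 // invr_ge0|apply: nullM null_inv => j; rewrite invr_ge0].
have [U uU _] := cauchy_conv n0 ud.
have lim (E : hmodType M) (q : nat -> E) r y : conv q r -> conv (fun j => minner (q j) y : M) (minner r y).
  move=> hq; apply: null_le (nullM (nrm y) (fun j => nrm_ge0 _) hq) _ => j.
  by rewrite -minnerBl mulrC; exact: minner_CS.
exists U => -[k y] /=; apply: conv_uniq (lim _ _ _ _ uU) _.
rewrite /elt_shift /=; have Xy := in_fiberP y; move: (in_fiber y) Xy => {}y Xy.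
have [e|ne] := eqVneq k m.
  move: y Xy; rewrite e => y Xy.
  rewrite fock_inc_inner //; last exact: fiber_smul.
  rewrite (projects_inner (smul_projects Xx Xy) Xw).
  have := lim _ _ _ (tmul x y) pw; congr conv; apply/funext => j.
  by rewrite fock_inc_inner ?(hu j).2 //; case: (hu j).
have -> : minner (inc w) (inc (smul x y)) = 0 :> M.
  by apply: fock_inc_orth => //; [move/addnI => e; rewrite e eqxx in ne|exact: fiber_smul].
have := conv_cst (0 : M); congr conv; apply/funext => j.
rewrite fock_inc_orth //; last by case: (hu j).
by move=> e; rewrite e eqxx in ne.
Qed.

Lemma shift_spec : adjointable (fshift x) /\
  forall m (y : pow X m), fib m y -> fshift x (inc y) = inc (smul x y).
Proof.
have [|H sigma hs G|S [Sa Sinc]] := @adjointable_extension R M s F elt (elt_inc F) (elt_shift F x) (nrm x)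
   (fock_corr F) (fock_dense_elt F) (nrm_ge0 x) (nrm_comb_shift F Xx).
- exact: shift_adjoint_generators.
- have [A Ab hA] := tensor_shift Xx G hs (I : setT 0).
  by exists A => // y xi; exact: hA.
apply: (@xgetPex _ (fun=> 0) [set S : F -> F | adjointable S /\
    forall m (y : pow X m), fib m y -> S (inc y) = inc (smul x y)]).
exists S; split=> // m y Xy; have := Sinc (Tagged (pow X) y).
by rewrite /elt_inc /elt_shift /= in_fiberE.
Qed.

Section Induced.
Variables (H : hilbertType R) (sigma : M -> H -> H) (D : set H).
Variable K : htensor (setT : set F) D sigma.
Hypotheses (hs : representation sigma) (D0 : D 0).
Hypothesis hn : normal_in s sigma.

Lemma fock_tensor_dense (k : K) :
  (forall m (y : pow X m) d, fib m y -> D d -> ip k (htensor_map K (inc y) d) = 0) -> k = 0.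
Proof.
move=> h; apply: (htensor_ext (G := K)) => z d _ Dd; rewrite ip0r -ipC.
suff -> : ip k (htensor_map K z d) = ip 0 (htensor_map K z d) by rewrite ip0l conjC0.
apply: (closure_in_tensor hs hn Dd Dd (A := lin_span (range (elt_inc F)))).
  by rewrite fock_dense_elt.
have tl (q : K) : linear (fun z => ip q (htensor_map K z d) : C^o).
  by move=> c y y'; rewrite (htensor_linl K hs (right_submoduleT F)) // ipDr ipZr.
apply: (@eq_lin_span R F C^o _ _ (range (elt_inc F)) (tl k) (tl 0)).
by move=> _ [[m y] _ <-]; rewrite ip0l h //; exact: in_fiberP.
Qed.

(** [tensor_shift] fixes the operator on generators only. The formula for all [z] is reached through
    the adjoint: there it can be tested against generators by [fock_tensor_dense], and it is then
    transferred back. *)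
Lemma induced_spec : bounded_op (induced_op (K := K) (fshift x)) /\
  forall z d, D d -> induced_op (K := K) (fshift x) (htensor_map K z d) = htensor_map K (fshift x z) d.
Proof.
apply: (@xgetPex _ (fun=> 0) [set A : K -> K | bounded_op A /\
    forall z d, D d -> A (htensor_map K z d) = htensor_map K (fshift x z) d]).
have [A Ab hA] := tensor_shift Xx K hs D0; have [[B hB] Sinc] := shift_spec.
exists A; split=> // z d Dd.
have hB' w y : minner w (fshift x y) = minner (B w) y :> M by rewrite -minnerC hB minnerC.
have hadj w d' : D d' -> adj A (htensor_map K w d') = htensor_map K (B w) d'.
  move=> Dd'; apply/eqP; rewrite -subr_eq0; apply/eqP/fock_tensor_dense => m y e Xy De.
  rewrite ipBl -(adjPr Ab); have := hA (Tagged (pow X) y) e De.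
  rewrite /elt_inc /elt_shift /= in_fiberE // => ->.
  by rewrite !htensor_ip // -Sinc // hB' subrr.
apply: (htensor_ext (G := K)) => w d' _ Dd'.
by rewrite (adjPr Ab) hadj // !htensor_ip // hB'.
Qed.
End Induced.
End ShiftExistence.

(** * Partial isometries *)

Section PartialIsometries.
Variable R : realType.
Local Notation C := (cplx R).

Lemma eq_nrm (V W : normedModType C) (x : V) (y : W) : `|x| = `|y| <-> nrm x = nrm y.
Proof. by rewrite !nrmE; split=> [/rc_inj|->]. Qed.

Lemma dense_of_orth (H : hilbertType R) (A : set H) :
  (forall k, (forall a, A a -> ip a k = 0) -> k = 0) -> closure (lin_span A) = setT.
Proof.
move=> h; apply/seteqP; split=> // x _; have [y cy hy] := projection_exists A x.
suff -> : x = y by [].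
by apply/eqP; rewrite -subr_eq0; apply/eqP; exact: h.
Qed.

Section One.
Variables (G H : hilbertType R) (A : G -> H).
Hypothesis Ab : bounded_op A.

Lemma ip_adj_self x : ip x (adj A (A x)) = rc (nrm (A x) ^+ 2).
Proof. by rewrite -(adjP Ab) ipxx. Qed.

(** [|A^* A x - x|^2 = |A^* A x|^2 - |x|^2], and the right side is at most 0. *)
Lemma adj_fix x : (forall y, nrm (A y) <= nrm y) -> nrm (A x) = nrm x -> adj A (A x) = x.
Proof.
move=> A1 Ax; apply/eqP; rewrite -subr_eq0; apply/eqP/ip_eq0.
have A1' y : nrm (A y) <= 1 * nrm y by rewrite mul1r.
have h1 := adj_bound Ab ler01 A1' (A x); rewrite mul1r in h1.
set w := adj A (A x) in h1 *; have e1 : ip x w = rc (nrm x ^+ 2) by rewrite ip_adj_self Ax.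
have e2 : ip w x = rc (nrm x ^+ 2) by rewrite -ipC e1 rc_conj.
apply/eqP; rewrite eq_le; apply/andP; split; last by rewrite ipxx -rc0 rc_le sqr_ge0.
rewrite ipBl !ipBr e1 e2 !ipxx -!rcB -rc0 rc_le.
have : nrm w ^+ 2 <= nrm x ^+ 2.
  by rewrite ler_sqr ?nnegrE ?nrm_ge0 // (le_trans h1) // Ax.
lra.
Qed.

Lemma partial_isometry_contr : partial_isometry A -> forall y, nrm (A y) <= nrm y.
Proof.
move=> [_ hA] x; pose N := [set y | A y = 0].
have N0 : N 0 by exact: lin0 Ab.1.
have [y cy hy] := projection_exists N x.
have Ny : A y = 0.
  by apply: (@eq_bounded_closure _ _ _ A (fun=> 0) N) => //; exact: bounded_0.
have := hA (x - y) hy; rewrite (linB Ab.1) Ny subr0 => /eq_nrm hx.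
have h0 : ip y (x - y) = 0 by exact: hy.
have := pythagoras h0; rewrite addrC subrK => e.
by rewrite hx; apply: le_sqr; rewrite ?nrm_ge0 // e lerDr sqr_ge0.
Qed.

Lemma partial_isometryE : partial_isometry A <-> forall x, A (adj A (A x)) = A x.
Proof.
split=> [hp x|h].
  have A1 := partial_isometry_contr hp; pose N := [set y | A y = 0].
  have [y cy hy] := projection_exists N x.
  have Ny : A y = 0.
    by apply: (@eq_bounded_closure _ _ _ A (fun=> 0) N) => //; exact: bounded_0.
  have -> : A x = A (x - y) by rewrite (linB Ab.1) Ny subr0.
  by rewrite adj_fix //; apply/eq_nrm; exact: hp.2.
split=> // x hx; apply/eq_nrm; have k0 : A (x - adj A (A x)) = 0 by rewrite (linB Ab.1) h subrr.
have xE : x = adj A (A x).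
  apply/eqP; rewrite -subr_eq0; apply/eqP/ip_eq0.
  by rewrite ipBr (hx _ k0) -(adjP Ab) k0 ip0l subr0.
apply/eqP; rewrite -(@eqrXn2 _ 2) ?nrm_ge0 //; apply/eqP/rc_inj.
by rewrite -!ipxx [LHS](adjP Ab) -xE.
Qed.

Lemma coisometryE : coisometry A <-> forall y, A (adj A y) = y.
Proof.
split=> [[_ h] y|h].
  have hn z : nrm (adj A z) = nrm z by apply/eq_nrm; exact: h.
  by apply: ip_ext => z; rewrite (adjPr Ab) (isometry_ip (adj_linear Ab) hn).
split=> // y; apply/eq_nrm.
by apply: ip_isometry => x z; rewrite -(adjPr Ab) h.
Qed.
End One.

Lemma isometry_adj (G H : hilbertType R) (A : G -> H) : linear A ->
  (forall x, nrm (A x) = nrm x) -> bounded_op A /\ forall x, adj A (A x) = x.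
Proof.
move=> Al Ai; have Ab : bounded_op A by apply: (@bounded_of_nrm R _ _ A 1 Al) => x; rewrite mul1r Ai.
split=> // x; apply: ip_ext => z; by rewrite -(adjP Ab) (isometry_ip Al Ai).
Qed.

(** [positive_op] does not mention symmetry. Reality of [<z, P z>] at [z = x + c y] shows that [c b]
    is real for every [c], where [b] is the defect of symmetry; comparing [c] with [i c] gives
    [b = 0]. *)
Lemma positive_sym (H : hilbertType R) (P : H -> H) : positive_op P ->
  forall x y, ip (P x) y = ip x (P y).
Proof.
move=> [[Pl _] Pp] x y; apply/eqP; rewrite eq_sym -subr_eq0; apply/eqP.
have sym z : ip (P z) z = ip z (P z).
  by rewrite -ipC (rc_ge0 (Pp z)) rc_conj.
set b := _ - _; have key c : c * b = (c * b)^*.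
  have := sym (x + c *: y); rewrite (linD Pl) (linZ Pl) !ipDl !ipDr !ipZl !ipZr.
  rewrite rmorphM /= /b rmorphB /= !ipC !sym => e.
  have : c * (ip x (P y) - ip (P x) y) - c^* * (ip (P y) x - ip y (P x)) = 0.
    move/eqP: e; rewrite eq_sym -subr_eq0 => /eqP <-; ring.
  by move/eqP; rewrite subr_eq0 => /eqP.
apply: polarization0 => c; have := key ('i * c); rewrite -mulrA rmorphM /= conjCi -key.
move/eqP; rewrite mulNr -subr_eq0 opprK -mulrDr mulf_eq0 (negPf (neq0Ci _)) /= => /eqP h.
exact: h.
Qed.

(** [sqrt_op] returns some positive root, so uniqueness is at stake. A root [P] kills the complement
    of the range of [E], and [u = P E x - E x] satisfies [P u = - u], which positivity allows only
    for [u = 0]. *)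
Lemma sqrt_projection (H : hilbertType R) (E : H -> H) :
  positive_op E -> (forall x, E (E x) = E x) -> sqrt_op E = E.
Proof.
move=> Ep EE; have [] : [set P : H -> H | positive_op P /\ forall x, P (P x) = E x] (sqrt_op E).
  by apply: xgetPex; exists E.
set P := sqrt_op E => Pp PP; have Ps := positive_sym Pp; have Pl := Pp.1.1; have El := Ep.1.1.
apply/funext => x; have -> : P x = P (E x).
  apply/eqP; rewrite -subr_eq0 -(linB Pl); apply/eqP/ip_eq0.
  by rewrite Ps PP (linB El) EE subrr ip0r.
pose u := P (E x) - E x.
have Pu : P u = - u by rewrite /u (linB Pl) PP EE opprB.
have := Pp.2 u; rewrite Pu ipNr ipxx -rcN -rc0 rc_le oppr_ge0 => h.
have u0 : nrm u = 0 by apply/eqP; rewrite -sqrf_eq0 eq_le h sqr_ge0.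
by move/nrm_eq0/eqP: u0; rewrite subr_eq0 => /eqP.
Qed.
End PartialIsometries.

(** * Decompositions of representations *)

Section Splitting.
Variables (R : realType) (M : cstarType R) (s : setting M).
Variables (X : subproduct_system s).
Notation fib n := (@fiber _ _ _ X n).

Lemma closure_linear_subspace (H : hilbertType R) (A : set H) :
  linear_subspace A -> linear_subspace (closure A).
Proof.
move=> [A0 AD]; split; first exact: subset_closure.
move=> c x y /closure_conv[u Au ux] /closure_conv[w Aw wy]; apply/closure_conv.
exists (fun n => c *: u n + w n); first by move=> n; exact: AD.
exact: convD (conv_scale c ux) wy.
Qed.

Variables (H : hilbertType R) (T : op_family X H).
Arguments T : clear implicits.
Hypothesis hT : ccc_rep T.
Variable XH : fiber_tensor T.

Lemma ccc_normal_in : normal_in s (rep0 T).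
Proof. by refine (setting_impl _ (ccc_normal hT)) => v []. Qed.

Lemma defect_linear_subspace : linear_subspace (defect_space XH).
Proof.
apply: closure_linear_subspace; rewrite /defect_op /sqrt_op.
(* Whether a root exists is left open here: the default value 0 also has a linear range. *)
set S := [set P | _]; have [[P hP]|hS] := pselect (exists P, S P).
  have [[[Dl _] _] _] : S (xget (fun=> 0) S) by apply: xgetPex; exists P.
  split; first by exists 0 => //; exact: lin0 Dl.
  by move=> c _ _ [x _ <-] [y _ <-]; exists (c *: x + y); rewrite ?Dl.
have -> : xget (fun=> 0) S = fun=> 0.
  by apply: xgetPN => P hP; apply: hS; exists P.
split; first by exists 0.
by move=> c _ _ [x _ <-] [y _ <-]; exists 0; rewrite // scaler0 addr0.
Qed.

Variables (F : fock_module X) (K : htensor (setT : set F) (defect_space XH) (rep0 T)).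
Notation ind x := (induced_op (K := K) (@Defs.shift _ _ _ _ F _ x)).
Variables (U : hilbertType R) (Z : op_family X U) (V : K -> H) (iota : U -> H).
Arguments Z : clear implicits.

(** [wold_decomposition] in terms of isometric embeddings of the two summands into H, so that all
    computations take place in H and not in a product. *)
Record splitting : Prop := Splitting {
  split_V : linear V ;
  split_Vi : forall k, nrm (V k) = nrm k ;
  split_iota : linear iota ;
  split_iotai : forall u, nrm (iota u) = nrm u ;
  split_orth : forall k u, ip (V k) (iota u) = 0 ;
  split_sum : forall h, exists k u, h = V k + iota u ;
  split_TV : forall n (x : pow X n) k, fib n x -> T n x (V k) = V (ind x k) ;
  split_Tiota : forall n (x : pow X n) u, fib n x -> T n x (iota u) = iota (Z n x u) ;
  split_Z : fully_coisometric Z }.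
End Splitting.

Section WoldSplitting.
Variables (R : realType) (M : cstarType R) (s : setting M) (X : subproduct_system s).
Notation fib n := (@fiber _ _ _ X n).
Variables (H : hilbertType R) (T : op_family X H).
Hypothesis hT : ccc_rep T.
Variable XH : fiber_tensor T.
Variables (F : fock_module X) (K : htensor (setT : set F) (defect_space XH) (rep0 T)).
Variables (U : hilbertType R) (Z : op_family X U).
Notation ind x := (induced_op (K := K) (@Defs.shift _ _ _ _ F _ x)).

Lemma induced_bounded n (x : pow X n) : fib n x -> bounded_op (ind x).
Proof.
move=> Xx; have [D0 _] := defect_linear_subspace XH.
by have [] := induced_spec Xx K (ccc_rep0 hT) D0 (ccc_normal_in hT).
Qed.

Lemma wold_splitting (W : H -> K * U) : wold_decomposition W Z ->
  exists V iota, @splitting _ _ _ _ _ _ _ _ K U Z V iota.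
Proof.
move=> [[Wl [Wi WK KW] Wip] hZ WT].
have Wil : linear Wi.
  by move=> c x y; rewrite -[RHS]WK Wl !KW.
have Wiip x y : ip (Wi x) (Wi y) = dsum_ip x y by rewrite -Wip !KW.
exists (fun k => Wi (k, 0)), (fun u => Wi (0, u)); split=> //.
- by move=> c x y; rewrite -Wil; congr Wi; congr pair; rewrite /= scaler0 addr0.
- by apply: ip_isometry => x y; rewrite Wiip /dsum_ip /= ip0l addr0.
- by move=> c x y; rewrite -Wil; congr Wi; congr pair; rewrite /= scaler0 addr0.
- by apply: ip_isometry => x y; rewrite Wiip /dsum_ip /= ip0l add0r.
- by move=> k u; rewrite Wiip /dsum_ip /= ip0r ip0l addr0.
- move=> h; exists (W h).1, (W h).2; rewrite -(linD Wil) -[LHS]WK; congr Wi.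
  by case: (W h) => k u; congr pair; rewrite /= ?addr0 ?add0r.
- move=> n x k Xx; apply: (can_inj WK); rewrite WT // !KW /dsum_op /=.
  by rewrite (lin0 (ccc_bounded hZ.1 Xx).1).
- move=> n x u Xx; apply: (can_inj WK); rewrite WT // !KW /dsum_op /=.
  by rewrite (lin0 (induced_bounded Xx).1).
Qed.

Lemma splitting_wold V iota : @splitting _ _ _ _ _ _ _ _ K U Z V iota ->
  exists W : H -> K * U, wold_decomposition W Z.
Proof.
move=> [Vl Vi il ii orth sum TV Ti hZ].
have [Vb VV] := isometry_adj Vl Vi; have [ib iiK] := isometry_adj il ii.
have Viota u : adj V (iota u) = 0 by apply: ip_ext => k; rewrite -(adjP Vb) orth ip0r.
have iotaV k : adj iota (V k) = 0.
  by apply: ip_ext => u; rewrite -(adjP ib) -ipC orth conjC0 ip0r.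
have adjD h k u : h = V k + iota u -> (adj V h = k) * (adj iota h = u).
  move=> ->; rewrite (linD (adj_linear Vb)) (linD (adj_linear ib)).
  by rewrite VV iiK Viota iotaV addr0 add0r.
have hK h : V (adj V h) + iota (adj iota h) = h.
  by have [k [u hE]] := sum h; rewrite !(adjD _ _ _ hE).
exists (fun h => (adj V h, adj iota h)); split => //.
  split.
  - by move=> c x y; rewrite (adj_linear Vb) (adj_linear ib).
  - exists (fun p => V p.1 + iota p.2) => [h|[k u]] /=; first exact: hK.
    by rewrite !(adjD _ _ _ erefl).
  - by move=> x y; rewrite /dsum_ip /= -(adjP Vb) -(adjP ib) -ipDl hK.
move=> n x Xx h; rewrite /dsum_op /= -{1 2}(hK h).
have Tb := ccc_bounded hT Xx.
by rewrite (linD Tb.1) TV // Ti // !(adjD _ _ _ erefl).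
Qed.
End WoldSplitting.

Section Summand.
Variables (R : realType) (M : cstarType R) (s : setting M) (X : subproduct_system s).
Local Notation C := (cplx R).
Notation fib n := (@fiber _ _ _ X n).
Variables (H : hilbertType R) (T : op_family X H).
Arguments T : clear implicits.
Hypothesis hT : ccc_rep T.
Variable XH : fiber_tensor T.
Notation tld n := (@tilde _ _ _ _ _ _ XH n).
Variables (K : lmodType C) (V : K -> H) (S : forall n, pow X n -> K -> K).
Arguments S : clear implicits.
Variables (U : hilbertType R) (iota : U -> H) (Z : op_family X U).
Arguments Z : clear implicits.
Hypothesis il : linear iota.
Hypothesis ii : forall u, nrm (iota u) = nrm u.
Hypothesis orth : forall k u, ip (V k) (iota u) = 0.
Hypothesis hsum : forall h, exists k u, h = V k + iota u.
Hypothesis TV : forall n (x : pow X n) k, fib n x -> T n x (V k) = V (S n x k).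
Hypothesis Ti : forall n (x : pow X n) u, fib n x -> T n x (iota u) = iota (Z n x u).
Hypothesis hZ : ccc_rep Z.
Variable XU : fiber_tensor Z.
Notation tldU n := (@tilde _ _ _ _ _ _ XU n).

Lemma rep0_summand a u : rep0 T a (iota u) = iota (rep0 Z a u).
Proof. by rewrite /rep0 Ti // fiber0. Qed.

(** The isometry [j] is [1 (x) iota]. Vectors [x (x) V k] are orthogonal to its range; testing
    against them and against [x (x) iota v] shows that [j] carries the adjoint of [tilde] for Z to
    the one for T, and [tilde] itself is compared on generators. *)
Lemma tilde_adj_summand n u :
  exists2 w, adj (tld n) (iota u) = w & tld n w = iota (tldU n (adj (tldU n) u)).
Proof.
have hs := ccc_rep0 hT; have hu := ccc_rep0 hZ; have hX := fiber_submodule X n.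
have iip := isometry_ip il ii.
have [|j [jb jg]] := @gram_isometry R (pow X n * U) (XU n) (XH n)
   (fun p => htensor_map (XU n) (in_fiber p.1) p.2)
   (fun p => htensor_map (XH n) (in_fiber p.1) (iota p.2)).
  move=> [x k] [y l] /=; rewrite !htensor_ip //; try exact: in_fiberP.
  by rewrite rep0_summand iip.
have jg' x k : fib n x -> j (htensor_map (XU n) x k) = htensor_map (XH n) x (iota k).
  by move=> Xx; have := jg (x, k); rewrite /= in_fiberE.
have dU : closure (lin_span (range (fun p : pow X n * U => htensor_map (XU n) (in_fiber p.1) p.2))) = setT.
  apply: dense_of_orth => k hk; apply: (htensor_ext (G := XU n)) => x h Xx _.
  by rewrite ip0r -[RHS](hk (htensor_map (XU n) x h)) //; exists (x, h); rewrite //= in_fiberE.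
move=> /(_ dU) ji; have jip := isometry_ip jb.1 ji.
exists (j (adj (tldU n) u)).
  have orthj x k : fib n x -> forall z, ip (htensor_map (XH n) x (V k)) (j z) = 0.
    move=> Xx; apply: (htensor_bounded_op (B := fun=> 0 : C^o)) => //.
    - exact: bounded_comp (ip_bounded _) jb.
    - exact: bounded_0.
    - by move=> y h Xy _; rewrite jg' // htensor_ip // rep0_summand orth.
  apply: (htensor_ext (G := XH n)) => x h Xx _; have [k [v ->]] := hsum h.
  have -> : htensor_map (XH n) x (V k + iota v) =
      htensor_map (XH n) x (V k) + htensor_map (XH n) x (iota v).
    by rewrite -[V k]scale1r (htensor_linr (XH n) hs (linear_subspaceT H)) // !scale1r.
  rewrite !ipDl orthj // !(ip_adj_tilde hT) // TV // orth Ti // iip -jg' // jip.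
  by rewrite (ip_adj_tilde hZ).
suff h z : tld n (j z) = iota (tldU n z) by exact: h.
move: z; apply: htensor_bounded_op.
- exact: bounded_comp (tilde_bounded hT XH n) jb.
- exact: bounded_comp (isometry_adj il ii).1 (tilde_bounded hZ XU n).
- by move=> x h Xx _; rewrite jg' // (tildeE hT) // (tildeE hZ) // Ti.
Qed.

Lemma tilde_summand n u :
  tld n (adj (tld n) (iota u)) = iota (tldU n (adj (tldU n) u)).
Proof. by have [w -> ->] := tilde_adj_summand n u. Qed.
End Summand.

(** A closed subspace is not a type; the range of [E] becomes one as the space of the kernel
    [<y, E z>], with [iota] as its inclusion. *)
Lemma projection_space (R : realType) (H : hilbertType R) (E : H -> H) :
  bounded_op E -> (forall x y, ip (E x) y = ip x (E y)) -> (forall x, E (E x) = E x) ->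
  exists (U : hilbertType R) (iota : U -> H), [/\ linear iota,
    forall u, nrm (iota u) = nrm u, forall u, E (iota u) = iota u &
    forall h, exists u, E h = iota u].
Proof.
move=> Eb Es EE; pose kappa y z := ip y (E z).
have kC y z : (kappa y z)^* = kappa z y by rewrite /kappa ipC Es.
have [|U [phi [hphi dphi]]] := kernel_space kC.
  move=> l; suff -> : kform kappa l l = rc (nrm (E (comb (fun y => y) l)) ^+ 2).
    by rewrite -rc0 rc_le sqr_ge0.
  rewrite -ipxx Es EE /comb (lin_sum Eb.1) ip_suml; apply: eq_bigr => p _.
  rewrite ip_sumr; apply: eq_bigr => q _.
  by rewrite (linZ Eb.1) ipZl ipZr mulrA.
have [|iota [ib ig ii]] := @gram_isometry R H U H phi E.
  by move=> y z; rewrite hphi /kappa Es EE.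
exists U, iota; split=> [||u|h]; first exact: ib.1.
- exact: ii.
- apply: (@eq_bounded_closure _ _ _ (E \o iota) iota (range phi)) => //.
  + exact: bounded_comp.
  + by move=> _ [y _ <-]; rewrite /= ig EE.
  + by rewrite dphi.
- by exists (phi h); rewrite ig.
Qed.

(** * Restriction of a representation to an invariant subspace *)

Section Compression.
Variables (R : realType) (M : cstarType R) (s : setting M) (X : subproduct_system s).
Notation fib n := (@fiber _ _ _ X n).
Variables (H : hilbertType R) (T : op_family X H).
Arguments T : clear implicits.
Hypothesis hT : ccc_rep T.
Variables (U : hilbertType R) (iota : U -> H).
Hypothesis il : linear iota.
Hypothesis ii : forall u, nrm (iota u) = nrm u.
Hypothesis hinv : forall n (x : pow X n) u, fib n x ->
  exists v, T n x (iota u) = iota v.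

(** By invariance this is the restriction of T; the adjoint of [iota] serves as a total left inverse
    of [iota]. *)
Definition compression : op_family X U := fun n x u => adj iota (T n x (iota u)).
Local Notation Z := compression.

Lemma compressionE n (x : pow X n) u : fib n x -> T n x (iota u) = iota (Z x u).
Proof.
move=> Xx; have [v hv] := hinv u Xx; rewrite /compression hv.
by have [_ ->] := isometry_adj il ii.
Qed.

Lemma compression_bounded (S : H -> H) : bounded_op S ->
  bounded_op (fun u => adj iota (S (iota u))).
Proof.
have ib := (isometry_adj il ii).1; move=> Sb.
exact: bounded_comp (adj_bounded ib) (bounded_comp Sb ib).
Qed.

Lemma uw_compression g : @uw_functional _ U g ->
  @uw_functional _ H (fun S => g (fun u => adj iota (S (iota u)))).
Proof.
have ib := (isometry_adj il ii).1.
move=> [xi [eta [h1 h2 h3]]]; exists (iota \o xi), (iota \o eta); split.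
- by move: h1; congr (cvgn (series _)); apply/funext => i; rewrite !nrmE ii.
- by move: h2; congr (cvgn (series _)); apply/funext => i; rewrite !nrmE ii.
- move=> S Sb; have -> : (fun i => ip ((iota \o xi) i) (S ((iota \o eta) i))) =
    (fun i => ip (xi i) (adj iota (S (iota (eta i))))).
    by apply/funext => i; rewrite -(adjP ib).
  exact: h3 (compression_bounded Sb).
Qed.

Lemma compression_rep : ccc_rep Z.
Proof.
have [ib iK] := isometry_adj il ii; have iip := isometry_ip il ii.
have iinj u v : iota u = iota v -> u = v by move=> e; rewrite -[u]iK e iK.
have hs := ccc_rep0 hT; have X0 a : fib 0 (tunit X a) by rewrite fiber0.
have r0 a u : iota (rep0 Z a u) = rep0 T a (iota u) by rewrite /rep0 -compressionE.
split.
- by move=> n x Xx; exact: compression_bounded (ccc_bounded hT Xx).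
- move=> n c x y h Xx Xy; rewrite /compression (ccc_linear hT) //.
  exact: (adj_linear ib).
- split=> [a|c a b h|a b h|a h k|].
  + exact: compression_bounded (rep_bounded hs a).
  + by apply: iinj; rewrite il !r0 (rep_linl hs).
  + by apply: iinj; rewrite !r0 (repM hs).
  + by rewrite -iip r0 (rep_adj hs) -r0 iip.
  (* If [k] is orthogonal to all these vectors, then [|rep0 T a (iota k)|^2] is the inner product of
     [k] with one of them, so [iota k] is annihilated and vanishes by nondegeneracy on H. *)
  + apply: dense_of_orth => k hk; apply: iinj.
    have h0 a : rep0 T a (iota k) = 0.
      apply: ip_eq0; rewrite (rep_adj hs) -(repM hs) -r0 iip -ipC hk ?conjC0 //.
      by exists (amul (astar a) a), k.
    have [_ _ _ _ dT] := hs; rewrite (lin0 il); apply: (ip_dense dT) => _ [a [h ->]].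
    by rewrite (rep_adj hs) h0 !ip0r.
- move=> n k z c zX zc h; have := @ccc_contractive _ _ _ _ _ _ hT n k z c zX zc (iota \o h).
  congr (_ <= _ * _); apply: eq_bigr => i _; last by rewrite /= !nrmE ii.
  rewrite !nrmE -(ii (\sum_j _)) (lin_sum il); congr (rc (nrm _) ^+ 2).
  by apply: eq_bigr => j _; rewrite -compressionE.
- move=> n x a h Xx; apply: iinj.
  have [_ _ hr] := fiber_submodule X n.
  by rewrite -!compressionE ?r0 ?(ccc_ract hT) //; exact: hr.
- move=> n x a h Xx; apply: iinj.
  by rewrite r0 -!compressionE ?(ccc_lact hT) //; exact: fiber_lact.
- move=> n m x y h Xx Xy; apply: iinj.
  by rewrite -!compressionE ?(ccc_mul hT) ?compressionE //; exact: (fiber_smul Xx Xy).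
- have h := wtop_map uw_compression.
  refine (setting_impl _ (ccc_normal hT)) => v [h1 h2]; split=> [|n].
    exact: (fun x => continuous_comp (h1 x) (h _)).
  exact: (fun x => continuous_comp (h2 n x) (h _)).
Qed.
End Compression.

(** * From relatively isometric representations to decompositions *)

Section Forward.
Variables (R : realType) (M : cstarType R) (s : setting M) (X : subproduct_system s).
Local Notation C := (cplx R).
Notation fib n := (@fiber _ _ _ X n).
Variables (H : hilbertType R) (T : op_family X H).
Arguments T : clear implicits.
Hypothesis hT : ccc_rep T.
Variable XH : fiber_tensor T.
Notation tld n := (@tilde _ _ _ _ _ _ XH n).
Notation Q n h := (tld n (adj (tld n) h)).
Local Notation D := (defect_space XH).

Let hs : representation (rep0 T) := ccc_rep0 hT.
Let tb n : bounded_op (tld n) := tilde_bounded hT XH n.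

Lemma range_proj_bounded n : bounded_op (fun h => Q n h).
Proof. exact: bounded_comp (tb n) (adj_bounded (tb n)). Qed.

Lemma range_proj_sym n x y : ip (Q n x) y = ip x (Q n y).
Proof. by rewrite (adjP (tb n)) (adjPr (tb n)). Qed.

Lemma adj_tilde0 n g : (forall x h, fib n x -> ip (T n x h) g = 0) -> adj (tld n) g = 0.
Proof.
by move=> h; apply: (htensor_ext (G := XH n)) => x k Xx _; rewrite (ip_adj_tilde hT) // h // ip0r.
Qed.

Lemma tilde_adj_ker n g : Q n g = 0 -> adj (tld n) g = 0.
Proof. by move=> h; apply: ip_eq0; rewrite -(adjP (tb n)) h ip0l. Qed.

Hypothesis hp : forall n, partial_isometry (tld n).

Lemma range_proj_tilde n z : Q n (tld n z) = tld n z.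
Proof. exact: (partial_isometryE (tb n)).1. Qed.

Lemma adj_range_proj n g : adj (tld n) (Q n g) = adj (tld n) g.
Proof.
by apply: ip_ext => z; rewrite -!(adjP (tb n)) -range_proj_sym range_proj_tilde.
Qed.

Lemma range_proj_compl_bounded n : bounded_op (fun h => h - Q n h).
Proof.
have := bounded_lin (-1) (range_proj_bounded n) (bounded_id H).
by congr bounded_op; apply/funext => x; rewrite scaleN1r addrC.
Qed.

Lemma defect_opE : defect_op XH = fun h => h - Q 1 h.
Proof.
have Q0 x : Q 1 (x - Q 1 x) = 0.
  by rewrite (linB (adj_linear (tb 1))) adj_range_proj subrr (lin0 (tb 1).1).
apply: sqrt_projection => [|x]; last by rewrite Q0 subr0.
split=> [|x]; first exact: range_proj_compl_bounded.
suff -> : ip x (x - Q 1 x) = ip (x - Q 1 x) (x - Q 1 x) by rewrite ipxx -rc0 rc_le sqr_ge0.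
by rewrite [RHS]ipBl (range_proj_sym 1 x (x - Q 1 x)) Q0 ip0r subr0.
Qed.

Lemma defect_spaceP d : D d <-> forall x h, fib 1 x -> ip (T 1%N x h) d = 0.
Proof.
split=> [Dd|h]; last first.
  have h0 : adj (tld 1) d = 0 by exact: adj_tilde0.
  apply: subset_closure; exists d => //.
  by rewrite defect_opE h0 (lin0 (tb 1).1) subr0.
suff h : adj (tld 1) d = 0 by move=> x k Xx; rewrite -(ip_adj_tilde hT XH) // h ip0r.
apply: (@eq_bounded_closure _ _ _ (adj (tld 1)) (fun=> 0) (range (defect_op XH))) => //.
- exact: adj_bounded.
- exact: bounded_0.
- move=> _ [h _ <-]; rewrite defect_opE (linB (adj_linear (tb 1))).
  by rewrite adj_range_proj subrr.
- exact: closureS (@lin_span_sub _ _ _) _ Dd.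
Qed.

Lemma range_proj_defect d : D d -> Q 1 d = 0.
Proof. by move=> /defect_spaceP/adj_tilde0 ->; exact: lin0 (tb 1).1. Qed.

Lemma defect_op_id d : D d -> defect_op XH d = d.
Proof. by move=> Dd; rewrite defect_opE range_proj_defect // subr0. Qed.

Lemma defect_space_inv a d : D d -> D (rep0 T a d).
Proof.
move=> /defect_spaceP h; apply/defect_spaceP => x k Xx; have := rep_adj hs (astar a) (T 1%N x k) d.
by rewrite astarK => <-; rewrite -(ccc_lact hT) // h //; exact: fiber_lact.
Qed.

Lemma defect_orth n z h d : fib (1 + n)%N z -> D d -> ip d (T (1 + n)%N z h) = 0.
Proof.
move=> Xz /defect_spaceP hd; apply: (rep_products_orth hT) Xz => x y Xx Xy.
by rewrite -ipC hd ?conjC0.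
Qed.

Hypothesis hri : (forall n, closure (lin_span [set z | exists x h,
        fib n x /\ z = htensor_map (XH n) x (defect_op XH h)])
      `<=` range (adj (tld n))) \/
   (forall n (x : pow X n) h, fiber x ->
      defect_op XH (adj (T n x) (T n x (defect_op XH h))) =
      rep0 T (minner x x) (defect_op XH h)).

(** Here the two forms of relative isometry are unified. Form (a) presents the tensor as [t_n^* g],
    and [t_n^* Q_n = t_n^*]; form (b) says that [t_n] preserves the norm of the tensor, so [adj_fix]
    applies. *)
Lemma tilde_fix n x d : fib n x -> D d ->
  adj (tld n) (T n x d) = htensor_map (XH n) x d.
Proof.
move=> Xx Dd; have hd := defect_op_id Dd; rewrite -(tildeE hT XH) //.
case: hri => [ha|hb].
  have [|g _ <-] := ha n (htensor_map (XH n) x d).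
    by apply: subset_closure; apply: lin_span_sub; exists x, d; rewrite hd.
  exact: adj_range_proj.
apply: (adj_fix (tb n)); first exact: (partial_isometry_contr (tb n)).
have Tb := ccc_bounded hT Xx.
have h : ip (T n x d) (T n x d) = ip d (rep0 T (minner x x) d).
  have := hb n x d Xx; rewrite hd => <-; rewrite defect_opE ipBr -range_proj_sym range_proj_defect //.
  by rewrite ip0l subr0 (adjP Tb).
apply/eqP; rewrite -(@eqrXn2 _ 2) ?nrm_ge0 //; apply/eqP/rc_inj.
by rewrite -!ipxx htensor_ip // (tildeE hT) //; exact: h.
Qed.

Lemma rep_defect_gram n x x' d h : fib n x -> fib n x' -> D d ->
  ip (T n x d) (T n x' h) = ip d (rep0 T (minner x x') h).
Proof.
move=> Xx Xx' Dd; rewrite -(tildeE hT XH h Xx') (adjPr (tb n)) tilde_fix //.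
by rewrite htensor_ip.
Qed.

(** For a product [x' (x) y] in place of [z], with [y] of degree at least 1, the inner product is
    that of [d] with [T (<x, x'> y) h], and D is orthogonal to such vectors. *)
Lemma rep_defect_orth n N x z d h : (n < N)%N -> fib n x -> fib N z -> D d ->
  ip (T n x d) (T N z h) = 0.
Proof.
move=> nN Xx Xz Dd; have [k kE] : exists k, N = (n + (1 + k))%N.
  by exists (N - n.+1)%N; rewrite addnA addn1 subnKC.
subst N; apply: (rep_products_orth hT) Xz => x' y Xx' Xy.
rewrite rep_defect_gram // -(ccc_lact hT) //.
by apply: defect_orth => //; exact: fiber_lact.
Qed.

(* By induction on [k]: [xi = adj (tld k) g] is orthogonal to all vectors
   [x (x) Q_1 h], hence a limit of combinations of [x (x) d] with [d] in D, so
   that [u] is orthogonal to [tld k xi = Q_k g]; the induction hypothesis applies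
   to [g - Q_k g]. *)
Lemma perp_range_proj u : (forall m y d, fib m y -> D d -> ip (T m y d) u = 0) ->
  forall k g, (forall z h, fib k z -> ip (T k z h) g = 0) -> ip g u = 0.
Proof.
move=> hu; elim=> [|k IH] g hg.
  suff -> : g = 0 by rewrite ip0l.
  have [_ _ _ _ dT] := hs; apply: (ip_dense dT) => _ [a [h ->]].
  by rewrite ip0r hg // fiber0.
pose xi := adj (tld k) g.
have xi0 x x' h : fib k x -> fib 1 x' -> ip xi (htensor_map (XH k) x (T 1%N x' h)) = 0.
  move=> Xx Xx'; rewrite -ipC (ip_adj_tilde hT) // -(rep_smul hT) //.
  by move: (fiber_smul Xx Xx'); move: (smul x x'); rewrite addn1 => z Xz; rewrite hg // conjC0.
have xi1 x w : fib k x -> ip xi (htensor_map (XH k) x (tld 1 w)) = 0.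
  move=> Xx; move: w; apply: (htensor_bounded_op (B := fun=> 0 : C^o)).
  - exact: bounded_comp (bounded_comp (ip_bounded xi) (fiber_tensor_bounded hT XH Xx)) (tb 1).
  - exact: bounded_0.
  - by move=> x' h Xx' _; rewrite (tildeE hT) // xi0.
pose A := [set z | exists x d, [/\ fib k x, D d & z = htensor_map (XH k) x d]].
have [xi' cxi' hxi'] := projection_exists A xi.
have exi : xi = xi'.
  apply/eqP; rewrite -subr_eq0; apply/eqP; apply: (htensor_ext (G := XH k)) => x h Xx _.
  rewrite ip0r -(subrK (Q 1 h) h) -[h - _]scale1r (htensor_linr (XH k) hs (linear_subspaceT H)) //.
  rewrite scale1r ipDl hxi' ?add0r; last first.
    exists x, (h - Q 1 h); split=> //; apply: subset_closure.
    by exists h; rewrite // defect_opE.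
  rewrite ipBr -ipC xi1 // conjC0 sub0r -ipC; apply/eqP; rewrite oppr_eq0 conjC_eq0; apply/eqP.
  rewrite -ipC; apply/eqP; rewrite conjC_eq0; apply/eqP.
  apply: ip_closure0 cxi' => _ [y [d [Xy Dd ->]]].
  by rewrite htensor_ip // range_proj_sym range_proj_defect ?ip0r //; exact: defect_space_inv.
have h1 : ip (tld k xi) u = 0.
  rewrite (adjP (tb k)) exi -ipC; apply/eqP; rewrite conjC_eq0; apply/eqP.
  apply: ip_closure0 cxi' => _ [y [d [Xy Dd ->]]].
  by rewrite -ipC (ip_adj_tilde hT) // hu // conjC0.
have h2 : ip (g - tld k xi) u = 0.
  apply: IH => z h Xz; rewrite -(ip_adj_tilde hT XH) // (linB (adj_linear (tb k))).
  by rewrite adj_range_proj subrr ip0r.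
by rewrite -(subrK (tld k xi) g) ipDl h1 h2 addr0.
Qed.

(** [u - Q_k u] is orthogonal to the range of T_k, hence to [u] by [perp_range_proj]; being
    annihilated by [Q_k], it is also orthogonal to [Q_k u]. *)
Lemma perp_range_projE k u : (forall m y d, fib m y -> D d -> ip (T m y d) u = 0) ->
  Q k u = u.
Proof.
move=> hu; apply/eqP; rewrite eq_sym -subr_eq0; apply/eqP/ip_eq0.
have e : adj (tld k) (u - Q k u) = 0.
  by rewrite (linB (adj_linear (tb k))) adj_range_proj subrr.
rewrite ipBr (@perp_range_proj u hu k) => [|z h Xz]; last first.
  by rewrite -(ip_adj_tilde hT XH) // e ip0r.
by rewrite -range_proj_sym e (lin0 (tb k).1) ip0l subr0.
Qed.

(* [T n x u = T n x (Q_(m+1) u)] is a limit of combinations of vectors in the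
   range of [T (n + m + 1)]. *)
Lemma perp_invariant n x u : fib n x ->
  (forall m y d, fib m y -> D d -> ip (T m y d) u = 0) ->
  forall m y d, fib m y -> D d -> ip (T m y d) (T n x u) = 0.
Proof.
move=> Xx hu m y d Xy Dd; rewrite -(perp_range_projE m.+1 hu).
move: (adj _ u); apply: (htensor_bounded_op (B := fun=> 0 : C^o)).
- apply: bounded_comp (ip_bounded _) (bounded_comp (ccc_bounded hT Xx) (tb _)).
- exact: bounded_0.
- move=> z h Xz _; rewrite (tildeE hT) // -(rep_smul hT) //.
  by rewrite rep_defect_orth //; [rewrite addnS ltnS leq_addl|exact: fiber_smul].
Qed.
End Forward.

Section FockGenerators.
Variables (R : realType) (M : cstarType R) (s : setting M) (X : subproduct_system s).
Local Notation C := (cplx R).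
Notation fib n := (@fiber _ _ _ X n).
Variables (H : hilbertType R) (sigma : M -> H -> H) (D : set H).
Hypotheses (hs : representation sigma) (hn : normal_in s sigma).
Variables (F : fock_module X) (K : htensor (setT : set F) D sigma).

Lemma fock_bounded_op (W : normedModType C) (A B : K -> W) :
  bounded_op A -> bounded_op B ->
  (forall m (y : pow X m) d, fib m y -> D d ->
    A (htensor_map K (fock_inc F y) d) = B (htensor_map K (fock_inc F y) d)) -> A =1 B.
Proof.
move=> Ab Bb AB k; pose G := [set z | exists m (y : pow X m) d,
  [/\ fib m y, D d & z = htensor_map K (fock_inc F y) d]].
apply: (eq_bounded_closure Ab Bb (A := G)) => [_ [m [y [d [Xy Dd ->]]]]|]; first exact: AB.
suff -> : closure (lin_span G) = setT by [].
apply: dense_of_orth => z hz; apply: (fock_tensor_dense hs hn) => m y d Xy Dd.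
by rewrite -ipC hz ?conjC0 //; exists m, y, d.
Qed.
End FockGenerators.

Section Wold.
Variables (R : realType) (M : cstarType R) (s : setting M) (X : subproduct_system s).
Notation fib n := (@fiber _ _ _ X n).
Variables (H : hilbertType R) (T : op_family X H).
Arguments T : clear implicits.
Hypothesis hT : ccc_rep T.
Variable XH : fiber_tensor T.
Local Notation D := (defect_space XH).
Variables (F : fock_module X) (K : htensor (setT : set F) D (rep0 T)).
Notation inc := (fock_inc F).
Notation ind x := (induced_op (K := K) (@Defs.shift _ _ _ _ F _ x)).

Let hs : representation (rep0 T) := ccc_rep0 hT.
Let hn : normal_in s (rep0 T) := ccc_normal_in hT.
Let D0 : D 0. Proof. by case: (defect_linear_subspace XH). Qed.

Lemma induced_inc n m (x : pow X n) (y : pow X m) d : fib n x -> fib m y -> D d ->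
  ind x (htensor_map K (inc y) d) = htensor_map K (inc (smul x y)) d.
Proof.
move=> Xx Xy Dd; have [_ ->] // := induced_spec Xx K hs D0 hn.
by have [_ ->] := shift_spec F Xx.
Qed.

Hypothesis hri : relatively_isometric XH.

(** The two families have the same Gram matrix: [rep_defect_gram] compares equal degrees and
    [rep_defect_orth] different ones. *)
Lemma wold_isometry : exists V : K -> H, [/\ bounded_op V,
  forall k, nrm (V k) = nrm k &
  forall m (y : pow X m) d, fib m y -> D d -> V (htensor_map K (inc y) d) = T m y d].
Proof.
have [hp hab] := hri.
pose dh d := if pselect (D d) then d else 0.
have Dd d : D (dh d) by rewrite /dh; case: pselect.
have dhE d : D d -> dh d = d by rewrite /dh; case: pselect.
have [|V [Vb Vg Vi]] := @gram_isometry R ({m : nat & pow X m} * H) K H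
  (fun p => htensor_map K (elt_inc F p.1) (dh p.2))
  (fun p => T (tag p.1) (in_fiber (tagged p.1)) (dh p.2)).
  move=> [[n x] d] [[m y] e]; rewrite /elt_inc /= htensor_ip //.
  have [nm|nm] := eqVneq n m.
    subst m; rewrite fock_inc_inner; try exact: in_fiberP.
    by rewrite (rep_defect_gram hT hp hab) //; exact: in_fiberP.
  rewrite fock_inc_orth; try exact: in_fiberP; last exact/eqP.
  rewrite (lin0 (rep_linl hs _)) ip0r.
  have [lt|lt|e'] := ltngtP n m; last by rewrite e' eqxx in nm.
    by rewrite (rep_defect_orth hT hp hab) //; exact: in_fiberP.
  by rewrite -ipC (rep_defect_orth hT hp hab) ?conjC0 //; exact: in_fiberP.
have Vg' m (y : pow X m) d : fib m y -> D d -> V (htensor_map K (inc y) d) = T m y d.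
  by move=> Xy De; have := Vg (Tagged (pow X) y, d); rewrite /elt_inc /= in_fiberE // dhE.
exists V; split=> //; apply: Vi; apply: dense_of_orth => k hk.
apply: (fock_tensor_dense hs hn) => m y d Xy De; rewrite -ipC hk ?conjC0 //.
by exists (Tagged (pow X) y, d) => //; rewrite /elt_inc /= in_fiberE // dhE.
Qed.

Lemma relatively_isometric_splitting : exists (U : hilbertType R) (Z : op_family X U) V iota,
  @splitting _ _ _ _ _ _ _ _ K U Z V iota.
Proof.
have [hp hab] := hri; have [V [Vb Vi Vg]] := wold_isometry.
have [_ VV] := isometry_adj Vb.1 Vi.
pose E h := h - V (adj V h).
have Eb : bounded_op E.
  have := bounded_lin (-1) (bounded_comp Vb (adj_bounded Vb)) (bounded_id H).
  by congr bounded_op; apply/funext => x; rewrite /= scaleN1r addrC.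
have E_ker h : adj V (E h) = 0 by rewrite (linB (adj_linear Vb)) VV subrr.
have Es x y : ip (E x) y = ip x (E y) by rewrite ipBl ipBr (adjP Vb) (adjPr Vb).
have EE x : E (E x) = E x by rewrite {1}/E E_ker (lin0 Vb.1) subr0.
have [U [iota [il ii Ei iE]]] := projection_space Eb Es EE.
have orth k u : ip (V k) (iota u) = 0 by rewrite (adjP Vb) -Ei E_ker ip0r.
have perp u m y d : fib m y -> D d -> ip (T m y d) (iota u) = 0.
  by move=> Xy Dd; rewrite -Vg // orth.
(* Together with [perp] this identifies the range of [iota], so that [perp_invariant] becomes
   invariance of this range. *)
have of_perp h : (forall m y d, fib m y -> D d -> ip (T m y d) h = 0) -> exists u, h = iota u.
  move=> hh; have [u hu] := iE h; exists u; rewrite -hu /E.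
  suff -> : adj V h = 0 by rewrite (lin0 Vb.1) subr0.
  apply: (fock_tensor_dense hs hn) => m y d Xy Dd.
  by rewrite -(adjPr Vb) Vg // -ipC hh ?conjC0.
have hinv n (x : pow X n) u : fib n x -> exists v, T n x (iota u) = iota v.
  by move=> Xx; apply: of_perp; apply: (perp_invariant hT hp hab Xx); exact: perp.
pose Z := compression T iota; have hZ : ccc_rep Z := compression_rep hT il ii hinv.
pose XU : fiber_tensor Z := fun n => inhabited_witness
  (htensor_exists (D := setT) (ccc_rep0 hZ) (fiber_0 X n) I).
have hsum h : exists k u, h = V k + iota u.
  by have [u hu] := iE h; exists (adj V h), u; rewrite -hu /E addrC subrK.
have TV n (x : pow X n) k : fib n x -> T n x (V k) = V (ind x k).
  move=> Xx; move: k; apply: (fock_bounded_op hs hn).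
  + exact: bounded_comp (ccc_bounded hT Xx) Vb.
  + exact: bounded_comp Vb (induced_bounded hT K Xx).
  + move=> m y d Xy Dd; rewrite Vg // induced_inc // Vg; [|exact: fiber_smul|by []].
    by rewrite rep_smul.
have Ti n (x : pow X n) u : fib n x -> T n x (iota u) = iota (Z n x u).
  exact: (compressionE il ii hinv).
exists U, Z, V, iota; split=> //; first exact: Vb.1.
split=> //; exists XU => n; apply/(coisometryE (tilde_bounded hZ XU n)) => u.
have [_ iK] := isometry_adj il ii.
(* Under [iota], the range projection of Z in degree [n] becomes [Q_n], which fixes [iota u]. *)
rewrite -[LHS]iK -(tilde_summand hT XH il ii orth hsum TV Ti hZ XU).
by rewrite (perp_range_projE hT hp) // => m y d; exact: perp.
Qed.
End Wold.

(** * From decompositions to relatively isometric representations *)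

Section Backward.
Variables (R : realType) (M : cstarType R) (s : setting M) (X : subproduct_system s).
Local Notation C := (cplx R).
Notation fib n := (@fiber _ _ _ X n).
Variables (H : hilbertType R) (T : op_family X H).
Arguments T : clear implicits.
Hypothesis hT : ccc_rep T.
Variable XH : fiber_tensor T.
Notation tld n := (@tilde _ _ _ _ _ _ XH n).
Notation Q n h := (tld n (adj (tld n) h)).
Local Notation D := (defect_space XH).
Variables (F : fock_module X) (K : htensor (setT : set F) D (rep0 T)).
Notation inc := (fock_inc F).
Variables (U : hilbertType R) (Z : op_family X U) (V : K -> H) (iota : U -> H).
Hypothesis hV : splitting Z V iota.

Let hs : representation (rep0 T) := ccc_rep0 hT.
Let hn : normal_in s (rep0 T) := ccc_normal_in hT.
Let hD : linear_subspace D := defect_linear_subspace XH.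
Let tb n : bounded_op (tld n) := tilde_bounded hT XH n.
Let Vb : bounded_op V. Proof. exact: (isometry_adj (split_V hV) (split_Vi hV)).1. Qed.

Definition fock_vec n (z : pow X n) d : H := V (htensor_map K (inc z) d).

Lemma fock_vec_inner n (z z' : pow X n) d d' : fib n z -> fib n z' -> D d -> D d' ->
  ip (fock_vec z d) (fock_vec z' d') = ip d (rep0 T (minner z z') d').
Proof.
move=> Xz Xz' Dd Dd'; rewrite (isometry_ip (split_V hV) (split_Vi hV)) htensor_ip //.
by rewrite fock_inc_inner.
Qed.

Lemma fock_vec_orth n m (z : pow X n) (z' : pow X m) d d' : n != m ->
  fib n z -> fib m z' -> D d -> D d' -> ip (fock_vec z d) (fock_vec z' d') = 0.
Proof.
move=> /eqP nm Xz Xz' Dd Dd'; rewrite (isometry_ip (split_V hV) (split_Vi hV)) htensor_ip //.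
by rewrite fock_inc_orth // (lin0 (rep_linl hs _)) ip0r.
Qed.

Lemma rep_fock_vec n m (x : pow X n) (z : pow X m) d : fib n x -> fib m z -> D d ->
  T n x (fock_vec z d) = fock_vec (smul x z) d.
Proof.
move=> Xx Xz Dd; rewrite (split_TV hV) // (induced_inc hT) //.
Qed.

Lemma rep0_fock_vec m (z : pow X m) a d : fib m z -> D d ->
  rep0 T a (fock_vec z d) = fock_vec (lact a z) d.
Proof.
move=> Xz Dd; rewrite [LHS]rep_fock_vec ?fiber0 //; congr fock_vec.
apply: (@orth_proj_eq _ _ _ _ (fiber_submodule X m)); rewrite tmul_unitl.
exact: projects_self (fiber_lact _ _).
Qed.

Lemma split_bounded_op (W : normedModType C) (A B : H -> W) :
  bounded_op A -> bounded_op B -> (forall u, A (iota u) = B (iota u)) ->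
  (forall m (z : pow X m) d, fib m z -> D d -> A (fock_vec z d) = B (fock_vec z d)) ->
  A =1 B.
Proof.
move=> Ab Bb hi hv h; have [k [u ->]] := split_sum hV h.
rewrite (linD Ab.1) (linD Bb.1) hi; congr (_ + _); move: k.
by apply: (fock_bounded_op hs hn); [exact: bounded_comp Vb|exact: bounded_comp Vb|].
Qed.

Lemma split_ext (y z : H) : (forall u, ip (iota u) y = ip (iota u) z) ->
  (forall m (w : pow X m) d, fib m w -> D d -> ip (fock_vec w d) y = ip (fock_vec w d) z) ->
  y = z.
Proof.
move=> hi hv; apply: ip_ext => h; rewrite -ipC -[RHS]ipC; congr (_^* ).
move: h; apply: split_bounded_op; try exact: ip_bounded.
  by move=> u; rewrite -ipC hi ipC.
by move=> m w d Xw Dd; rewrite -ipC hv // ipC.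
Qed.

Lemma split_tensor_ext n (y z : XH n) :
  (forall x u, fib n x ->
     ip (htensor_map (XH n) x (iota u)) y = ip (htensor_map (XH n) x (iota u)) z) ->
  (forall x m (w : pow X m) d, fib n x -> fib m w -> D d ->
     ip (htensor_map (XH n) x (fock_vec w d)) y = ip (htensor_map (XH n) x (fock_vec w d)) z) ->
  y = z.
Proof.
move=> hi hv; apply: (htensor_ext (G := XH n)) => x h Xx _.
rewrite -ipC -[RHS]ipC; congr (_^* ).
have xb := fiber_tensor_bounded hT XH Xx.
move: h; apply: split_bounded_op; try exact: bounded_comp (ip_bounded _) xb.
  by move=> u; rewrite -ipC hi // ipC.
by move=> m w d Xw Dd; rewrite -ipC hv // ipC.
Qed.

Lemma range_proj_iota n u : Q n (iota u) = iota u.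
Proof.
have [hZ [XU hc]] := split_Z hV; have tz := tilde_bounded hZ XU n.
rewrite (tilde_summand hT XH (split_iota hV) (split_iotai hV) (split_orth hV)
  (split_sum hV) (split_TV hV) (split_Tiota hV) hZ XU).
by rewrite ((coisometryE tz).1 (hc n)).
Qed.

Lemma fock_vec_iota m (z : pow X m) d u : ip (fock_vec z d) (iota u) = 0.
Proof. exact: split_orth hV _ _. Qed.

Lemma iota_fock_vec m (z : pow X m) d u : ip (iota u) (fock_vec z d) = 0.
Proof. by rewrite -ipC fock_vec_iota conjC0. Qed.

(** T_n maps U into itself and raises degrees by [n], so its range is orthogonal to lower
    degrees. *)
Lemma range_proj_low n N (z : pow X N) d : (N < n)%N -> fib N z -> D d ->
  adj (tld n) (fock_vec z d) = 0.
Proof.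
move=> Nn Xz Dd; apply: split_tensor_ext => [x u Xx|x m w e Xx Xw De].
  by rewrite (ip_adj_tilde hT) // (split_Tiota hV) // iota_fock_vec ip0r.
rewrite (ip_adj_tilde hT) // rep_fock_vec // ip0r fock_vec_orth //.
  by rewrite gtn_eqF // (leq_trans Nn) // leq_addr.
exact: fiber_smul.
Qed.

Section Degree.
Variables n m : nat.

(** The tensor product is formed over all of [pow X (n + m)], since the products [tmul x y] that
    approximate elements of X(n + m) need not lie in it. *)
Lemma products_tensor (G : htensor (setT : set (pow X (n + m)%N)) D (rep0 T)) (k k' : G) d d' z :
  D d -> D d' -> fib (n + m)%N z ->
  (forall x y, fib n x -> fib m y ->
    ip k (htensor_map G (tmul x y) d) = ip k' (htensor_map G (tmul x y) d')) ->
  ip k (htensor_map G z d) = ip k' (htensor_map G z d').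
Proof.
move=> Dd Dd' Xz h; apply: (closure_in_tensor hs hn Dd Dd' (fiber_closure Xz)).
have hl l e : D e -> linear (fun z => ip l (htensor_map G z e) : C^o).
  move=> De c x y; rewrite (htensor_linl G hs (right_submoduleT _)) //.
  by rewrite ipDr ipZr.
move=> a; apply: (eq_lin_span (hl k d Dd) (hl k' d' Dd')) => _ [x [y [Xx Xy ->]]].
exact: h.
Qed.

(* The map [z (x) d |-> tld^* V(z (x) d)], in a form that makes sense on the
   tensor products of elements, which span a dense subspace. *)
Lemma tensor_dilation : exists (G : htensor (setT : set (pow X (n + m)%N)) D (rep0 T))
    (A : G -> XH n), bounded_op A /\ forall x y d, fib n x -> fib m y -> D d ->
  A (htensor_map G (tmul x y) d) = htensor_map (XH n) x (fock_vec y d).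
Proof.
have [D0 _] := hD.
have [G] := @htensor_exists _ _ (pow X (n + m)%N) setT H D (rep0 T) hs I D0.
pose dh d := if pselect (D d) then d else 0.
have Dd d : D (dh d) by rewrite /dh; case: pselect.
have dhE d : D d -> dh d = d by rewrite /dh; case: pselect.
have [|A [Ab Ag _]] := @gram_isometry R (pow X n * pow X m * H) G (XH n)
  (fun p => htensor_map G (tmul (in_fiber p.1.1) (in_fiber p.1.2)) (dh p.2))
  (fun p => htensor_map (XH n) (in_fiber p.1.1) (fock_vec (in_fiber p.1.2) (dh p.2))).
  move=> [[x y] d] [[x' y'] d'] /=; rewrite !htensor_ip //; try exact: in_fiberP.
  rewrite rep0_fock_vec ?fock_vec_inner ?tmul_inner //; try exact: in_fiberP.
  by apply: fiber_lact; exact: in_fiberP.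
exists G, A; split=> // x y d Xx Xy De.
by have := Ag (x, y, d); rewrite /= !in_fiberE // dhE.
Qed.

(** Both identities are tested against vectors built from [iota u] and from [V (w (x) e)]. For a
    fixed test vector the sides are matrix coefficients in [z], so products suffice; projecting onto
    X(n + m) is invisible there, because the other argument of the inner product lies in X(n +
    m). *)
Lemma fock_vec_dilation : exists (G : htensor (setT : set (pow X (n + m)%N)) D (rep0 T))
    (A : G -> XH n), [/\ forall x y d, fib n x -> fib m y -> D d ->
      A (htensor_map G (tmul x y) d) = htensor_map (XH n) x (fock_vec y d),
    forall z d, fib _ z -> D d -> tld n (A (htensor_map G z d)) = fock_vec z d &
    forall z d, fib _ z -> D d -> adj (tld n) (fock_vec z d) = A (htensor_map G z d)].
Proof.
have [G [A [Ab Ag]]] := tensor_dilation; exists G, A; split=> // z d Xz Dd.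
  have tAb := bounded_comp (tb n) Ab.
  have hA w k : (forall x y, fib n x -> fib m y ->
      ip w (fock_vec (smul x y) d) = ip k (htensor_map G (tmul x y) d)) ->
      ip w (tld n (A (htensor_map G z d))) = ip k (htensor_map G z d).
    move=> h; rewrite -[tld n _]/((tld n \o A) _) (adjPr tAb).
    apply: (products_tensor Dd Dd Xz) => x y Xx Xy.
    by rewrite -(adjPr tAb) /= Ag // (tildeE hT) // rep_fock_vec // h.
  apply: split_ext => [u|N w e Xw De].
    rewrite iota_fock_vec (hA _ 0) ?ip0l // => x y Xx Xy.
    by rewrite ip0l iota_fock_vec.
  have [e'|ne] := eqVneq N (n + m)%N.
    subst N; rewrite fock_vec_inner // -(htensor_ip G) //; apply: hA => x y Xx Xy.
    rewrite fock_vec_inner //; last exact: fiber_smul.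
    by rewrite htensor_ip // (projects_inner (smul_projects Xx Xy)).
  rewrite fock_vec_orth // (hA _ 0) ?ip0l // => x y Xx Xy.
  by rewrite ip0l fock_vec_orth //; exact: fiber_smul.
have hA w k : (forall x y, fib n x -> fib m y ->
    ip w (htensor_map (XH n) x (fock_vec y d)) = ip k (htensor_map G (tmul x y) d)) ->
    ip w (A (htensor_map G z d)) = ip k (htensor_map G z d).
  move=> h; rewrite (adjPr Ab); apply: (products_tensor Dd Dd Xz) => x y Xx Xy.
  by rewrite -(adjPr Ab) Ag // h.
apply: split_tensor_ext => [x u Xx|x N w e Xx Xw De].
  rewrite (ip_adj_tilde hT) // (split_Tiota hV) // iota_fock_vec.
  rewrite (hA _ 0) ?ip0l // => x' y Xx' Xy.
  by rewrite htensor_ip // rep0_fock_vec // iota_fock_vec ip0l.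
rewrite (ip_adj_tilde hT) // rep_fock_vec //; have Xxw := fiber_smul Xx Xw.
have [e'|ne] := eqVneq N m.
  subst N; rewrite fock_vec_inner // (hA _ (htensor_map G (tmul x w) e)) // => [|x' y Xx' Xy].
    by rewrite htensor_ip // -minnerC (projects_inner (smul_projects Xx Xw)) // minnerC.
  rewrite !htensor_ip // rep0_fock_vec // fock_vec_inner ?tmul_inner //.
  exact: fiber_lact.
rewrite fock_vec_orth // ?eqn_add2l // (hA _ 0) ?ip0l // => x' y Xx' Xy.
by rewrite htensor_ip // rep0_fock_vec // fock_vec_orth ?ip0l //; exact: fiber_lact.
Qed.
End Degree.

Lemma range_proj_high n N (z : pow X N) d : (n <= N)%N -> fib N z -> D d ->
  Q n (fock_vec z d) = fock_vec z d.
Proof.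
move=> nN; have [m mE] : exists m, N = (n + m)%N by exists (N - n)%N; rewrite subnKC.
subst N => Xz Dd; have [G [A [_ h1 h2]]] := fock_vec_dilation n m.
by rewrite h2 // h1.
Qed.

(** In degree 0 the product [x (x) z] has the form [x a] and lies in X(n), so no projection
    intervenes. This is the source of condition (a). *)
Lemma tilde_bottom n (x : pow X n) (z : pow X 0%N) d : fib n x -> D d ->
  adj (tld n) (T n x (fock_vec z d)) = htensor_map (XH n) x (fock_vec z d).
Proof.
move=> Xx Dd; have X0 : fib 0 z by rewrite fiber0.
have [G [A [h0 _ h2]]] := fock_vec_dilation n 0.
have Xxz : fib (n + 0)%N (tmul x z).
  have [a ->] := tunit_surj z; have [_ _ hr] := fiber_submodule X n.
  (* [n + 0] is not convertible to [n], so membership is transported as a predicate on pairs of a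
     degree and an element. *)
  pose P (u : {m : nat & pow X m}) := fib (tag u) (tagged u).
  suff : P (Tagged (pow X) (tmul x (tunit X a))) by [].
  rewrite tmul_unitr; exact: hr.
rewrite rep_fock_vec // h2 ?h0 //; last exact: fiber_smul.
by rewrite /smul (orth_proj_eq (fiber_submodule X _) (projects_self Xxz)) h0.
Qed.

Lemma range_proj_idem n h : Q n (Q n h) = Q n h.
Proof.
have Qb := range_proj_bounded hT XH n.
move: h; apply: split_bounded_op => [||u|N z d Xz Dd].
- exact: (bounded_comp Qb Qb).
- exact: Qb.
- by rewrite !range_proj_iota.
- have [nN|Nn] := leqP n N; first by rewrite !range_proj_high.
  by rewrite range_proj_low // (lin0 (tb n).1) (lin0 (adj_linear (tb n))) (lin0 (tb n).1).
Qed.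

(** Idempotence of [Q_n] is enough: [Q_n h - h] is killed by [Q_n], hence by [t_n^*], so
    [t_n^* Q_n = t_n^*], and taking adjoints gives [Q_n t_n = t_n]. *)
Lemma splitting_partial_isometry n : partial_isometry (tld n).
Proof.
apply/(partial_isometryE (tb n)) => z; apply: ip_ext => h.
rewrite -(range_proj_sym hT) !(adjPr (tb n)); congr (ip _ z).
apply/eqP; rewrite -subr_eq0 -(linB (adj_linear (tb n))); apply/eqP/(tilde_adj_ker hT).
have Ql := (range_proj_bounded hT XH n).1.
by rewrite [LHS](linB Ql) range_proj_idem subrr.
Qed.

Lemma splitting_relatively_isometric : relatively_isometric XH.
Proof.
have hp := splitting_partial_isometry; split=> //; left=> n z hz.
exists (tld n z) => //.
apply: (eq_bounded_closure _ _ _ hz (f := adj (tld n) \o tld n) (g := fun z => z)).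
- exact: bounded_comp (adj_bounded (tb n)) (tb n).
- exact: bounded_id.
move=> _ [x [h [Xx ->]]].
have xb := fiber_tensor_bounded hT XH Xx.
have Db : bounded_op (defect_op XH).
  by rewrite (defect_opE hT hp); exact: range_proj_compl_bounded.
have xDb := bounded_comp xb Db.
(* The defect operator vanishes on U and in degrees at least 1, and it is the identity in degree 0,
   where [tilde_bottom] applies. *)
move: h; apply: split_bounded_op.
- exact: bounded_comp (adj_bounded (tb n)) (bounded_comp (tb n) xDb).
- exact: xDb.
- move=> u; rewrite (defect_opE hT hp) range_proj_iota subrr /= (lin0 xb.1).
  by rewrite (lin0 (tb n).1) (lin0 (adj_linear (tb n))).
move=> [|m] w d Xw Dd; rewrite (defect_opE hT hp) /=.
  rewrite range_proj_low // (lin0 (tb 1).1) subr0 (tildeE hT) //.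
  exact: tilde_bottom.
by rewrite range_proj_high // subrr (lin0 xb.1) (lin0 (tb n).1) (lin0 (adj_linear (tb n))).
Qed.

End Backward.

(** * Purity and the coisometric summand *)

Section Purity.
Variables (R : realType) (M : cstarType R) (s : setting M) (X : subproduct_system s).
Notation fib n := (@fiber _ _ _ X n).
Variables (H : hilbertType R) (T : op_family X H).
Arguments T : clear implicits.
Hypothesis hT : ccc_rep T.
Variable XH : fiber_tensor T.
Notation tld n := (@tilde _ _ _ _ _ _ XH n).
Notation Q n h := (tld n (adj (tld n) h)).
Variables (F : fock_module X) (K : htensor (setT : set F) (defect_space XH) (rep0 T)).
Variables (U : hilbertType R) (Z : op_family X U) (V : K -> H) (iota : U -> H).
Hypothesis hV : splitting Z V iota.

Lemma pure_summand0 : pure_rep XH -> forall u : U, u = 0.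
Proof.
move=> hp u; apply: nrm_eq0; rewrite -(split_iotai hV); apply/eqP.
have /convP h := hp (iota u).
suff -> : iota u = 0 by rewrite nrm0.
apply: (conv_uniq _ h).
rewrite (_ : (fun n => _) = fun=> iota u); first exact: conv_cst.
by apply/funext => n; rewrite (range_proj_iota hT hV).
Qed.

Lemma summand0_pure : (forall u : U, u = 0) -> pure_rep XH.
Proof.
move=> U0 h; apply/convP; have hp := splitting_partial_isometry hT hV.
have Q1 n k : nrm (Q n k) <= nrm k.
  have tb := tilde_bounded hT XH n; have t1 := partial_isometry_contr tb (hp n).
  apply: le_trans (t1 _) _; rewrite -[leRHS]mul1r; apply: adj_bound => // z.
  by rewrite mul1r.
pose G := [set z | exists m (y : pow X m) d,
  [/\ fib m y, defect_space XH d & z = fock_vec V y d]].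
have Gh : closure (lin_span G) h.
  suff -> : closure (lin_span G) = setT by [].
  apply: dense_of_orth => k hk; apply: (split_ext hT hV) => [u|m w d Xw Dd].
    by rewrite (U0 u) (lin0 (split_iota hV)) !ip0l.
  by rewrite hk ?ip0r //; exists m, w, d.
have Gs g : lin_span G g -> conv (fun n => Q n g) 0.
  move: g; apply: lin_spanP => [|c _ g [m [y [d [Xy Dd ->]]]] hg].
    rewrite (_ : (fun n => _) = fun=> 0); first exact: conv_cst.
    by apply/funext => n; rewrite (lin0 (range_proj_bounded hT XH n).1).
  have h1 : conv (fun n => Q n (fock_vec V y d)) 0.
    move=> e e0; exists m.+1 => n mn; rewrite (range_proj_low hT hV) //.
    by rewrite (lin0 (tilde_bounded hT XH n).1) subrr nrm0.
  have := convD (conv_scale c h1) hg; rewrite scaler0 addr0; congr conv.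
  by apply/funext => n; rewrite (range_proj_bounded hT XH n).1.
move=> e e0; have e2 : 0 < e / 2 by rewrite divr_gt0.
have [g Gg hg] := (closureP _ h).1 Gh _ e2; have [N hN] := Gs g Gg _ e2.
exists N => n /hN; rewrite !subr0 => hn.
rewrite -(subrK g h) (linD (range_proj_bounded hT XH n).1) (splitr e).
by apply: le_lt_trans (nrmD _ _) (ltrD _ hn); apply: le_lt_trans (Q1 _ _) _; rewrite nrmBC.
Qed.
End Purity.

Theorem theorem3p7 (R : realType) (M : cstarType R) (s : setting M)
    (X : subproduct_system s) (H : hilbertType R) (T : op_family X H)
    (hT : ccc_rep T)
    (XH : fiber_tensor T) (F : fock_module X)
    (K : htensor (setT : set F) (defect_space XH) (rep0 T)) :
  (relatively_isometric XH <->
     exists (U : hilbertType R) (W : H -> K * U) (Z : op_family X U),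
       wold_decomposition W Z) /\
  (relatively_isometric XH ->
     ((exists (U : hilbertType R) (W : H -> K * U) (Z : op_family X U),
         wold_decomposition W Z /\ forall u : U, u = 0%R) <->
      pure_rep XH)).
Proof.
split; first split.
- move=> /(relatively_isometric_splitting hT K)[U [Z [V [iota hV]]]].
  by have [W hW] := splitting_wold hT hV; exists U, W, Z.
- move=> [U [W [Z /(wold_splitting hT)[V [iota hV]]]]].
  exact: (splitting_relatively_isometric hT hV).
(* The first implication concerns any decomposition with trivial coisometric summand; for the
   second, purity forces that summand of the constructed decomposition to vanish. *)
- move=> /(relatively_isometric_splitting hT K)[U [Z [V [iota hV]]]]; split.
    move=> [U' [W [Z' [/(wold_splitting hT)[V' [iota' hV']] U0]]]].
    exact: (summand0_pure hT hV' U0).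
  move=> hp; have [W hW] := splitting_wold hT hV.
  by exists U, W, Z; split=> //; exact: (pure_summand0 hT hV hp).
Qed.
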